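(* Let $n\ge1$ and $G=\operatorname{U}(n)\times\{1\}$. Let $\mathfrak I_0:V\to\mathfrak{gl}(V)/\mathfrak g$, $\mathfrak I_0\neq0$, be a $G$-equivariant inner torsion with normal form parameters $(a,b,\alpha,\beta,\gamma,\delta)\in\mathbb R^6$, and let $R_0:\Lambda^2V\to\mathfrak{gl}(V)$ be a $G$-equivariant curvature candidate, given by $c_0,c_1,c_2,c_3,c_4\in\mathbb R$ and $B\in\operatorname{Hom}_{\operatorname{U}(n)}(\Lambda^2H_0,\mathfrak{gl}(H_0))$. Then $(R_0,\mathfrak I_0)$ are the curvature and inner torsion characteristic tensors of a torsion-free infinitesimally homogeneous affine manifold with $G$-structure if and only if $\delta(\alpha-a)=0$ and exactly one of the following holds: (i) $\alpha=a$; the coefficients are $$c_1=a(b-a)+\beta^2,\quad c_2=\beta(b-2a),\quad c_3=(a-b)\gamma+\beta\delta,\quad c_4=(a-b)\delta-\beta\gamma,\quad c_0=2c_4,$$ and there exists $\kappa\in\mathbb R$ such that, for $X,Y,Z\in H_0$, with $P(X)=aX+\beta J_0X$ and $Q(X)=\gamma X+\delta J_0X$, $$B(X,Y)Z=h_0(Q(Y),Z)P(X)-h_0(Q(X),Z)P(Y)-2a\delta\,\omega_0(X,Y)Z-2\beta\delta\,\omega_0(X,Y)J_0Z+\kappa K_{X,Y}Z.$$ Here $(a,b,\beta,\gamma,\delta,\kappa)$ are arbitrary, subject only to $(a,b,\beta,\gamma,\delta)\neq0$; (ii) $\alpha\neq a$; then $\delta=0$, the coefficients are $$c_1=-\alpha^2+b\alpha+\beta^2,\quad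 c_2=\beta(b-2\alpha),\quad c_3=(2a-\alpha-b)\gamma,\quad c_4=-\beta\gamma,\quad c_0=-2\beta\gamma=2c_4,$$ and, with $P(X)=\alpha X+\beta J_0X$, $$B(X,Y)Z=\gamma\bigl(h_0(Y,Z)P(X)-h_0(X,Z)P(Y)\bigr).$$ Here $(a,b,\alpha,\beta,\gamma)$ are arbitrary with $a\neq\alpha$.
   Context: Let $V$ be a finite-dimensional real vector space and $G\subseteq\operatorname{GL}(V)$ a Lie subgroup with Lie algebra $\mathfrak g\subseteq\mathfrak{gl}(V)$. A $G$-structure on a smooth manifold $M$ with $\dim M=\dim V$ is a principal $G$-subbundle $P$ of the frame bundle $\operatorname{FR}(TM)$; elements $p\in P_x$ are linear isomorphisms $p:V\to T_xM$, and two frames in $P_x$ differ by right composition with an element of $G$. An affine manifold with $G$-structure is a triple $(M,\nabla,P)$ with $\nabla$ an affine connection on $M$ and $P$ a $G$-structure. Put $T(X,Y)=\nabla_XY-\nabla_YX-[X,Y]$ and $R(X,Y)=\nabla_X\nabla_Y-\nabla_Y\nabla_X-\nabla_{[X,Y]}$. Inner torsion: for a local section $s:U\to P$ define $\Lambda^s_x(u)\in\mathfrak{gl}(V)$ by $\nabla_{s(x)u}(s\,w)=s(x)(\Lambda^s_x(u)w)$ for $u,w\in V$, where $s\,w$ is the vector field $x\mapsto s(x)w$. With $\mathfrak g_x=\operatorname{Ad}_p(\mathfrak g)$ for any $p\in P_x$ and $\overline{\operatorname{Ad}}_p:\mathfrak{gl}(V)/\mathfrak g\to\mathfrak{gl}(T_xM)/\mathfrak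 g_x$ induced by conjugation by $p$, the inner torsion is $\mathfrak I^P_x:T_xM\to\mathfrak{gl}(T_xM)/\mathfrak g_x$, $\mathfrak I^P_x(s(x)u)=\overline{\operatorname{Ad}}_{s(x)}(\Lambda^s_x(u)+\mathfrak g)$ (independent of $s$). $(M,\nabla,P)$ is infinitesimally homogeneous if there are linear maps $T_0:\Lambda^2V\to V$, $R_0:\Lambda^2V\to\mathfrak{gl}(V)$, $\mathfrak I_0:V\to\mathfrak{gl}(V)/\mathfrak g$ (the characteristic tensors) with $T_x(pu,pv)=p\,T_0(u,v)$, $R_x(pu,pv)pw=p\,R_0(u,v)w$, $\mathfrak I^P_x(pu)=\overline{\operatorname{Ad}}_p(\mathfrak I_0(u))$ for all $x\in M$, $p\in P_x$, $u,v,w\in V$. A lift of $\mathfrak I_0$ is a linear map $\lambda:V\to\mathfrak{gl}(V)$ with $\mathfrak I_0(u)=\lambda(u)+\mathfrak g$. Here $V=H_0\oplus\mathbb Re$, where $H_0\simeq\mathbb R^{2n}$ has its standard Euclidean metric $h_0$, standard complex structure $J_0$ and $\omega_0(X,Y)=h_0(J_0X,Y)$. $G=\operatorname{U}(n)\times\{1\}\subset\operatorname{GL}(V)$ acts on $H_0$ by the standard real representation of $\operatorname{U}(n)$ and fixes $e$; $\mathfrak g=\mathfrak u(n)\oplus\{0\}$. Write $Z^\flat=h_0(Z,\cdot)$; matrices are with respect to $V=H_0\oplus\mathbb Re$. Normal form of $\mathfrak I_0$: every $G$-equivariant $\mathfrak I_0$ has a lift, with uniquely determined parameters, $$\lambda(X+se)=\begin{pmatrix}as\,\operatorname{Id}_{H_0}&\alpha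 X+\beta J_0X\\(\gamma X+\delta J_0X)^\flat&bs\end{pmatrix},\quad X\in H_0,\ s\in\mathbb R.$$ Normal form of a $G$-equivariant $R_0$: for $X,Y\in H_0$, $$R_0(X,e)=\begin{pmatrix}0&c_1X+c_2J_0X\\(c_3X+c_4J_0X)^\flat&0\end{pmatrix},\qquad R_0(X,Y)=\begin{pmatrix}B(X,Y)&0\\0&c_0\,\omega_0(X,Y)\end{pmatrix}.$$ For $X,Y,Z\in H_0$, $$K_{X,Y}Z=\tfrac14\bigl(h_0(Y,Z)X-h_0(X,Z)Y+\omega_0(Y,Z)J_0X-\omega_0(X,Z)J_0Y-2\omega_0(X,Y)J_0Z\bigr).$$ *)

(* Defs.v *)
From HB Require Import structures.
From mathcomp Require Import all_boot all_order all_algebra.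
From mathcomp Require Import all_classical all_reals all_analysis.
Import numFieldNormedType.Exports.

Set Implicit Arguments.
Unset Strict Implicit.
Unset Printing Implicit Defensive.

Import Order.TTheory GRing.Theory Num.Theory.
Local Open Scope classical_set_scope.
Local Open Scope ring_scope.

Section Smooth.
Context {R : realType} {V W : normedModType R}.

(* Only used for open [U] and finite-dimensional [V], where this is C^k. *)
Fixpoint Ck_on (k : nat) (U : set V) (f : V -> W) : Prop :=
  match k with
  | 0 => forall x, U x -> {for x, continuous f}
  | k'.+1 => (forall x, U x -> differentiable f x) /\
             forall v : V, Ck_on k' U (fun x => 'D_v f x)
  end.

Definition smooth_on (U : set V) (f : V -> W) : Prop :=
  forall k, Ck_on k U f.

End Smooth.

(* A smooth atlas determines the smooth structure, so it need not be maximal.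
   [chart i] and [cochart i] are only meaningful on [dom i] and on its image. *)
Record manifold (R : realType) (m : nat) := Manifold {
  carrier :> topologicalType;
  carrier_nonempty : inhabited carrier;
  carrier_hausdorff : hausdorff_space carrier;
  carrier_second_countable : @second_countable carrier;
  idx : Type;
  dom : idx -> set carrier;
  chart : idx -> carrier -> 'cV[R]_m;
  cochart : idx -> 'cV[R]_m -> carrier;
  dom_cover : forall x, exists i, dom i x;
  dom_open : forall i, open (dom i);
  chart_open : forall i, open (chart i @` dom i);
  chartK : forall i x, dom i x -> cochart i (chart i x) = x;
  chart_continuous : forall i x, dom i x -> {for x, continuous (chart i)};
  cochart_continuous : forall i y, (chart i @` dom i) y ->
    {for y, continuous (cochart i)};
  transition_smooth : forall i j,
    smooth_on (chart i @` (dom i `&` dom j)) (chart j \o cochart i) }.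

Section Tangent.
Context {R : realType} {m : nat} {M : manifold R m}.
Local Notation E := ('cV[R]_m).

(* A tangent vector at [x] is the family of its components in the charts around
   [x], related by the differentials of the transition maps; the components in
   charts not containing [x] are set to 0. *)
Definition is_tangent (x : M) : {pred (idx M -> E)} := fun v =>
  `[< (forall i, ~ dom i x -> v i = 0) /\
      (forall i j, dom i x -> dom j x ->
         v j = 'd (chart j \o cochart i) (chart i x) (v i)) >].

Lemma is_tangent_submod (x : M) : submod_closed (is_tangent x).
Proof.
split.
  by apply/asboolP; split=> // i j _ _; rewrite raddf0.
move=> a u v /asboolP[u0 uT] /asboolP[v0 vT]; apply/asboolP; split.
  by move=> i xi; rewrite /GRing.add /GRing.scale /= u0// v0// scaler0 addr0.
move=> i j xi xj; rewrite /GRing.add /GRing.scale /= linearP.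
by rewrite (uT i j)// (vT i j).
Qed.

HB.instance Definition _ (x : M) :=
  GRing.isSubmodClosed.Build R (idx M -> E) (is_tangent x)
    (is_tangent_submod x).

Record tangent (x : M) := Tangent {
  coords :> idx M -> E;
  coordsP : coords \in is_tangent x }.

HB.instance Definition _ (x : M) := [isSub for @coords x].
HB.instance Definition _ (x : M) := [Choice of tangent x by <:].
HB.instance Definition _ (x : M) :=
  [SubChoice_isSubLmodule of tangent x by <:].

(* Functions, vector fields and frame fields are total; those which are
   smooth on an open set [U] play the role of the local ones over [U], and
   their values outside [U] are irrelevant. *)
Definition vfield := forall x : M, tangent x.

Definition smooth_fun (U : set M) (f : M -> R) : Prop :=
  forall i, smooth_on (chart i @` (U `&` dom i)) (f \o cochart i).

Definition smooth_field (U : set M) (X : vfield) : Prop :=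
  forall i, smooth_on (chart i @` (U `&` dom i)) (fun y => X (cochart i y) i).

(* [smooth_at x X]: smooth on a neighbourhood of [x], and similarly for
   functions. *)
Definition smooth_at (x : M) (X : vfield) : Prop :=
  exists U, [/\ open U, U x & smooth_field U X].

Definition smooth_fun_at (x : M) (f : M -> R) : Prop :=
  exists U, [/\ open U, U x & smooth_fun U f].

(* [X, Y] is DY(X) - DX(Y) in every chart. For fields smooth near [x] this
   family of components satisfies [is_tangent x], so [insubd] never takes its
   default value. *)
Definition bracket (X Y : vfield) : vfield := fun x =>
  insubd (0 : tangent x) (fun i => if `[< dom i x >] then
      'd (fun y => Y (cochart i y) i) (chart i x) (X x i)
    - 'd (fun y => X (cochart i y) i) (chart i x) (Y x i)
    else 0).

End Tangent.
Arguments vfield {R m} M.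

(* [nabla v Y] is the covariant derivative at [x] of the local vector field
   [Y] in the direction [v]. *)
Record connection (R : realType) (m : nat) (M : manifold R m) := Connection {
  nabla :> forall x : M, tangent x -> vfield M -> tangent x;
  nabla_linear : forall (x : M) (Y : vfield M), smooth_at x Y ->
    linear (fun v : tangent x => nabla v Y);
  nabla_local : forall (x : M) (v : tangent x) (Y Z : vfield M),
    smooth_at x Y -> (\forall y \near x, Y y = Z y) -> nabla v Y = nabla v Z;
  nabla_add : forall (x : M) (v : tangent x) (Y Z : vfield M),
    smooth_at x Y -> smooth_at x Z ->
    nabla v (fun y => Y y + Z y) = nabla v Y + nabla v Z;
  nabla_leibniz : forall (x : M) (v : tangent x) (f : M -> R) (Y : vfield M) i,
    smooth_fun_at x f -> smooth_at x Y -> dom i x ->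
    nabla v (fun y => f y *: Y y) =
      'd (f \o cochart i) (chart i x) (v i) *: Y x + f x *: nabla v Y;
  nabla_smooth : forall (U : set M) (X Y : vfield M), open U ->
    smooth_field U X -> smooth_field U Y ->
    smooth_field U (fun x => nabla (X x) Y) }.

Section TorsionCurvature.
Context {R : realType} {m : nat} {M : manifold R m} (D : connection M).

Definition torsion (X Y : vfield M) : vfield M := fun x =>
  D x (X x) Y - D x (Y x) X - bracket X Y x.

Definition curvature (X Y Z : vfield M) : vfield M := fun x =>
  D x (X x) (fun y => D y (Y y) Z) - D x (Y x) (fun y => D y (X y) Z)
  - D x (bracket X Y x) Z.

Definition torsion_free : Prop :=
  forall (x : M) (X Y : vfield M), smooth_at x X -> smooth_at x Y ->
    torsion X Y x = 0.

End TorsionCurvature.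

Section LinearAlgebra.
Context {R : realType}.

(* Linear maps from the exterior square are alternating bilinear maps. *)
Definition alternating_bilinear (V W : lmodType R) (F : V -> V -> W) : Prop :=
  [/\ forall u, linear (F u), forall v, linear (F^~ v) & forall u, F u u = 0].

Context {m : nat}.
Local Notation V := ('cV[R]_m).
Local Notation gl := ('M[R]_m).

(* Elements of gl(V)/g are the cosets A + g, as subsets of gl(V). *)
Definition coset (g : set gl) (A : gl) : set gl := [set A + C | C in g].

(* Linear maps V -> gl(V)/g; for a subspace [g], the second clause is linearity
   for the vector space structure of gl(V)/g, written on representatives. *)
Definition quot_linear (g : set gl) (I0 : V -> set gl) : Prop :=
  (forall u, exists A, I0 u = coset g A) /\
  (forall (c : R) u v A B, I0 u A -> I0 v B -> I0 (c *: u + v) (c *: A + B)).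

Definition quot_equivariant (G : set gl) (I0 : V -> set gl) : Prop :=
  forall k u, G k -> I0 (k *m u) = [set k *m A *m invmx k | A in I0 u].

(* Equivariance of a map from the exterior square to gl(V). *)
Definition equivariant2 (G : set gl) (F : V -> V -> gl) : Prop :=
  forall k u v, G k -> F (k *m u) (k *m v) = k *m F u v *m invmx k.

End LinearAlgebra.

Section GStructures.
Context {R : realType} {m : nat} {M : manifold R m}.
Local Notation V := ('cV[R]_m).
Local Notation gl := ('M[R]_m).

(* [s y w] is the image of [w] under the frame at [y]. *)
Definition frame_field := forall y : M, V -> tangent y.

Definition smooth_section (P : forall x : M, set (V -> tangent x))
    (U : set M) (s : frame_field) : Prop :=
  [/\ open U, forall y, U y -> P y (s y) &
      forall w, smooth_field U (fun y => s y w)].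

End GStructures.
Arguments frame_field {R m} M.

(* A principal G-subbundle of the frame bundle: fibres are G-orbits of frames,
   and smooth local sections exist around every point. *)
Record Gstructure (R : realType) (m : nat) (M : manifold R m)
    (G : set 'M[R]_m) := GStructure {
  frames :> forall x : M, set ('cV[R]_m -> tangent x);
  frames_iso : forall x p, @frames x p -> linear p /\ bijective p;
  frames_torsor : forall x p q, @frames x p ->
    @frames x q <-> exists2 k, G k & q = (fun w => p (k *m w));
  frames_section : forall x, exists U s, U x /\ smooth_section (@frames) U s }.

Section InnerTorsion.
Context {R : realType} {m : nat} {M : manifold R m}.
Context (D : connection M) (G g : set 'M[R]_m) (P : Gstructure M G).
Local Notation V := ('cV[R]_m).
Local Notation gl := ('M[R]_m).

(* Image in gl(T_x M)/g_x of a coset of gl(V)/g under conjugation by the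
   isomorphism [p]. *)
Definition Adbar (x : M) (p : V -> tangent x) (C : set gl) :
    set (tangent x -> tangent x) :=
  [set F | exists2 A, C A & forall w, F (p w) = p (A *m w)].

(* [L] is the local connection form at [x] of the section [s]. *)
Definition connection_form (s : frame_field M) (x : M) (L : V -> gl) : Prop :=
  forall u w, D x (s x u) (fun y => s y w) = s x (L u *m w).

(* The coset is independent of the local section [s], so the union over all [s]
   is again that single coset. *)
Definition inner_torsion (x : M) (v : tangent x) :
    set (tangent x -> tangent x) :=
  [set F | exists U s L u, [/\ smooth_section P U s, U x,
     connection_form s x L, v = s x u & Adbar (s x) (coset g (L u)) F]].

Definition characteristic_tensors (T0 : V -> V -> V) (R0 : V -> V -> gl)
    (I0 : V -> set gl) : Prop :=
  [/\ alternating_bilinear T0 /\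
      (forall x p (X Y : vfield M) u v, P x p -> smooth_at x X ->
        smooth_at x Y -> X x = p u -> Y x = p v ->
        torsion D X Y x = p (T0 u v)),
      alternating_bilinear R0 /\
      (forall x p (X Y Z : vfield M) u v w, P x p -> smooth_at x X ->
        smooth_at x Y -> smooth_at x Z -> X x = p u -> Y x = p v ->
        Z x = p w -> curvature D X Y Z x = p (R0 u v *m w)) &
      quot_linear g I0 /\
      (forall x p u, P x p -> inner_torsion (p u) = Adbar p (I0 u))].

End InnerTorsion.

Section UnitaryData.
Context {R : realType} {n : nat}.
Local Notation H := ('cV[R]_(n + n)).
Local Notation V := ('cV[R]_(n + n + 1)).
Local Notation glH := ('M[R]_(n + n)).
Local Notation gl := ('M[R]_(n + n + 1)).

Definition J0 : glH := block_mx 0 (- 1%:M) 1%:M 0.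
Definition h0 (X Y : H) : R := (X^T *m Y) 0 0.
Definition omega0 (X Y : H) : R := h0 (J0 *m X) Y.

Definition vec (X : H) (s : R) : V := col_mx X s%:M.
Definition e0 : V := vec 0 1.

(* The row [X^T] is the matrix of h0(X, _). *)
Definition flat (X : H) : 'rV[R]_(n + n) := X^T.

Definition Un : set glH :=
  [set A | A^T *m A = 1%:M /\ A *m J0 = J0 *m A].
Definition un : set glH :=
  [set A | A^T = - A /\ A *m J0 = J0 *m A].

Definition Un1 : set gl := [set block_mx A 0 0 1%:M | A in Un].
Definition un0 : set gl := [set block_mx A 0 0 0 | A in un].

Definition lambda_nf (a b alpha beta gamma delta : R) (X : H) (s : R) : gl :=
  block_mx (a * s)%:M (alpha *: X + beta *: (J0 *m X))
           (flat (gamma *: X + delta *: (J0 *m X))) (b * s)%:M.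

Definition inner_torsion_nf (I0 : V -> set gl)
    (a b alpha beta gamma delta : R) : Prop :=
  forall X s, I0 (vec X s) = coset un0 (lambda_nf a b alpha beta gamma delta X s).

Definition curvature_nf (R0 : V -> V -> gl) (c0 c1 c2 c3 c4 : R)
    (B : H -> H -> glH) : Prop :=
  (forall X, R0 (vec X 0) e0 =
     block_mx 0 (c1 *: X + c2 *: (J0 *m X))
              (flat (c3 *: X + c4 *: (J0 *m X))) 0) /\
  (forall X Y, R0 (vec X 0) (vec Y 0) =
     block_mx (B X Y) 0 0 (c0 * omega0 X Y)%:M).

Definition Kop (X Y Z : H) : H :=
  4^-1 *: (h0 Y Z *: X - h0 X Z *: Y
           + omega0 Y Z *: (J0 *m X) - omega0 X Z *: (J0 *m Y)
           - (2 * omega0 X Y) *: (J0 *m Z)).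

Definition case_i (a b alpha beta gamma delta c0 c1 c2 c3 c4 : R)
    (B : H -> H -> glH) : Prop :=
  let P X := a *: X + beta *: (J0 *m X) in
  let Q X := gamma *: X + delta *: (J0 *m X) in
  [/\ alpha = a,
      ~ [/\ a = 0, b = 0, beta = 0, gamma = 0 & delta = 0],
      [/\ c1 = a * (b - a) + beta ^+ 2,
          c2 = beta * (b - 2 * a),
          c3 = (a - b) * gamma + beta * delta,
          c4 = (a - b) * delta - beta * gamma &
          c0 = 2 * c4] &
      exists kappa : R, forall X Y Z : H,
        B X Y *m Z = h0 (Q Y) Z *: P X - h0 (Q X) Z *: P Y
          - (2 * a * delta * omega0 X Y) *: Z
          - (2 * beta * delta * omega0 X Y) *: (J0 *m Z)
          + kappa *: Kop X Y Z].

Definition case_ii (a b alpha beta gamma delta c0 c1 c2 c3 c4 : R)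
    (B : H -> H -> glH) : Prop :=
  let P X := alpha *: X + beta *: (J0 *m X) in
  [/\ alpha <> a,
      delta = 0,
      [/\ c1 = - alpha ^+ 2 + b * alpha + beta ^+ 2,
          c2 = beta * (b - 2 * alpha),
          c3 = (2 * a - alpha - b) * gamma,
          c4 = - (beta * gamma) &
          c0 = - (2 * beta * gamma) /\ c0 = 2 * c4] &
      forall X Y Z : H,
        B X Y *m Z = gamma *: (h0 Y Z *: P X - h0 X Z *: P Y)].

End UnitaryData.

(* Main.v *)
Require Import Defs.
From HB Require Import structures.
From mathcomp Require Import all_boot all_order all_algebra.
From mathcomp Require Import all_classical all_reals all_analysis.
From mathcomp Require Import ring lra.
Import numFieldNormedType.Exports.

(** A connection with a structure of group [G] is described, in a chart and a local
    section, by the matrix [th] of the coframe dual to the section and by the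
    matrix-valued connection form [om]. Vanishing torsion, constant curvature and
    constant inner torsion turn into Cartan's structure equations, collected in
    [cartan_structure]:
    [d th + om /\ th = 0], [d om + om /\ om = R0 (th, th)], and [om] is the lift of
    the inner torsion applied to [th] up to a form with values in the Lie algebra.
    A homogeneous manifold gives a solution near any point
    ([cartan_of_manifold]). Conversely a solution near one point gives a manifold
    directly, namely a ball with a single chart ([manifold_of_cartan]), so the
    theorem is a statement about the constants for which the structure equations
    have a local solution.

    Necessity ([cartan_necessary]). Write [om = lambda (th) + Gamma] with [Gamma]
    unitary. The curvature of [lambda (th)] is the explicit tensor [base_curv], and
    the equations show that [R0 - base_curv] has values in the unitary Lie
    algebra. Its transverse blocks therefore vanish, which gives [c0], ..., [c4].
    The first Bianchi identity on [X], [J X], [e] gives [c0 = 2 c4], and comparing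
    with the formulas just found, [delta (alpha - a) = 0]. What remains is the
    unitary part of [B]; after the correction [2 beta delta omega0 J] it has the
    symmetries of a Kaehler curvature tensor and is invariant under U(n). The
    unitary group is transitive on unit vectors, so the holomorphic sectional
    curvature is a constant [kappa], and a Kaehler curvature tensor is determined
    by its holomorphic sectional curvatures ([invariant_kahler_curvature]). If
    [alpha <> a], the form [tr (J Gamma)] is a potential of a multiple of
    [kappa omega0 (th, th)]; that two-form is rescaled along [e] with speed
    [2 (alpha - a)], so it can only be closed when [kappa = 0].

    Sufficiency. In both cases the solution is explicit. For [alpha = a] it lives
    on the product of a complex space form of holomorphic sectional curvature
    [kappa] and a line, with the vertical coframe twisted by a potential of the
    Kaehler form ([kahler_model_cartan]); for [alpha <> a] it is a flat coframe
    divided by an affine function of the last coordinate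
    ([nonkahler_model_cartan]). The two cases exclude each other because they
    disagree on [alpha = a]. *)

Set Implicit Arguments.
Unset Strict Implicit.
Unset Printing Implicit Defensive.

Import Order.TTheory GRing.Theory Num.Theory.
Local Open Scope classical_set_scope.
Local Open Scope ring_scope.

(** * Smooth functions on open sets *)

Section DirectionalDerivatives.
Context {R : realType} {V W : normedModType R}.

Lemma open_near (T : topologicalType) (U : set T) x : open U -> U x ->
  \forall y \near x, U y.
Proof. by move=> oU Ux; apply: open_nbhs_nbhs. Qed.

Lemma derive_linear (f : V -> W) (x : V) (a : R) (u v : V) :
  differentiable f x -> 'D_(a *: u + v) f x = a *: 'D_u f x + 'D_v f x.
Proof. by move=> df; rewrite !deriveE// linearP. Qed.

Lemma derive_on (U : set V) (f g : V -> W) (x v : V) : open U -> U x ->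
  {in U, f =1 g} -> 'D_v f x = 'D_v g x.
Proof.
move=> oU Ux fg; apply: near_eq_derive; near=> y; apply: fg.
by rewrite inE; near: y; apply: open_near.
Unshelve. all: by end_near. Qed.

Lemma near_differentiable (f g : V -> W) (x : V) :
  (\forall y \near x, f y = g y) -> differentiable f x -> differentiable g x.
Proof.
move=> fg df; have fgx := nbhs_singleton fg.
have go : g \o shift x = cst (g x) + 'd f x +o_ 0 id.
  apply/eqaddoP => e e0; have := diff_locally df; move/eqaddoP => /(_ e e0) fo.
  have fg0 : \forall h \near (0 : V), f (h + x) = g (h + x).
    have cx : (fun h : V => h + x) @ (0 : V) --> x.
      by rewrite -[X in _ --> X]add0r; apply: cvgD; [exact: cvg_id|exact: cvg_cst].
    exact: (cx _ fg).
  by apply: filterS2 fo fg0 => h + E; rewrite -fgx -[X in X -> _]/(is_true (`|f (h + x) - _| <= _)) E.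
have cf : continuous ('d f x) by exact: diff_continuous.
by apply/diff_locallyP; rewrite (diff_unique cf go).
Qed.

Lemma differentiable_on (U : set V) (f g : V -> W) (x : V) : open U -> U x ->
  {in U, f =1 g} -> differentiable f x -> differentiable g x.
Proof.
move=> oU Ux fg; apply: near_differentiable; near=> y; apply: fg.
by rewrite inE; near: y; apply: open_near.
Unshelve. all: by end_near. Qed.

(** Brackets and derivatives of functions in charts use the differential, models
    and structure equations use directional derivatives; both only see germs. *)
Lemma near_diff (f g : V -> W) (x v : V) :
  (\forall y \near x, f y = g y) -> differentiable f x -> 'd f x v = 'd g x v.
Proof.
move=> fg df; have dg := near_differentiable fg df.
by rewrite -!deriveE//; apply: near_eq_derive.
Qed.

End DirectionalDerivatives.

Section SmoothBasics.
Context {R : realType} {V W : normedModType R}.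
Implicit Types (U : set V) (f g : V -> W) (k : nat).

Lemma Ck_onW k U f : Ck_on k.+1 U f -> Ck_on k U f.
Proof.
elim: k f => [|k IH] f [df dk].
  by move=> x Ux; apply: differentiable_continuous; apply: df.
by split=> // v; apply: IH; apply: dk.
Qed.

Lemma eq_Ck_on k U f g : open U -> {in U, f =1 g} -> Ck_on k U f -> Ck_on k U g.
Proof.
move=> oU; elim: k f g => [|k IH] f g fg.
  move=> cf x Ux; have gx : g x = f x by rewrite fg// inE.
  rewrite /prop_for /continuous_at gx; apply: cvg_trans (cf _ Ux).
  apply: near_eq_cvg; near=> y; apply: fg; rewrite inE; near: y.
  exact: open_near.
move=> [df dk]; split=> [x Ux|v]; first exact: differentiable_on fg (df _ Ux).
apply: IH (dk v) => x; rewrite inE => Ux; exact: derive_on fg.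
Unshelve. all: by end_near. Qed.

Lemma eq_smooth_on U f g :
  open U -> {in U, f =1 g} -> smooth_on U f -> smooth_on U g.
Proof. by move=> oU fg sf k; apply: eq_Ck_on fg (sf k). Qed.

Lemma subset_smooth_on U U' f : U `<=` U' -> smooth_on U' f -> smooth_on U f.
Proof.
move=> sU sf k; elim: k f {sf}(sf k) => [|k IH] f.
  by move=> cf x /sU; apply: cf.
by move=> [df dk]; split=> [x /sU|v]; [apply: df|apply: IH (dk v)].
Qed.

Lemma smooth_differentiable U f x : smooth_on U f -> U x -> differentiable f x.
Proof. by move=> sf; have [df _] := sf 1; apply: df. Qed.

Lemma smooth_derive U f v : smooth_on U f -> smooth_on U ('D_v f).
Proof. by move=> sf k; have [_] := sf k.+1; apply. Qed.

Lemma Ck_on_cst k U (c : W) : Ck_on k U (fun=> c).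
Proof.
elim: k c => [|k IH] c; first by move=> x _; exact: cvg_cst.
split=> [x _|v]; first exact: differentiable_cst.
have -> : 'D_v (fun=> c) = (fun=> 0) :> (V -> W); last exact: IH.
by apply/funext => x; rewrite derive_cst.
Qed.

Lemma smooth_cst U (c : W) : smooth_on U (fun=> c).
Proof. by move=> k; exact: Ck_on_cst. Qed.

Lemma Ck_onD k U f g : open U ->
  Ck_on k U f -> Ck_on k U g -> Ck_on k U (fun x => f x + g x).
Proof.
move=> oU; elim: k f g => [|k IH] f g.
  by move=> cf cg x Ux; apply: cvgD; [exact: cf|exact: cg].
move=> [df dfk] [dg dgk]; split=> [x Ux|v].
  exact: differentiableD (df _ Ux) (dg _ Ux).
apply: eq_Ck_on (IH _ _ (dfk v) (dgk v)) => // x; rewrite inE => Ux.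
by rewrite -deriveD //; apply: diff_derivable; [exact: df|exact: dg].
Qed.

Lemma smoothD U f g : open U ->
  smooth_on U f -> smooth_on U g -> smooth_on U (fun x => f x + g x).
Proof. by move=> oU sf sg k; apply: Ck_onD. Qed.

Lemma smooth_sum U (I : Type) (r : seq I) (P : pred I) (F : I -> V -> W) :
  open U -> (forall i, P i -> smooth_on U (F i)) ->
  smooth_on U (fun x => \sum_(i <- r | P i) F i x).
Proof.
move=> oU sF; elim: r => [|i r IH].
  by under eq_fun do rewrite big_nil; exact: smooth_cst.
under eq_fun do rewrite big_cons.
case Pi: (P i) => //; exact: smoothD (sF _ Pi) IH.
Qed.

End SmoothBasics.

Section SmoothLinear.
Context {R : realType} {V W W' : normedModType R}.

Lemma linear_post_derive (L : {linear W -> W'}) (f : V -> W) (x v : V) :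
  continuous L -> differentiable f x ->
  'D_v (L \o f) x = L ('D_v f x).
Proof.
move=> cL df; have dL : differentiable L (f x) by exact: linear_differentiable.
rewrite deriveE; last exact: differentiable_comp.
by rewrite diff_comp//= diff_lin// -deriveE.
Qed.

Lemma smooth_linear_post (U : set V) (L : {linear W -> W'}) (f : V -> W) :
  open U -> continuous L -> smooth_on U f -> smooth_on U (L \o f).
Proof.
move=> oU cL sf k; elim: k f {sf}(sf k) => [|k IH] f.
  by move=> cf x Ux; apply: continuous_comp; [exact: cf|exact: cL].
move=> [df dk]; split=> [x Ux|v].
  by apply: differentiable_comp (df _ Ux) _; exact: linear_differentiable.
apply: eq_Ck_on (IH _ (dk v)) => // x; rewrite inE => Ux.
by rewrite linear_post_derive//; exact: df.
Qed.

Lemma smooth_linear (U : set V) (L : {linear V -> W}) :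
  open U -> continuous L -> smooth_on U L.
Proof.
move=> oU cL; case=> [|k]; first by move=> x _; exact: cL.
split=> [x _|v]; first exact: linear_differentiable.
apply: eq_Ck_on (Ck_on_cst k U (L v)) => // x _.
by rewrite deriveE ?diff_lin//; exact: linear_differentiable.
Qed.

End SmoothLinear.

Section SmoothScalar.
Context {R : realType} {V : normedModType R}.
Implicit Types (U : set V) (f g : V -> R).

Lemma Ck_onM k U f g : open U ->
  Ck_on k U f -> Ck_on k U g -> Ck_on k U (fun x => f x * g x).
Proof.
move=> oU; elim: k f g => [|k IH] f g.
  by move=> cf cg x Ux; apply: cvgM; [exact: cf|exact: cg].
move=> Cf Cg; have [df dfk] := Cf; have [dg dgk] := Cg.
split=> [x Ux|v]; first exact: differentiableM (df _ Ux) (dg _ Ux).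
have := Ck_onD oU (IH _ _ (Ck_onW Cf) (dgk v)) (IH _ _ (dfk v) (Ck_onW Cg)).
apply: eq_Ck_on => // x; rewrite inE => Ux.
have dfx : derivable f x v by apply: diff_derivable; exact: df.
have dgx : derivable g x v by apply: diff_derivable; exact: dg.
have := deriveM dfx dgx; rewrite /GRing.scale /= [_ * 'D_v f x]mulrC => <-.
by [].
Qed.

Lemma smoothM U f g : open U ->
  smooth_on U f -> smooth_on U g -> smooth_on U (fun x => f x * g x).
Proof. by move=> oU sf sg k; apply: Ck_onM. Qed.

Lemma smoothV U f : open U -> (forall x, U x -> f x != 0) ->
  smooth_on U f -> smooth_on U (fun x => (f x)^-1).
Proof.
move=> oU f0 sf; elim=> [|k IH].
  by move=> x Ux; apply: cvgV; [exact: f0|exact: (sf 0)].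
have df x : U x -> differentiable f x by exact: smooth_differentiable.
split=> [x Ux|v]; first by apply: differentiableV; [exact: df|exact: f0].
have : Ck_on k U (fun x => - 1 * ((f x)^-1 * (f x)^-1 * 'D_v f x)).
  apply: Ck_onM => //; first exact: Ck_on_cst.
  by apply: Ck_onM => //; [exact: Ck_onM|exact: smooth_derive].
apply: eq_Ck_on => // x; rewrite inE => Ux.
rewrite (@deriveV _ _ f x v (f0 _ Ux)); last exact/diff_derivable/df.
by rewrite -expr2 exprVn mulN1r; exact: esym (mulNr _ _).
Qed.

Lemma smooth_prod U (I : Type) (r : seq I) (P : pred I) (F : I -> V -> R) :
  open U -> (forall i, P i -> smooth_on U (F i)) ->
  smooth_on U (fun x => \prod_(i <- r | P i) F i x).
Proof.
move=> oU sF; elim: r => [|i r IH].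
  by under eq_fun do rewrite big_nil; exact: smooth_cst.
under eq_fun do rewrite big_cons.
case Pi: (P i) => //; exact: smoothM (sF _ Pi) IH.
Qed.

End SmoothScalar.

(** * Symmetry of second derivatives *)

Section Schwarz.
Context {R : realType} {V : normedModType R}.

Lemma is_derive_line (f : V -> R) (p u : V) (s : R) :
  differentiable f (p + s *: u) ->
  is_derive s 1 (fun s : R => f (p + s *: u)) ('D_u f (p + s *: u)).
Proof.
move=> df; pose l (s : R) := p + s *: u.
have dl : is_diff s l (fun t : R => t *: u).
  have -> : (fun t : R => t *: u) = 0 + (fun t : R => t *: u).
    by rewrite add0r.
  exact: is_diffD.
have dfl : differentiable f (l s) by [].
have dls : differentiable l s by exact: ex_diff.
have dc : differentiable (f \o l) s by exact: differentiable_comp.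
apply: DeriveDef; first exact: (@diff_derivable _ _ _ (f \o l)).
have := deriveE (1 : R) dc; rewrite diff_comp// diff_val /= scale1r.
by rewrite -deriveE.
Qed.

(** Two applications of the mean value theorem: first to the increment in the
    direction [v], as a function of the step along [u], then to ['D_u f]. *)
Lemma second_difference (U : set V) (f : V -> R) (x u v : V) (h : R) :
  smooth_on U f -> 0 < h ->
  (forall s t : R, 0 <= s <= h -> 0 <= t <= h -> U (x + s *: u + t *: v)) ->
  exists c d : R, [/\ 0 <= c <= h, 0 <= d <= h &
   f (x + h *: u + h *: v) - f (x + h *: u) - (f (x + h *: v) - f x)
    = 'D_v ('D_u f) (x + c *: u + d *: v) * h * h].
Proof.
move=> sf h0 hU; have h00 : 0 <= (0 : R) <= h by rewrite lexx ltW.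
have hh : 0 <= h <= h by rewrite lexx ltW.
have ioW (s : R) : s \in `]0, h[ -> 0 <= s <= h.
  by rewrite in_itv /= => /andP[/ltW-> /ltW->].
have icW (s : R) : s \in `[0, h] -> 0 <= s <= h by rewrite in_itv.
pose phi s := f (x + h *: v + s *: u) - f (x + s *: u).
pose dphi s := 'D_u f (x + h *: v + s *: u) - 'D_u f (x + s *: u).
have Ut s t : 0 <= s <= h -> 0 <= t <= h -> U (x + t *: v + s *: u).
  by move=> hs ht; rewrite addrAC; exact: hU.
have U0 s : 0 <= s <= h -> U (x + s *: u).
  by move=> hs; have := hU s 0 hs h00; rewrite scale0r addr0.
have dphiP (s : R) : 0 <= s <= h -> is_derive s 1 phi (dphi s).
  move=> hs; apply: is_deriveB; apply: is_derive_line.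
    by apply: smooth_differentiable sf _; exact: Ut.
  by apply: smooth_differentiable sf _; exact: U0.
have [|c c0 Ec] := MVT h0 (fun s Hs => dphiP s (ioW s Hs)).
  apply: derivable_within_continuous => s /icW hs.
  by have [] := dphiP s hs.
have hc := ioW _ c0.
pose psi t := 'D_u f (x + c *: u + t *: v).
have dpsiP (t : R) : 0 <= t <= h ->
    is_derive t 1 psi ('D_v ('D_u f) (x + c *: u + t *: v)).
  move=> ht; apply: is_derive_line.
  by apply: smooth_differentiable (smooth_derive u sf) _; exact: hU.
have [|d d0 Ed] := MVT h0 (fun s Hs => dpsiP s (ioW s Hs)).
  apply: derivable_within_continuous => s /icW hs.
  by have [] := dpsiP s hs.
exists c, d; split => //; first exact: ioW.
move: Ec Ed; rewrite /phi /psi /dphi !subr0 !scale0r !addr0 => Ec Ed.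
rewrite -Ed [x + c *: u + _]addrAC -Ec.
by rewrite [x + h *: u + _]addrAC; ring.
Qed.

(** Two numbers which approximate distinct limits to less than half the distance
    of these limits cannot both be the second difference quotient. *)
Lemma equal_quotients (p q p' q' h f1 f2 f3 f4 : R) : h != 0 -> p != q ->
  f1 - f2 - (f3 - f4) = p' * h * h -> f1 - f3 - (f2 - f4) = q' * h * h ->
  `|p - p'| < `|p - q| / 2 -> `|q - q'| < `|p - q| / 2 -> False.
Proof.
move=> h0 /negP npq E1 E2 hp hq.
have pq : p' = q'.
  by apply: (mulIf (mulf_neq0 h0 h0)); rewrite !mulrA -E1 -E2; ring.
have : `|p - q| < `|p - q| / 2 + `|p - q| / 2.
  have {1}-> : p - q = (p - p') - (q - q') by rewrite pq; ring.
  exact: le_lt_trans (ler_normB _ _) (ltrD hp hq).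
by rewrite -splitr ltxx.
Qed.

(** Both mixed derivatives are the limit of the same second difference
    quotient, which is symmetric in the two directions. *)
Lemma schwarz (U : set V) (f : V -> R) (x u v : V) : open U -> U x ->
  smooth_on U f -> 'D_v ('D_u f) x = 'D_u ('D_v f) x.
Proof.
move=> oU Ux sf.
have cts w z : {for x, continuous ('D_w ('D_z f))}.
  apply: differentiable_continuous; apply: smooth_differentiable Ux.
  by do 2 apply: smooth_derive.
apply/eqP/negPn/negP => neq.
pose e := `|'D_v ('D_u f) x - 'D_u ('D_v f) x| / 2.
have e0 : 0 < e by rewrite divr_gt0// normr_gt0 subr_eq0.
have : \forall y \near x, [/\ U y, `|'D_v ('D_u f) x - 'D_v ('D_u f) y| < e &
    `|'D_u ('D_v f) x - 'D_u ('D_v f) y| < e].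
  have n1 : \forall y \near x, `|'D_v ('D_u f) x - 'D_v ('D_u f) y| < e.
    by have /cvgrPdist_lt := cts v u; apply.
  have n2 : \forall y \near x, `|'D_u ('D_v f) x - 'D_u ('D_v f) y| < e.
    by have /cvgrPdist_lt := cts u v; apply.
  by apply: filterS3 (open_near oU Ux) n1 n2.
move=> /nbhs_normP[r /= r0 hr].
pose h := r / (`|u| + `|v| + 1).
have d0 : 0 < `|u| + `|v| + 1 by rewrite ltr_wpDl// addr_ge0.
have h0 : 0 < h by exact: divr_gt0.
have box w z (E : `|w| + `|z| = `|u| + `|v|) (s t : R) :
    0 <= s <= h -> 0 <= t <= h -> `|x - (x + s *: w + t *: z)| < r.
  move=> /andP[s0 sh] /andP[t0 th].
  rewrite -addrA opprD addNKr -normrN opprK.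
  apply: le_lt_trans (ler_normD _ _) _; rewrite !normrZ !ger0_norm//.
  apply: (@le_lt_trans _ _ (h * (`|w| + `|z|))).
    by rewrite mulrDr lerD// ler_wpM2r.
  by rewrite E /h mulrAC ltr_pdivrMr// ltr_pM2l// ltrDl.
have b1 := box u v erefl.
have b2 := box v u (addrC _ _).
have [|c [d [hc hd E1]]] := @second_difference U f x u v h sf h0.
  by move=> s t hs ht; have [] := hr _ (b1 s t hs ht).
have [|c' [d' [hc' hd' E2]]] := @second_difference U f x v u h sf h0.
  by move=> s t hs ht; have [] := hr _ (b2 s t hs ht).
have [_ ha _] := hr _ (b1 _ _ hc hd).
have [_ _ hb] := hr _ (b2 _ _ hc' hd').
rewrite [x + h *: v + h *: u]addrAC in E2.
exact: (equal_quotients (lt0r_neq0 h0) neq E1 E2 ha hb).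
Qed.

End Schwarz.

(** * Smooth matrix-valued functions *)

Section SmoothMatrix.
Context {R : realType} {V : normedModType R}.
Implicit Types (U : set V).

Definition mxcoord p q (i : 'I_p) (j : 'I_q) (A : 'M[R]_(p, q)) : R := A i j.

Lemma mxcoord_is_linear p q (i : 'I_p) (j : 'I_q) : linear (mxcoord i j).
Proof. by move=> c A B; rewrite /mxcoord !mxE. Qed.

HB.instance Definition _ p q (i : 'I_p) (j : 'I_q) :=
  GRing.isLinear.Build R 'M[R]_(p, q) R _ (mxcoord i j) (mxcoord_is_linear i j).

Lemma mxcoord_continuous p q (i : 'I_p) (j : 'I_q) : continuous (mxcoord i j).
Proof. exact: coord_continuous. Qed.

Lemma derive_entry p q (A : V -> 'M[R]_(p, q)) (x v : V) i j :
  differentiable A x -> 'D_v (fun y => A y i j) x = ('D_v A x) i j.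
Proof.
move=> dA; exact: (@linear_post_derive _ _ _ _ (mxcoord i j) A x v
  (@mxcoord_continuous _ _ i j) dA).
Qed.

Lemma smooth_entry p q U (A : V -> 'M[R]_(p, q)) i j : open U ->
  smooth_on U A -> smooth_on U (fun y => A y i j).
Proof.
move=> oU sA; exact: (@smooth_linear_post _ _ _ _ U (mxcoord i j) A oU
  (@mxcoord_continuous _ _ i j) sA).
Qed.

Lemma smooth_scale_cst (W : normedModType R) U (f : V -> R) (w : W) : open U ->
  smooth_on U f -> smooth_on U (fun y => f y *: w).
Proof.
move=> oU sf k; elim: k f {sf}(sf k) => [|k IH] f.
  by move=> cf x Ux; apply: cvgZr_tmp; exact: cf.
move=> [df dk]; split=> [x Ux|v]; first exact: differentiableZl (df _ Ux).
apply: eq_Ck_on (IH _ (dk v)) => // x; rewrite inE => Ux.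
rewrite deriveE; last exact: df.
rewrite [RHS]deriveE; last exact: differentiableZl (df _ Ux).
by rewrite (diffZl _ (df _ Ux)).
Qed.

Lemma smooth_mxP p q U (A : V -> 'M[R]_(p, q)) : open U ->
  (forall i j, smooth_on U (fun y => A y i j)) -> smooth_on U A.
Proof.
move=> oU sA.
have -> : A = (fun y => \sum_i \sum_j A y i j *: delta_mx i j).
  by apply/funext => y; exact: matrix_sum_delta.
by do 2 (apply: smooth_sum => // ? _); exact: smooth_scale_cst.
Qed.

Lemma differentiable_entry p q (A : V -> 'M[R]_(p, q)) (x : V) i j :
  differentiable A x -> differentiable (fun y => A y i j) x.
Proof.
move=> dA; apply: (@differentiable_comp _ _ _ _ A (mxcoord i j)) => //.
exact: differentiable_coord.
Qed.

Lemma differentiable_mxP p q (A : V -> 'M[R]_(p, q)) (x : V) :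
  (forall i j, differentiable (fun y => A y i j) x) -> differentiable A x.
Proof.
move=> dA.
have -> : A = \sum_i \sum_j (fun y => A y i j *: delta_mx i j).
  apply/funext => y; rewrite [LHS]matrix_sum_delta fct_sumE.
  by apply: eq_bigr => i _; rewrite fct_sumE.
by do 2 (apply: differentiable_sum => ?); exact: differentiableZl.
Qed.

Lemma smooth_mulmx p q r U (A : V -> 'M[R]_(p, q)) (B : V -> 'M[R]_(q, r)) :
  open U -> smooth_on U A -> smooth_on U B -> smooth_on U (fun y => A y *m B y).
Proof.
move=> oU sA sB; apply: smooth_mxP => // i j.
under eq_fun do rewrite mxE.
by apply: smooth_sum => // k _; apply: smoothM => //; exact: smooth_entry.
Qed.

Lemma differentiable_mulmx p q r (A : V -> 'M[R]_(p, q)) (B : V -> 'M[R]_(q, r))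
    x : differentiable A x -> differentiable B x ->
  differentiable (fun y => A y *m B y) x.
Proof.
move=> dA dB; apply: differentiable_mxP => i j.
have -> : (fun y => (A y *m B y) i j) = \sum_k (fun y => A y i k * B y k j).
  by apply/funext => y; rewrite mxE fct_sumE.
by apply: differentiable_sum => k; apply: differentiableM;
  exact: differentiable_entry.
Qed.

Lemma derive_mulmx p q r (A : V -> 'M[R]_(p, q)) (B : V -> 'M[R]_(q, r)) x v :
  differentiable A x -> differentiable B x ->
  'D_v (fun y => A y *m B y) x = 'D_v A x *m B x + A x *m 'D_v B x.
Proof.
move=> dA dB; apply/matrixP => i j.
rewrite -derive_entry; last exact: differentiable_mulmx.
have -> : (fun y => (A y *m B y) i j) = \sum_k (fun y => A y i k * B y k j).
  by apply/funext => y; rewrite mxE fct_sumE.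
have dAB k : derivable (fun y => A y i k * B y k j) x v.
  by apply: diff_derivable; apply: differentiableM; exact: differentiable_entry.
rewrite derive_sum // !mxE -big_split; apply: eq_bigr => k _ /=.
have dAi : derivable (fun y => A y i k) x v.
  by apply: diff_derivable; exact: differentiable_entry.
have dBj : derivable (fun y => B y k j) x v.
  by apply: diff_derivable; exact: differentiable_entry.
have := deriveM dAi dBj; rewrite /GRing.mul /= => ->.
rewrite !derive_entry // addrC; congr (_ + _); exact: mulrC.
Qed.

Lemma smooth_trmx p q U (A : V -> 'M[R]_(p, q)) : open U ->
  smooth_on U A -> smooth_on U (fun y => (A y)^T).
Proof.
move=> oU sA; apply: smooth_mxP => // i j; under eq_fun do rewrite mxE.
exact: smooth_entry.
Qed.

Lemma differentiable_trmx p q (A : V -> 'M[R]_(p, q)) x :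
  differentiable A x -> differentiable (fun y => (A y)^T) x.
Proof.
move=> dA; apply: differentiable_mxP => i j; under eq_fun do rewrite mxE.
exact: differentiable_entry.
Qed.

Lemma smooth_scalemx p q U (f : V -> R) (A : V -> 'M[R]_(p, q)) : open U ->
  smooth_on U f -> smooth_on U A -> smooth_on U (fun y => f y *: A y).
Proof.
move=> oU sf sA; apply: smooth_mxP => // i j; under eq_fun do rewrite mxE.
by apply: smoothM => //; exact: smooth_entry.
Qed.

Lemma differentiable_scalemx p q (f : V -> R) (A : V -> 'M[R]_(p, q)) x :
  differentiable f x -> differentiable A x ->
  differentiable (fun y => f y *: A y) x.
Proof.
move=> df dA; apply: differentiable_mxP => i j; under eq_fun do rewrite mxE.
by apply: differentiableM => //; exact: differentiable_entry.
Qed.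

Lemma derive_scalemx p q (f : V -> R) (A : V -> 'M[R]_(p, q)) x v :
  differentiable f x -> differentiable A x ->
  'D_v (fun y => f y *: A y) x = 'D_v f x *: A x + f x *: 'D_v A x.
Proof.
move=> df dA; apply/matrixP => i j.
rewrite -derive_entry; last exact: differentiable_scalemx.
under eq_fun do rewrite mxE.
have dfx : derivable f x v by exact: diff_derivable.
have dAx : derivable (fun y => A y i j) x v.
  by apply: diff_derivable; exact: differentiable_entry.
have := deriveM dfx dAx; rewrite /GRing.mul /= => ->.
rewrite !mxE derive_entry // addrC; congr (_ + _); exact: mulrC.
Qed.

Lemma smooth_det p U (A : V -> 'M[R]_p) : open U ->
  smooth_on U A -> smooth_on U (fun y => \det (A y)).
Proof.
move=> oU sA; apply: smooth_sum => // s _; apply: smoothM => //.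
  exact: smooth_cst.
by apply: smooth_prod => // i _; exact: smooth_entry.
Qed.

Lemma smooth_invmx p U (A : V -> 'M[R]_p) : open U ->
  (forall x, U x -> A x \in unitmx) ->
  smooth_on U A -> smooth_on U (fun y => invmx (A y)).
Proof.
move=> oU uA sA.
apply: (@eq_smooth_on _ _ _ _ (fun y => (\det (A y))^-1 *: \adj (A y))) => //.
  by move=> y; rewrite inE => /uA Ay; rewrite /invmx Ay.
apply: smooth_scalemx => //.
  apply: smoothV => //; last exact: smooth_det.
  by move=> x /uA; rewrite unitmxE unitfE.
apply: smooth_mxP => // i j; under eq_fun do rewrite mxE.
apply: smoothM => //; first exact: smooth_cst.
apply: smooth_det => //; apply: smooth_mxP => // k l.
by under eq_fun do rewrite !mxE; exact: smooth_entry.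
Qed.

End SmoothMatrix.

Section Composition.
Context {R : realType} {V : normedModType R} {m : nat}.
Local Notation E := ('cV[R]_m).

(** The definition of smoothness only provides derivatives in constant
    directions; varying directions and arguments are expanded along the standard
    basis. *)
Lemma linear_coords (W : lmodType R) (f : E -> W) (u : E) : linear f ->
  f u = \sum_k u k 0 *: f (delta_mx k 0).
Proof.
move=> lf; pose F : {linear E -> W} := HB.pack f (GRing.isLinear.Build _ _ _ _ f lf).
rewrite -[LHS]/(F u) {1}[u]matrix_sum_delta linear_sum.
by apply: eq_bigr => k _; rewrite big_ord1 linearZ.
Qed.

Lemma derive_coords (W : normedModType R) (f : E -> W) (x v : E) :
  differentiable f x ->
  'D_v f x = \sum_k v k 0 *: 'D_(delta_mx k 0) f x.
Proof.
move=> df; apply: (@linear_coords W (fun u => 'D_u f x)) => c u w.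
exact: derive_linear.
Qed.

Lemma smooth_comp (O : set E) (U : set V) (f : E -> R) (g : V -> E) :
  open O -> open U -> (forall x, U x -> O (g x)) ->
  smooth_on O f -> smooth_on U g -> smooth_on U (f \o g).
Proof.
move=> oO oU gO sf sg k; elim: k f sf => [|k IH] f sf.
  move=> x Ux; apply: continuous_comp; first exact: (sg 0).
  by apply: (sf 0); exact: gO.
have dg x : U x -> differentiable g x by exact: smooth_differentiable.
have df x : U x -> differentiable f (g x).
  by move=> Ux; apply: smooth_differentiable sf _; exact: gO.
split=> [x Ux|v]; first by apply: differentiable_comp; [exact: dg|exact: df].
have sDg j : smooth_on U (fun x => ('D_v g x) j 0).
  by apply: smooth_entry => //; exact: smooth_derive.
have : Ck_on k U (fun x => \sum_j ('D_v g x) j 0 * 'D_(delta_mx j 0) f (g x)).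
  elim: (index_enum _) => [|j s IHs].
    by under eq_fun do rewrite big_nil; exact: Ck_on_cst.
  under eq_fun do rewrite big_cons.
  apply: Ck_onD => //; apply: Ck_onM => //; first exact: sDg.
  by apply: (IH ('D_(delta_mx j 0) f)); exact: smooth_derive.
apply: eq_Ck_on => // x; rewrite inE => Ux.
rewrite [RHS]deriveE; last by apply: differentiable_comp; [exact: dg|exact: df].
rewrite diff_comp /=; [|exact: dg|exact: df].
rewrite -!deriveE; [|exact: dg|exact: df].
by rewrite [RHS]derive_coords //; exact: df.
Qed.

Lemma schwarz_mx p q (U : set V) (f : V -> 'M[R]_(p, q)) (x u v : V) :
  open U -> U x -> smooth_on U f -> 'D_v ('D_u f) x = 'D_u ('D_v f) x.
Proof.
move=> oU Ux sf.
have D2 w z i j :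
    'D_w ('D_z f) x i j = 'D_w ('D_z (fun y => f y i j)) x.
  rewrite -derive_entry; last exact: smooth_differentiable (smooth_derive z sf) Ux.
  apply: (derive_on w oU Ux) => y; rewrite inE => Uy.
  by rewrite derive_entry//; exact: smooth_differentiable sf Uy.
apply/matrixP => i j; apply: etrans (D2 v u i j) _.
apply: etrans _ (esym (D2 u v i j)).
exact: (schwarz _ _ oU Ux (smooth_entry i j oU sf)).
Qed.

(** The product rule for the pairing of a family of linear maps with a moving
    vector. It differentiates [om y (Y y)] and ['D_(Y y) f y] alike. *)
Lemma derive_moving_argument p q (O : set E) (F : E -> E -> 'M[R]_(p, q))
    (Y : E -> E) (x a : E) : open O -> O x ->
  (forall y, O y -> linear (F y)) -> (forall u, differentiable (F^~ u) x) ->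
  differentiable Y x ->
  'D_a (fun y => F y (Y y)) x = F x ('D_a Y x) + 'D_a (F^~ (Y x)) x.
Proof.
move=> oO Ox lF dF dY.
have dYk k : differentiable (fun y => Y y k 0) x by exact: differentiable_entry.
have E1 : 'D_a (fun y => F y (Y y)) x =
    'D_a (\sum_k (fun y => Y y k 0 *: F y (delta_mx k 0))) x.
  apply: (derive_on a oO Ox) => y; rewrite inE => Oy.
  by rewrite fct_sumE (linear_coords _ (lF _ Oy)).
have E2 : 'D_a (F^~ (Y x)) x =
    'D_a (\sum_k (fun y => Y x k 0 *: F y (delta_mx k 0))) x.
  apply: (derive_on a oO Ox) => y; rewrite inE => Oy.
  by rewrite fct_sumE (linear_coords _ (lF _ Oy)).
apply: etrans E1 _; rewrite (linear_coords ('D_a Y x) (lF _ Ox)).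
apply: etrans _ (congr1 _ (esym E2)).
rewrite !derive_sum; first last.
- by move=> k; apply: diff_derivable; exact: differentiable_scalemx.
- by move=> k; apply: diff_derivable; exact: differentiable_scalemx.
rewrite -big_split; apply: eq_bigr => k _ /=.
rewrite !derive_scalemx // derive_cst scale0r add0r.
by rewrite derive_entry.
Qed.

End Composition.

(** * Vector fields and brackets in charts *)

Section TangentVectors.
Context {R : realType} {m : nat} {M : manifold R m}.
Local Notation E := ('cV[R]_m).

Lemma tangentD (x : M) (v w : tangent x) i : (v + w) i = v i + w i.
Proof. by []. Qed.

Lemma tangentZ (x : M) (c : R) (v : tangent x) i : (c *: v) i = c *: v i.
Proof. by []. Qed.

Lemma tangentN (x : M) (v : tangent x) i : (- v) i = - v i.
Proof. by []. Qed.

Lemma tangent0 (x : M) i : (0 : tangent x) i = 0.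
Proof. by []. Qed.

Lemma tangent_transition (x : M) (v : tangent x) i j : dom i x -> dom j x ->
  v j = 'd (chart j \o cochart i) (chart i x) (v i).
Proof. by case: v => v /= /asboolP[_]; apply. Qed.

(** One component determines a tangent vector, so identities between tangent
    vectors may be checked in any chart at the point. *)
Lemma tangent_inj (x : M) (v w : tangent x) i :
  dom i x -> v i = w i -> v = w.
Proof.
move=> xi vw; apply/val_inj/funext => j /=.
have [xj|xj] := pselect (dom j x).
  by rewrite (tangent_transition v xi xj) (tangent_transition w xi xj) vw.
move: v w {vw} => [v vP] [w wP] /=.
by move/asboolP: vP => [-> //]; move/asboolP: wP => [-> //].
Qed.

Lemma chart_image (U : set M) (i : idx M) : chart i @` (U `&` dom i) =
  chart i @` dom i `&` cochart i @^-1` U.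
Proof.
apply/seteqP; split=> [y [x [Ux xi] <-]|y [[x xi <-]]] /=.
  by split; [exists x|rewrite chartK].
by rewrite chartK// => Ux; exists x.
Qed.

Lemma chart_image_open (U : set M) (i : idx M) : open U ->
  open (chart i @` (U `&` dom i)).
Proof.
move=> oU; rewrite chart_image openE => y [Oy Uy].
have oD : open (chart i @` dom i) by exact: chart_open.
apply: filterI; first exact: open_near oD Oy.
exact: (cochart_continuous Oy (open_near oU Uy)).
Qed.

Lemma cochart_in (U : set M) (i : idx M) y : (chart i @` (U `&` dom i)) y ->
  [/\ U (cochart i y), dom i (cochart i y) & chart i (cochart i y) = y].
Proof. by move=> [x [Ux xi] <-]; rewrite chartK. Qed.

Lemma derive_moving_direction p q (O : set E) (f : E -> 'M[R]_(p, q))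
    (Y : E -> E) (x a : E) : open O -> O x -> smooth_on O f ->
  differentiable Y x ->
  'D_a (fun y => 'D_(Y y) f y) x
    = 'D_('D_a Y x) f x + 'D_a (fun y => 'D_(Y x) f y) x.
Proof.
move=> oO Ox sf dY.
apply: (@derive_moving_argument _ _ _ _ O (fun y u => 'D_u f y)) => //.
  by move=> y Oy c u v; apply: derive_linear; exact: smooth_differentiable sf Oy.
by move=> u; exact: smooth_differentiable (smooth_derive u sf) Ox.
Qed.

(** In overlapping charts a vector field is related by the differential of the
    transition map; differentiating this relation produces second derivatives
    of the transition map, which cancel in the bracket by symmetry. *)
Lemma bracket_coord (U : set M) (X Y : vfield M) (x : M) i :
  open U -> U x -> smooth_field U X -> smooth_field U Y -> dom i x ->
  bracket X Y x i = 'd (fun y => Y (cochart i y) i) (chart i x) (X x i)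
                  - 'd (fun y => X (cochart i y) i) (chart i x) (Y x i).
Proof.
move=> oU Ux sX sY xi; rewrite /bracket.
set F := (F in insubd _ F).
suff FT : F \in is_tangent x.
  by rewrite -[coords _]/(val (insubd 0 F)) insubdK // /F; case: asboolP.
apply/asboolP; split=> [j xj|k j xk xj].
  by rewrite /F; case: asboolP.
rewrite /F; case: asboolP => // _; case: asboolP => // _.
set psi := chart j \o cochart k.
pose O := chart k @` ((U `&` dom j) `&` dom k).
have oO : open O.
  by apply: chart_image_open; apply: openI => //; exact: dom_open.
have Op : O (chart k x) by exists x.
have spsi : smooth_on O psi.
  apply: subset_smooth_on (transition_smooth k j) => y [z [[_ zj] zk] <-].
  by exists z.
have OU : O `<=` chart k @` (U `&` dom k).
  by move=> y [z [[? ?] ?] <-]; exists z.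
have OUj y : O y -> (chart j @` (U `&` dom j)) (psi y).
  by move=> [z [[? ?] ?] <-]; exists z => //; rewrite /psi /= chartK.
have comp (Z : vfield M) (a : E) : smooth_field U Z ->
    'd (fun y => Z (cochart j y) j) (chart j x) ('d psi (chart k x) a) =
    'd psi (chart k x) ('d (fun y => Z (cochart k y) k) (chart k x) a)
    + 'D_a ('D_(Z x k) psi) (chart k x).
  move=> sZ; pose Zj y := Z (cochart j y) j; pose Zk y := Z (cochart k y) k.
  have dpsi : differentiable psi (chart k x) by exact: smooth_differentiable Op.
  have dZk : differentiable Zk (chart k x).
    by apply: smooth_differentiable (sZ k) _; exact: OU.
  have psix : psi (chart k x) = chart j x by rewrite /psi /= chartK.
  have dZj : differentiable Zj (psi (chart k x)).
    by apply: smooth_differentiable (sZ j) _; exact: OUj.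
  have dc : differentiable (Zj \o psi) (chart k x) by exact: differentiable_comp.
  have C1 : 'd Zj (psi (chart k x)) ('d psi (chart k x) a)
          = 'D_a (Zj \o psi) (chart k x).
    apply: etrans _ (esym (deriveE a dc)).
    exact: esym (congr1 (@^~ a) (diff_comp dpsi dZj)).
  have C2 : 'D_a (Zj \o psi) (chart k x)
          = 'D_a (fun y => 'D_(Zk y) psi y) (chart k x).
    apply: (derive_on a oO Op) => y; rewrite inE => Oy.
    have [z [[Uz zj] zk] yE] := Oy.
    apply: etrans _ (esym (deriveE _ (smooth_differentiable spsi Oy))).
    by rewrite -yE /Zj /Zk /psi /= (chartK zk) (chartK zj); exact: tangent_transition.
  have C3 := derive_moving_direction a oO Op spsi dZk.
  have C4 : 'D_('D_a Zk (chart k x)) psi (chart k x)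
          = 'd psi (chart k x) ('d Zk (chart k x) a).
    apply: etrans (deriveE _ dpsi) _; congr ('d psi _ _); exact: deriveE.
  have C5 : Zk (chart k x) = Z x k by rewrite /Zk chartK.
  rewrite C4 C5 in C3.
  by rewrite -psix; exact: etrans C1 (etrans C2 C3).
rewrite (tangent_transition (X x) xk xj) (tangent_transition (Y x) xk xj).
have sw := schwarz_mx (X x k) (Y x k) oO Op spsi.
apply: etrans (congr2 (fun a b => a - b) (comp Y (X x k) sY) (comp X (Y x k) sX)) _.
by rewrite sw opprD addrACA subrr addr0 -linearB.
Qed.

End TangentVectors.

(** * Cartan structure equations *)

Section LinearMatrix.
Context {R : realType} {m : nat}.
Local Notation E := ('cV[R]_m).

Definition linmx (f : E -> E) : 'M[R]_m := \matrix_(k, l) f (delta_mx l 0) k 0.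

Lemma mul_linmx (f : E -> E) (w : E) : linear f -> linmx f *m w = f w.
Proof.
move=> lf; pose F : {linear E -> E} := HB.pack f (GRing.isLinear.Build _ _ _ _ f lf).
rewrite -[RHS]/(F w) [in RHS](matrix_sum_delta w) linear_sum.
apply/matrixP => k j; rewrite ord1 mxE summxE; apply: eq_bigr => l _.
by rewrite mxE big_ord1 linearZ mxE mulrC.
Qed.

Lemma linmx_ext (A B : 'M[R]_m) : (forall w : E, A *m w = B *m w) -> A = B.
Proof.
move=> AB; apply/matrixP => i j; have := congr1 (fun v : E => v i 0) (AB (delta_mx j 0)).
by rewrite -!colE !mxE.
Qed.

Lemma unitmx_ker0 (A : 'M[R]_m) : (forall w : E, A *m w = 0 -> w = 0) ->
  A \in unitmx.
Proof.
move=> A0; rewrite -unitmx_tr -row_free_unit; apply: inj_row_free => v vA.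
apply: trmx_inj; rewrite trmx0; apply: A0.
by apply: trmx_inj; rewrite trmx_mul trmxK trmx0.
Qed.

(** A torsion-free connection with constant curvature and inner torsion, read
    off in a local section of the structure and a chart: [th y] is the coframe
    dual to the section and [om y a] the connection form in the direction [a].
    The equations are Cartan's [d th + om /\ th = 0] and
    [d om + om /\ om = R0 (th, th)], evaluated on constant vector fields, which
    commute; the last clause says that [om] represents the inner torsion. *)
Record cartan_structure (O : set E) (R0 : E -> E -> 'M[R]_m)
    (I0 : E -> set 'M[R]_m) (th : E -> 'M[R]_m) (om : E -> E -> 'M[R]_m) :
    Prop := CartanStructure {
  cartan_open : open O;
  cartan_linear : forall y, O y -> linear (om y);
  cartan_unit : forall y, O y -> th y \in unitmx;
  cartan_smooth_th : smooth_on O th;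
  cartan_smooth_om : forall a, smooth_on O (om^~ a);
  cartan_torsion : forall y a b, O y ->
    'D_a th y *m b - 'D_b th y *m a
      = om y b *m (th y *m a) - om y a *m (th y *m b);
  cartan_curvature : forall y a b, O y ->
    'D_a (om^~ b) y - 'D_b (om^~ a) y + (om y a *m om y b - om y b *m om y a)
      = R0 (th y *m a) (th y *m b);
  cartan_inner : forall y a, O y -> I0 (th y *m a) (om y a) }.

End LinearMatrix.

Section Fields.
Context {R : realType} {m : nat} {M : manifold R m}.

Lemma vfield_ext (X Y : vfield M) : (forall y, X y = Y y) -> X = Y.
Proof. exact: functional_extensionality_dep. Qed.

Lemma sum_field_cons (I : Type) (k : I) (r : seq I) (F : I -> vfield M) :
  (fun y => \sum_(l <- k :: r) F l y)
    = (fun y => F k y + \sum_(l <- r) F l y) :> vfield M.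
Proof. by apply: vfield_ext => y; rewrite big_cons. Qed.

Lemma sum_field_nil (I : Type) (F : I -> vfield M) :
  (fun y => \sum_(l <- [::]) F l y) = (fun=> 0) :> vfield M.
Proof. by apply: vfield_ext => y; rewrite big_nil. Qed.

Lemma smooth_fieldD (U : set M) (X Y : vfield M) : open U ->
  smooth_field U X -> smooth_field U Y -> smooth_field U (fun y => X y + Y y).
Proof. by move=> oU sX sY i; apply: smoothD; [exact: chart_image_open|..]. Qed.

Lemma smooth_fieldZ (U : set M) (f : M -> R) (X : vfield M) : open U ->
  smooth_fun U f -> smooth_field U X -> smooth_field U (fun y => f y *: X y).
Proof.
move=> oU sf sX i; apply: (smooth_scalemx (chart_image_open oU)).
  exact: sf.
exact: sX.
Qed.

Lemma smooth_field0 (U : set M) : smooth_field U (fun=> 0 : tangent _).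
Proof. by move=> i; exact: smooth_cst. Qed.

Lemma smooth_field_sum (U : set M) (I : Type) (r : seq I) (F : I -> vfield M) :
  open U -> (forall k, smooth_field U (F k)) ->
  smooth_field U (fun y => \sum_(k <- r) F k y).
Proof.
move=> oU sF; elim: r => [|k r IH].
  by rewrite sum_field_nil; exact: smooth_field0.
by rewrite sum_field_cons; exact: smooth_fieldD.
Qed.

Lemma smooth_field_at (U : set M) (X : vfield M) x :
  open U -> U x -> smooth_field U X -> smooth_at x X.
Proof. by move=> oU Ux sX; exists U. Qed.

Context (D : connection M).

Lemma nabla0 (x : M) (v : tangent x) : D x v (fun=> 0) = 0.
Proof.
have s0 : smooth_at x (fun=> 0 : tangent _).
  by exists setT; split => //; [exact: openT|exact: smooth_field0].
have := nabla_add D v s0 s0.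
have -> : (fun y : M => 0 + 0) = (fun=> 0) :> vfield M.
  by apply: vfield_ext => y; rewrite addr0.
by move/eqP; rewrite -subr_eq0 opprD addNKr oppr_eq0 => /eqP.
Qed.

Lemma nabla_sum (U : set M) (x : M) (v : tangent x) (I : Type) (r : seq I)
    (F : I -> vfield M) : open U -> U x -> (forall k, smooth_field U (F k)) ->
  D x v (fun y => \sum_(k <- r) F k y) = \sum_(k <- r) D x v (F k).
Proof.
move=> oU Ux sF; elim: r => [|k r IH].
  by rewrite big_nil sum_field_nil; exact: nabla0.
rewrite big_cons sum_field_cons.
rewrite (@nabla_add _ _ _ D) ?IH //; apply: smooth_field_at Ux _ => //.
exact: smooth_field_sum.
Qed.

End Fields.

(** * From a homogeneous manifold to the structure equations *)

Section FrameToCoframe.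
Context {R : realType} {m : nat}.
Local Notation E := ('cV[R]_m).

Lemma derive_invmx (O : set E) (S : E -> 'M[R]_m) (x a : E) :
  open O -> O x -> smooth_on O S -> (forall y, O y -> S y \in unitmx) ->
  'D_a (fun y => invmx (S y)) x = - (invmx (S x) *m 'D_a S x *m invmx (S x)).
Proof.
move=> oO Ox sS uS; have sV := smooth_invmx oO uS sS.
have dS := smooth_differentiable sS Ox.
have dV := smooth_differentiable sV Ox.
have : 'D_a (fun y => invmx (S y) *m S y) x = 0.
  rewrite -[RHS](derive_cst (1%:M : 'M[R]_m) x a).
  by apply: (derive_on a oO Ox) => y; rewrite inE => Oy; rewrite mulVmx // uS.
rewrite (derive_mulmx a dV dS) => /eqP; rewrite addr_eq0 => /eqP/(congr1 (mulmxr (invmx (S x)))) /=.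
by rewrite mulmxK ?uS // mulNmx.
Qed.

(** Dualising the frame turns the structure equations for the brackets of the
    frame fields into those of the coframe. *)
Lemma cartan_of_frame (O : set E) (R0 : E -> E -> 'M[R]_m)
    (I0 : E -> set 'M[R]_m) (S : E -> 'M[R]_m) (L : E -> E -> 'M[R]_m) :
  open O -> (forall y, O y -> linear (L y)) ->
  (forall y, O y -> S y \in unitmx) -> smooth_on O S ->
  (forall u, smooth_on O (L^~ u)) ->
  (forall y u v, O y -> 'D_(S y *m u) S y *m v - 'D_(S y *m v) S y *m u
      = S y *m (L y u *m v - L y v *m u)) ->
  (forall y u v, O y ->
     'D_(S y *m u) (L^~ v) y - 'D_(S y *m v) (L^~ u) y
       + (L y u *m L y v - L y v *m L y u)
       - L y (L y u *m v - L y v *m u) = R0 u v) ->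
  (forall y u, O y -> I0 u (L y u)) ->
  cartan_structure O R0 I0 (fun y => invmx (S y))
    (fun y a => L y (invmx (S y) *m a)).
Proof.
move=> oO lL uS sS sL torS curS innS.
have sV := smooth_invmx oO uS sS.
have dL y u : O y -> differentiable (L^~ u) y.
  exact: smooth_differentiable.
have dV y : O y -> differentiable (fun y => invmx (S y)) y.
  exact: smooth_differentiable.
have LB y u v : O y -> L y (u - v) = L y u - L y v.
  by move=> Oy; rewrite addrC -scaleN1r (lL _ Oy) scaleN1r addrC.
have tor y a b : O y ->
    'D_a (fun y => invmx (S y)) y *m b - 'D_b (fun y => invmx (S y)) y *m a =
    L y (invmx (S y) *m b) *m (invmx (S y) *m a) -
    L y (invmx (S y) *m a) *m (invmx (S y) *m b).
  move=> Oy; rewrite !(derive_invmx _ oO Oy sS uS).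
  have := torS y (invmx (S y) *m a) (invmx (S y) *m b) Oy.
  rewrite !(mulKVmx (uS _ Oy)) => /(congr1 (mulmx (invmx (S y)))).
  rewrite (mulKmx (uS _ Oy)) mulmxBr => E1.
  move: E1; move: ('D_a S y) ('D_b S y) (L y _) (L y _) => DA DB La Lb E1.
  by rewrite !mulNmx -!mulmxA -[RHS]opprB -E1 opprK opprB addrC.
split => //.
- move=> y Oy c u v; rewrite mulmxDr -scalemxAr; exact: lL.
- by move=> y Oy; rewrite unitmx_inv uS.
- move=> a.
  apply: (@eq_smooth_on _ _ _ _ (fun y => \sum_k (invmx (S y) *m a) k 0 *: L y (delta_mx k 0))) => //.
    by move=> y; rewrite inE => Oy; rewrite -(linear_coords _ (lL _ Oy)).
  apply: smooth_sum => // k _; apply: smooth_scalemx => //.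
  by apply: smooth_entry => //; apply: smooth_mulmx => //; exact: smooth_cst.
- move=> y a b Oy.
  have dom c d : 'D_c (fun y => L y (invmx (S y) *m d)) y =
      L y ('D_c (fun y => invmx (S y)) y *m d)
      + 'D_c (L^~ (invmx (S y) *m d)) y.
    have dVd : differentiable (fun y => invmx (S y) *m d) y.
      by apply: differentiable_mulmx; [exact: dV|exact: differentiable_cst].
    rewrite (derive_moving_argument _ oO Oy lL (fun u => dL _ u Oy) dVd).
    congr (L y _ + _); rewrite derive_mulmx ?derive_cst ?mulmx0 ?addr0 //.
      exact: dV.
  rewrite !dom -(curS y (invmx (S y) *m a) (invmx (S y) *m b) Oy).
  rewrite !(mulKVmx (uS _ Oy)).
  have LN u : L y (- u) = - L y u.
    by rewrite -[- u]sub0r LB // -{1}(subrr u) LB // subrr sub0r.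
  have := congr1 (L y) (tor y a b Oy); rewrite LB // -[X in _ = L y X]opprB LN.
  move: (L y _) (L y _) (L y _) => A B C /(canRL (subrK _)) ->.
  have swap (P Q X : 'M[R]_m) : - A + B + P - (B + Q) + X = P - Q + X - A.
    by apply/matrixP => i j; rewrite !mxE; ring.
  exact: swap.
- by move=> y a Oy; exact: innS.
Qed.

End FrameToCoframe.

Section LocalFrame.
Context {R : realType} {m : nat} {M : manifold R m}.
Local Notation E := ('cV[R]_m).
Context (D : connection M) (G g : set 'M[R]_m) (P : Gstructure M G).
Context (U : set M) (s : frame_field M) (sec : smooth_section P U s) (i : idx M).
Context (tfree : torsion_free D).

Let O : set E := chart i @` (U `&` dom i).
Let oU : open U. Proof. by case: sec. Qed.
Let oO : open O. Proof. exact: chart_image_open. Qed.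

Let s_field w : smooth_field U (fun y => s y w). Proof. by case: sec. Qed.

Let s_linear x : U x -> linear (s x).
Proof. by case: sec => _ + _ => /[apply] /frames_iso []. Qed.

Let s_inj x : U x -> injective (s x).
Proof. by case: sec => _ + _ => /[apply] /frames_iso [_ /bij_inj]. Qed.

Let s_at x w : U x -> smooth_at x (fun y => s y w).
Proof. by move=> Ux; exists U. Qed.

Definition frame_mx (y : E) : 'M[R]_m := linmx (fun w => s (cochart i y) w i).

(** The form [Lambda^s] of the section, written in the chart. *)
Definition frame_form (y : E) (u : E) : 'M[R]_m :=
  linmx (fun w => invmx (frame_mx y) *m
    D (cochart i y) (s (cochart i y) u) (fun z => s z w) i).

Let S := frame_mx.
Let L := frame_form.

Lemma frame_mxE y w : O y -> S y *m w = s (cochart i y) w i.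
Proof.
case/cochart_in => Uy _ _; rewrite /S /frame_mx mul_linmx // => c u v.
by rewrite (s_linear Uy) tangentD tangentZ.
Qed.

Lemma frame_mx_at x w : U x -> dom i x -> S (chart i x) *m w = s x w i.
Proof. by move=> Ux xi; rewrite frame_mxE ?chartK //; exists x. Qed.

Lemma frame_mx_unit y : O y -> S y \in unitmx.
Proof.
move=> Oy; apply: unitmx_ker0 => w; have [Uy yi _] := cochart_in Oy.
rewrite frame_mxE // => sw0; apply: (s_inj Uy).
have s0 : s (cochart i y) 0 = 0.
  have := s_linear Uy 1 0 0; rewrite !scale1r addr0 => /eqP.
  by rewrite -subr_eq0 opprD addNKr oppr_eq0 => /eqP.
by rewrite s0; apply: (tangent_inj yi); rewrite sw0.
Qed.

Lemma frame_mx_smooth : smooth_on O S.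
Proof.
apply: smooth_mxP => // k l; under eq_fun do rewrite mxE.
by apply: smooth_entry => //; exact: (s_field (delta_mx l 0) i).
Qed.

Lemma nabla_frame_linear x (v : tangent x) : U x ->
  linear (fun w => D x v (fun z => s z w)).
Proof.
move=> Ux c w1 w2.
have sc : smooth_fun U (fun=> c) by move=> j; exact: smooth_cst.
have sw1 : smooth_field U (fun z => c *: s z w1) by exact: smooth_fieldZ.
have near_s : \forall z \near x, s z (c *: w1 + w2) = c *: s z w1 + s z w2.
  by apply: filterS (open_near oU Ux) => z Uz; exact: s_linear.
rewrite (nabla_local D v (s_at _ Ux) near_s).
rewrite (nabla_add D v (smooth_field_at oU Ux sw1) (s_at w2 Ux)).
have [j xj] := dom_cover x.
rewrite (nabla_leibniz D v _ (s_at w1 Ux) xj); last by exists U.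
by rewrite diff_cst scale0r add0r.
Qed.

Lemma nabla_frame x u w : U x -> dom i x ->
  D x (s x u) (fun z => s z w) = s x (L (chart i x) u *m w).
Proof.
move=> Ux xi; apply: (tangent_inj xi).
have Ox : O (chart i x) by exists x.
rewrite -frame_mx_at // /L /frame_form mul_linmx.
  by rewrite mulKVmx ?frame_mx_unit // chartK.
move=> c w1 w2; rewrite chartK // nabla_frame_linear //.
by rewrite tangentD tangentZ mulmxDr -scalemxAr.
Qed.

Lemma frame_form_linear y : O y -> linear (L y).
Proof.
move=> Oy c u v; have [Uy yi yE] := cochart_in Oy.
apply: linmx_ext => w; apply: (can_inj (mulKmx (frame_mx_unit Oy))).
have LE u' : S y *m (L y u' *m w) = D (cochart i y) (s (cochart i y) u') (fun z => s z w) i.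
  by rewrite (nabla_frame _ _ Uy yi) yE -(frame_mxE _ Oy).
rewrite LE mulmxDl -scalemxAl mulmxDr -scalemxAr !LE s_linear //.
by rewrite (nabla_linear D (s_at w Uy)).
Qed.

Lemma frame_form_smooth u : smooth_on O (L^~ u).
Proof.
apply: smooth_mxP => // k l; under eq_fun do rewrite mxE.
apply: smooth_entry => //; apply: smooth_mulmx => //.
  apply: smooth_invmx => //; [exact: frame_mx_unit|exact: frame_mx_smooth].
exact: (nabla_smooth D oU (s_field u) (s_field (delta_mx l 0)) i).
Qed.

Let dS y : O y -> differentiable S y.
Proof. exact: smooth_differentiable frame_mx_smooth. Qed.

Let dL y u : O y -> differentiable (L^~ u) y.
Proof. exact: smooth_differentiable (frame_form_smooth u). Qed.

Lemma diff_frame x u w : U x -> dom i x ->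
  'd (fun y => s (cochart i y) w i) (chart i x) (s x u i)
    = 'D_(S (chart i x) *m u) S (chart i x) *m w.
Proof.
move=> Ux xi; have Ox : O (chart i x) by exists x.
rewrite (frame_mx_at u Ux xi).
have dsw := smooth_differentiable (s_field w i) Ox.
have dS' := dS Ox.
have E1 : 'D_(s x u i) (fun y => S y *m w) (chart i x)
    = 'D_(s x u i) S (chart i x) *m w.
  by rewrite derive_mulmx // derive_cst mulmx0 addr0.
apply: etrans _ E1; apply: etrans (esym (deriveE _ dsw)) _.
by apply: (derive_on _ oO Ox) => z; rewrite inE => Oz; rewrite frame_mxE.
Qed.

Lemma bracket_frame x u v : U x ->
  bracket (fun z => s z u) (fun z => s z v) x
    = D x (s x u) (fun z => s z v) - D x (s x v) (fun z => s z u).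
Proof.
by move=> Ux; have /eqP := tfree (s_at u Ux) (s_at v Ux); rewrite subr_eq0 => /eqP.
Qed.

(** Without torsion the bracket of two frame fields is the difference of their
    covariant derivatives; in the chart this bracket is a difference of
    derivatives of the frame matrix. *)
Lemma frame_torsion y u v : O y ->
  'D_(S y *m u) S y *m v - 'D_(S y *m v) S y *m u
    = S y *m (L y u *m v - L y v *m u).
Proof.
move=> Oy; have [Uy yi yE] := cochart_in Oy.
have := congr1 (fun t : tangent (cochart i y) => t i) (bracket_frame u v Uy).
move=> /(etrans (esym (bracket_coord oU Uy (s_field u) (s_field v) yi))).
move=> /(etrans (esym (congr2 (fun a b => a - b) (diff_frame u v Uy yi) (diff_frame v u Uy yi)))).
rewrite yE => ->.
rewrite tangentD tangentN (nabla_frame u v Uy yi) (nabla_frame v u Uy yi) yE.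
by rewrite -(frame_mxE (L y u *m v) Oy) -(frame_mxE (L y v *m u) Oy) mulmxBr.
Qed.

(** The inner covariant derivative is a combination of frame fields with
    coefficients the entries of [L]; the Leibniz rule differentiates these
    coefficients, and one more application of [nabla_frame] gives the product of
    two connection matrices. *)
Lemma nabla_nabla_frame x u v w : U x -> dom i x ->
  D x (s x u) (fun z => D z (s z v) (fun t => s t w))
    = s x (('D_(S (chart i x) *m u) (L^~ v) (chart i x)
            + L (chart i x) u *m L (chart i x) v) *m w).
Proof.
move=> Ux xi; have Ox : O (chart i x) by exists x.
pose f k (z : M) : R := (L (chart i z) v *m w) k 0.
pose F k : vfield M := fun z => f k z *: s z (delta_mx k 0).
pose U' := U `&` dom i.
have oU' : open U' by apply: openI => //; exact: dom_open.
have U'x : U' x by [].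
have sf k : smooth_fun U' (f k).
  move=> j; rewrite -[_ \o _]/((fun y => (L y v *m w) k 0) \o (chart i \o cochart j)).
  apply: (smooth_comp oO (chart_image_open oU')).
  - by move=> y [z [[Uz zi] zj] <-]; exists z => //=; rewrite chartK.
  - apply: smooth_entry => //; apply: smooth_mulmx => //.
      exact: frame_form_smooth.
    exact: smooth_cst.
  - apply: subset_smooth_on (transition_smooth j i) => y [z [[Uz zi] zj] <-].
    by exists z.
have s_field' w' : smooth_field U' (fun z => s z w').
  move=> j; apply: subset_smooth_on (s_field w' j) => y [z [[Uz zi] zj] <-].
  by exists z.
have sF k : smooth_field U' (F k) by exact: smooth_fieldZ.
have sN : smooth_at x (fun z => D z (s z v) (fun t => s t w)).
  by exists U; split => //; exact: (nabla_smooth D oU (s_field v) (s_field w)).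
have sum_s z (c : 'I_m -> R) : U z ->
    \sum_k c k *: s z (delta_mx k 0) = s z (\col_k c k).
  move=> Uz; rewrite (linear_coords _ (s_linear Uz)).
  by apply: eq_bigr => k _; rewrite mxE.
have nearF : \forall z \near x,
    D z (s z v) (fun t => s t w) = \sum_k F k z.
  apply: filterS (open_near oU' U'x) => z [Uz zi].
  rewrite nabla_frame // sum_s //; congr (s z _).
  by apply/matrixP => k j; rewrite mxE ord1.
rewrite (nabla_local D _ sN nearF) (nabla_sum D _ _ oU' U'x sF).
have dLw : differentiable (fun y => L y v *m w) (chart i x).
  by apply: differentiable_mulmx; [exact: dL|exact: differentiable_cst].
have nF k : D x (s x u) (F k) =
    (('D_(S (chart i x) *m u) (L^~ v) (chart i x) *m w) k 0) *: s x (delta_mx k 0)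
    + f k x *: s x (L (chart i x) u *m delta_mx k 0).
  have sfk : smooth_fun_at x (f k) by exists U'.
  rewrite (nabla_leibniz D _ sfk (s_at _ Ux) xi) nabla_frame //.
  apply: (congr1 (fun c : R => c *: s x (delta_mx k 0) + _)).
  have dfk : differentiable (f k \o cochart i) (chart i x).
    by apply: smooth_differentiable (sf k i) _; exists x.
  have E1 : 'D_(s x u i) (f k \o cochart i) (chart i x)
     = 'D_(s x u i) (fun y => (L y v *m w) k 0) (chart i x).
    apply: (derive_on _ oO Ox) => y; rewrite inE => Oy.
    by have [_ _ yE] := cochart_in Oy; rewrite /f /= yE.
  apply: etrans (esym (deriveE _ dfk)) _; apply: etrans E1 _.
  rewrite (frame_mx_at u Ux xi) derive_entry //.
  apply: (congr1 (fun A : E => A k 0)).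
  by rewrite (derive_mulmx _ (dL v Ox)) // derive_cst mulmx0 addr0.
have fsum : \sum_k f k x *: s x (L (chart i x) u *m delta_mx k 0)
    = s x (L (chart i x) u *m (L (chart i x) v *m w)).
  have lsl : linear (fun w' => s x (L (chart i x) u *m w')).
    by move=> c w1 w2; rewrite mulmxDr -scalemxAr s_linear.
  by rewrite (linear_coords (L (chart i x) v *m w) lsl).
rewrite (eq_bigr _ (fun k _ => nF k)) big_split /= fsum sum_s //.
have sD w1 w2 : s x w1 + s x w2 = s x (w1 + w2).
  by have := s_linear Ux 1 w1 w2; rewrite !scale1r.
rewrite sD mulmxDl mulmxA; congr (s x (_ + _)).
by apply/matrixP => k j; rewrite mxE ord1.
Qed.

Lemma frame_curvature (R0 : E -> E -> 'M[R]_m) y u v :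
  (forall x p (X Y Z : vfield M) u v w, P x p -> smooth_at x X ->
        smooth_at x Y -> smooth_at x Z -> X x = p u -> Y x = p v ->
        Z x = p w -> curvature D X Y Z x = p (R0 u v *m w)) ->
  O y ->
  'D_(S y *m u) (L^~ v) y - 'D_(S y *m v) (L^~ u) y
    + (L y u *m L y v - L y v *m L y u)
    - L y (L y u *m v - L y v *m u) = R0 u v.
Proof.
move=> curv Oy; have [Uy yi yE] := cochart_in Oy.
have Py : P (cochart i y) (s (cochart i y)) by case: sec => _ + _; apply.
apply: linmx_ext => w; apply: (s_inj Uy).
rewrite -(curv _ _ _ _ _ u v w Py (s_at u Uy) (s_at v Uy) (s_at w Uy) erefl erefl erefl).
rewrite /curvature !nabla_nabla_frame // bracket_frame // !nabla_frame // yE.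
have sB w1 w2 : s (cochart i y) w1 - s (cochart i y) w2 = s (cochart i y) (w1 - w2).
  by have := s_linear Uy (-1) w2 w1; rewrite !scaleN1r addrC => <-; rewrite addrC.
rewrite !sB (nabla_frame _ w Uy yi) yE !sB; apply: (congr1 (s (cochart i y))).
rewrite -mulmxBl -mulmxBl; congr (_ *m _).
by rewrite opprD addrACA.
Qed.

(** The union defining the inner torsion contains the contribution of the given
    section, so the representative supplied by this section lies in [I0 u]. *)
Lemma frame_inner (I0 : E -> set 'M[R]_m) y u :
  (forall x p u, P x p -> inner_torsion D g P (p u) = Adbar p (I0 u)) ->
  g 0 -> O y -> I0 u (L y u).
Proof.
move=> inn g0 Oy; have [Uy yi yE] := cochart_in Oy.
have Py : P (cochart i y) (s (cochart i y)) by case: sec => _ + _; apply.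
have [_ [inv sK Ks]] := frames_iso Py.
pose F (t : tangent (cochart i y)) := s (cochart i y) (L y u *m inv t).
have : inner_torsion D g P (s (cochart i y) u) F.
  exists U, s, (L y), u; split => //.
    by move=> u' w; rewrite nabla_frame // yE.
  exists (L y u); last by move=> w; rewrite /F sK.
  by exists 0 => //; rewrite addr0.
rewrite (inn _ _ u Py) => -[A IA FA].
have -> // : L y u = A; apply: linmx_ext => w; apply: (s_inj Uy).
by rewrite -FA /F sK.
Qed.

Lemma cartan_of_local_frame (R0 : E -> E -> 'M[R]_m) (I0 : E -> set 'M[R]_m) T0 :
  g 0 -> characteristic_tensors D g P T0 R0 I0 ->
  cartan_structure O R0 I0 (fun y => invmx (S y))
    (fun y a => L y (invmx (S y) *m a)).
Proof.
move=> g0 [_ [_ curv] [_ inn]]; apply: cartan_of_frame => //.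
- exact: frame_form_linear.
- exact: frame_mx_unit.
- exact: frame_mx_smooth.
- exact: frame_form_smooth.
- exact: frame_torsion.
- by move=> y u v Oy; exact: frame_curvature.
- by move=> y u Oy; exact: frame_inner.
Qed.

End LocalFrame.

(** Any local section and any chart will do: the characteristic tensors are the
    same for all frames of the structure. *)
Lemma cartan_of_manifold (R : realType) (m : nat) (M : manifold R m)
    (D : connection M) (G g : set 'M[R]_m) (P : Gstructure M G) T0 R0 I0 :
  g 0 -> torsion_free D -> characteristic_tensors D g P T0 R0 I0 ->
  exists O th om p, O p /\ cartan_structure O R0 I0 th om.
Proof.
move=> g0 tf ct; have [x] := carrier_nonempty M.
have [U [s [Ux sec]]] := frames_section P x.
have [i xi] := dom_cover x.
eexists _, _, _, (chart i x); split; last exact: (cartan_of_local_frame sec i tf g0 ct).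
by exists x.
Qed.

(** * From the structure equations to a homogeneous manifold *)

Section GlobalChart.
Context {R : realType} {m : nat} (M : manifold R m) (i : idx M).
Hypothesis one_chart : forall j : idx M, j = i.
Hypothesis chart_total : forall x : M, dom i x.
Local Notation E := ('cV[R]_m).

Let ph : M -> E := chart i.
Let ps : E -> M := cochart i.

Let im : set E := chart i @` dom i.

Lemma global_chart_image_open : open im. Proof. exact: chart_open. Qed.

Lemma global_chart_image x : im (ph x). Proof. by exists x. Qed.

Lemma global_cochartK y : im y -> ph (ps y) = y.
Proof. by move=> [x xi <-]; rewrite /ps /ph chartK. Qed.

Lemma global_chartK x : ps (ph x) = x. Proof. exact: chartK. Qed.

Lemma diff_transition x (w : E) : 'd (ph \o ps) (ph x) w = w.
Proof.
have nid : \forall y \near ph x, id y = (ph \o ps) y.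
  have := open_near global_chart_image_open (global_chart_image x).
  by apply: filterS => y /global_cochartK.
have did : differentiable id (ph x) by exact: ex_diff.
rewrite -(near_diff w nid did) -deriveE //; exact: derive_id.
Qed.

Lemma const_is_tangent (x : M) (w : E) : (fun=> w) \in is_tangent x.
Proof.
apply/asboolP; split=> [j nj|j k _ _].
  by case: nj; rewrite (one_chart j).
by rewrite (one_chart j) (one_chart k); exact: esym (diff_transition x w).
Qed.

Definition mk_tangent (x : M) (w : E) : tangent x :=
  Tangent (const_is_tangent x w).

Lemma mk_tangentE x w j : mk_tangent x w j = w. Proof. by []. Qed.

Lemma mk_tangentK x (v : tangent x) : mk_tangent x (v i) = v.
Proof. exact: (tangent_inj (chart_total x)). Qed.

Lemma mk_tangent_linear x : linear (mk_tangent x).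
Proof. by move=> c v w; exact: (tangent_inj (chart_total x)). Qed.

Definition field_coord (X : vfield M) (y : E) : E := X (ps y) i.

Lemma field_coordE (X : vfield M) x : field_coord X (ph x) = X x i.
Proof. by rewrite /field_coord global_chartK. Qed.

Lemma smooth_at_coord (X : vfield M) x : smooth_at x X ->
  exists O, [/\ open O, O (ph x), O `<=` im & smooth_on O (field_coord X)].
Proof.
move=> [U [oU Ux sX]]; exists (chart i @` (U `&` dom i)); split.
- exact: chart_image_open.
- by exists x.
- by move=> y [z [_ zi] <-]; exists z.
- exact: (sX i).
Qed.

Context (O : set E) (R0 : E -> E -> 'M[R]_m) (I0 : E -> set 'M[R]_m).
Context (th : E -> 'M[R]_m) (om : E -> E -> 'M[R]_m).
Context (cs : cartan_structure O R0 I0 th om).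
Hypothesis imO : im `<=` O.

Let oO : open O := cartan_open cs.

Let sth : smooth_on O th := cartan_smooth_th cs.

Let uth y : O y -> th y \in unitmx. Proof. exact: (cartan_unit cs). Qed.

(** The components in the frame dual to [th] of the covariant derivative of
    the field with components [Y] in the direction [a]. *)
Definition frame_cov (Y : E -> E) (y a : E) : E :=
  'D_a (fun z => th z *m Y z) y + om y a *m (th y *m Y y).

Lemma thM_differentiable (Y : E -> E) y : O y -> differentiable Y y ->
  differentiable (fun z => th z *m Y z) y.
Proof.
by move=> Oy dY; apply: differentiable_mulmx => //; exact: smooth_differentiable sth Oy.
Qed.

Lemma frame_cov_linear (Y : E -> E) y : O y -> differentiable Y y ->
  linear (frame_cov Y y).
Proof.
move=> Oy dY c a b; have E1 := derive_linear c a b (thM_differentiable Oy dY).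
rewrite /frame_cov E1 (cartan_linear cs Oy).
move: ('D_a _ y) ('D_b _ y) (th y *m Y y) => A B T.
by rewrite mulmxDl -scalemxAl scalerDr addrACA.
Qed.

Lemma frame_cov_near (Y Z : E -> E) y a : O y ->
  (\forall z \near y, Y z = Z z) -> frame_cov Y y a = frame_cov Z y a.
Proof.
move=> Oy YZ; have Yy := nbhs_singleton YZ.
have E1 : 'D_a (fun z => th z *m Y z) y = 'D_a (fun z => th z *m Z z) y.
  by apply: near_eq_derive; apply: filterS YZ => z ->.
by rewrite /frame_cov E1 Yy.
Qed.

Lemma frame_covD (Y Z : E -> E) y a : O y ->
  differentiable Y y -> differentiable Z y ->
  frame_cov (fun z => Y z + Z z) y a = frame_cov Y y a + frame_cov Z y a.
Proof.
move=> Oy dY dZ; rewrite /frame_cov.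
have -> : (fun z => th z *m (Y z + Z z))
    = (fun z => th z *m Y z) + (fun z => th z *m Z z).
  by apply/funext => z; rewrite mulmxDr.
rewrite deriveD; [|exact/diff_derivable/thM_differentiable..].
by rewrite !mulmxDr addrACA.
Qed.

Lemma frame_covZ (f : E -> R) (Y : E -> E) y a : O y ->
  differentiable f y -> differentiable Y y ->
  frame_cov (fun z => f z *: Y z) y a
    = 'D_a f y *: (th y *m Y y) + f y *: frame_cov Y y a.
Proof.
move=> Oy df dY; rewrite /frame_cov.
have -> : (fun z => th z *m (f z *: Y z)) = (fun z => f z *: (th z *m Y z)).
  by apply/funext => z; rewrite scalemxAr.
rewrite derive_scalemx //; last exact: thM_differentiable.
by rewrite -!scalemxAr scalerDr addrA.
Qed.

Lemma frame_cov_smooth (U : set E) (X Y : E -> E) : open U -> U `<=` O ->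
  smooth_on U X -> smooth_on U Y -> smooth_on U (fun y => frame_cov Y y (X y)).
Proof.
move=> oU UO sX sY.
have sthY : smooth_on U (fun z => th z *m Y z).
  by apply: smooth_mulmx => //; exact: subset_smooth_on sth.
apply: (@eq_smooth_on _ _ _ U
  (fun y => \sum_k X y k 0 *: frame_cov Y y (delta_mx k 0))) => //.
  move=> y; rewrite inE => Uy; apply/esym.
  apply: (linear_coords (X y)); apply: frame_cov_linear; first exact: UO.
  exact: smooth_differentiable sY Uy.
apply: smooth_sum => // k _; apply: smooth_scalemx => //.
  exact: smooth_entry.
apply: smoothD => //; first exact: smooth_derive.
apply: smooth_mulmx => //; apply: subset_smooth_on UO _.
exact: (cartan_smooth_om cs).
Qed.

Definition cartan_nabla (x : M) (v : tangent x) (Y : vfield M) : tangent x :=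
  mk_tangent x (invmx (th (ph x)) *m frame_cov (field_coord Y) (ph x) (v i)).

Let Oph x : O (ph x). Proof. exact/imO/global_chart_image. Qed.

Let diff_at (X : vfield M) x : smooth_at x X ->
  differentiable (field_coord X) (ph x).
Proof.
by move=> /smooth_at_coord[U [oU Ux _ sX]]; exact: smooth_differentiable sX Ux.
Qed.

Lemma near_chart (x : M) (Q : M -> Prop) :
  (\forall z \near x, Q z) -> \forall y \near ph x, Q (ps y).
Proof.
move=> nQ; have Iy := global_chart_image x.
have := cochart_continuous Iy; rewrite /prop_for /continuous_at.
rewrite -/ps -/ph global_chartK => /(_ _ nQ); exact.
Qed.

Lemma cartan_nabla_linear (x : M) (Y : vfield M) : smooth_at x Y ->
  linear (fun v : tangent x => cartan_nabla v Y).
Proof.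
move=> sY c v w; apply: (tangent_inj (chart_total x)).
rewrite tangentD tangentZ /cartan_nabla !mk_tangentE.
rewrite tangentD tangentZ (frame_cov_linear (Oph x) (diff_at sY)).
by rewrite mulmxDr -scalemxAr.
Qed.

Lemma cartan_nabla_local (x : M) (v : tangent x) (Y Z : vfield M) :
  smooth_at x Y -> (\forall y \near x, Y y = Z y) ->
  cartan_nabla v Y = cartan_nabla v Z.
Proof.
move=> _ YZ; congr (mk_tangent x (_ *m _)); apply: frame_cov_near => //.
apply: filterS (near_chart YZ) => y YZy.
by rewrite /field_coord YZy.
Qed.

Lemma cartan_nabla_add (x : M) (v : tangent x) (Y Z : vfield M) :
  smooth_at x Y -> smooth_at x Z ->
  cartan_nabla v (fun y => Y y + Z y) = cartan_nabla v Y + cartan_nabla v Z.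
Proof.
move=> sY sZ; apply: (tangent_inj (chart_total x)).
rewrite tangentD /cartan_nabla !mk_tangentE -mulmxDr.
by rewrite -(frame_covD (v i) (Oph x) (diff_at sY) (diff_at sZ)).
Qed.

Lemma cartan_nabla_leibniz (x : M) (v : tangent x) (f : M -> R) (Y : vfield M) j :
  smooth_fun_at x f -> smooth_at x Y -> dom j x ->
  cartan_nabla v (fun y => f y *: Y y) =
    'd (f \o cochart j) (chart j x) (v j) *: Y x + f x *: cartan_nabla v Y.
Proof.
rewrite (one_chart j) => -[U [oU Ux sf]] sY xi; apply: (tangent_inj (chart_total x)).
have df : differentiable (f \o ps) (ph x).
  by apply: smooth_differentiable (sf i) _; exists x.
rewrite tangentD !tangentZ /cartan_nabla !mk_tangentE.
have := frame_covZ (v i) (Oph x) df (diff_at sY).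
rewrite (deriveE _ df) field_coordE /= global_chartK => C1.
apply: etrans (congr1 (mulmx (invmx (th (ph x)))) C1) _.
by rewrite mulmxDr -!scalemxAr mulKmx ?uth.
Qed.

Lemma cartan_nabla_coord (X Y : vfield M) y : im y ->
  field_coord (fun x => cartan_nabla (X x) Y) y
    = invmx (th y) *m frame_cov (field_coord Y) y (field_coord X y).
Proof.
by move=> Iy; rewrite {1}/field_coord /cartan_nabla mk_tangentE global_cochartK.
Qed.

Lemma cartan_nabla_smooth (U : set M) (X Y : vfield M) : open U ->
  smooth_field U X -> smooth_field U Y ->
  smooth_field U (fun x => cartan_nabla (X x) Y).
Proof.
move=> oU sX sY j; rewrite (one_chart j); have oC := chart_image_open (i := i) oU.
have sub : chart i @` (U `&` dom i) `<=` im by move=> y [z [_ zi] <-]; exists z.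
apply: (@eq_smooth_on _ _ _ _ (fun y =>
  invmx (th y) *m frame_cov (field_coord Y) y (field_coord X y))) => //.
  by move=> y; rewrite inE => /sub /(cartan_nabla_coord X Y).
apply: smooth_mulmx => //.
  apply: smooth_invmx => //; first by move=> y /sub/imO/uth.
  by apply: subset_smooth_on sth => y /sub/imO.
by apply: frame_cov_smooth => // y /sub/imO.
Qed.

Definition cartan_connection : connection M :=
  Connection cartan_nabla_linear cartan_nabla_local cartan_nabla_add
    cartan_nabla_leibniz cartan_nabla_smooth.

Lemma bracket_field_coord (X Y : vfield M) x : smooth_at x X -> smooth_at x Y ->
  bracket X Y x i = 'D_(X x i) (field_coord Y) (ph x)
                  - 'D_(Y x i) (field_coord X) (ph x).
Proof.
move=> [U [oU Ux sX]] [U' [oU' U'x sY]].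
have sub (Z : vfield M) U1 : smooth_field U1 Z -> U `&` U' `<=` U1 ->
    smooth_field (U `&` U') Z.
  move=> sZ su j; apply: subset_smooth_on (sZ j) => y [z [/su Uz zj] <-].
  by exists z.
rewrite (bracket_coord (openI oU oU') (conj Ux U'x) (sub _ _ sX _) (sub _ _ sY _)) //.
by rewrite !deriveE //; apply: diff_at; [exists U|exists U'].
Qed.

Lemma cartan_torsion_free : torsion_free cartan_connection.
Proof.
move=> x X Y sX sY; apply: (tangent_inj (chart_total x)).
have dX := diff_at sX; have dY := diff_at sY.
rewrite /torsion tangentD tangentN tangentD tangentN.
rewrite (bracket_field_coord sX sY) tangent0 /=.
apply: (can_inj (mulKmx (uth (Oph x)))).
rewrite mulmx0 !mulmxBr !mulKVmx ?uth // /frame_cov !field_coordE.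
have dth := smooth_differentiable sth (Oph x).
have E1 := derive_mulmx (X x i) dth dY; have E2 := derive_mulmx (Y x i) dth dX.
rewrite !field_coordE in E1 E2; rewrite E1 E2.
have swap (a b c f h k : E) : a - b = h - k ->
    a + c + k - (b + f + h) - (c - f) = 0.
  move=> /(canRL (subrK _)) ->.
  by apply/matrixP => k' l; rewrite !mxE; ring.
exact/swap/(cartan_torsion cs _ _ (Oph x)).
Qed.

Lemma smooth_at_coord3 (X Y Z : vfield M) x :
  smooth_at x X -> smooth_at x Y -> smooth_at x Z ->
  exists U, [/\ open U, U (ph x) & U `<=` im] /\
    [/\ smooth_on U (field_coord X), smooth_on U (field_coord Y)
      & smooth_on U (field_coord Z)].
Proof.
move=> /smooth_at_coord[U1 [U1o x1 i1 s1]].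
move=> /smooth_at_coord[U2 [U2o x2 _ s2]].
move=> /smooth_at_coord[U3 [U3o x3 _ s3]].
exists (U1 `&` (U2 `&` U3)); split; split.
- by apply: openI => //; exact: openI.
- by [].
- by move=> y [/i1].
- by apply: subset_smooth_on s1 => y [].
- by apply: subset_smooth_on s2 => y [_ []].
- by apply: subset_smooth_on s3 => y [_ []].
Qed.

(** Second covariant derivative, expanded. In the curvature the term with
    ['D_a A] is absorbed by the bracket, the second derivative of [th *m Z]
    cancels by symmetry, and the terms linear in [om] cancel in pairs; the
    derivative and the commutator of [om] remain. *)
Lemma frame_cov_cov (U : set E) (A Z : E -> E) y a : open U -> U y -> U `<=` O ->
  smooth_on U A -> smooth_on U Z ->
  frame_cov (fun z => invmx (th z) *m frame_cov Z z (A z)) y a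
  = frame_cov Z y ('D_a A y)
    + 'D_a (fun z => 'D_(A y) (fun t => th t *m Z t) z) y
    + 'D_a (om^~ (A y)) y *m (th y *m Z y)
    + om y (A y) *m 'D_a (fun t => th t *m Z t) y
    + om y a *m frame_cov Z y (A y).
Proof.
move=> oU Uy UO sA sZ; have Oy := UO _ Uy.
pose Zt z := th z *m Z z.
have sZt : smooth_on U Zt by apply: smooth_mulmx => //; exact: subset_smooth_on sth.
have dA := smooth_differentiable sA Uy; have dZt := smooth_differentiable sZt Uy.
have dom u : differentiable (om^~ u) y.
  exact: smooth_differentiable (cartan_smooth_om cs u) Oy.
have lom z : U z -> linear (om z) by move=> /UO; exact: (cartan_linear cs).
have somA : smooth_on U (fun z => om z (A z)).
  apply: (@eq_smooth_on _ _ _ U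
    (fun z => \sum_k A z k 0 *: om z (delta_mx k 0))) => //.
    by move=> z; rewrite inE => Uz; rewrite -(linear_coords (A z) (lom _ Uz)).
  apply: smooth_sum => // k _; apply: smooth_scalemx => //.
    exact: smooth_entry.
  by apply: subset_smooth_on UO _; exact: (cartan_smooth_om cs).
have domA := smooth_differentiable somA Uy.
have E1 : 'D_a (fun z => th z *m (invmx (th z) *m frame_cov Z z (A z))) y
        = 'D_a ((fun z => 'D_(A z) Zt z) + (fun z => om z (A z) *m Zt z)) y.
  by apply: (derive_on a oU Uy) => z; rewrite inE => /UO /uth uz; rewrite mulKVmx.
have E2 : 'D_a ((fun z => 'D_(A z) Zt z) + (fun z => om z (A z) *m Zt z)) y
    = 'D_a (fun z => 'D_(A z) Zt z) y + 'D_a (fun z => om z (A z) *m Zt z) y.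
  apply: deriveD; apply: diff_derivable; last exact: differentiable_mulmx.
  have sDA : smooth_on U (fun z => 'D_(A z) Zt z).
    apply: (@eq_smooth_on _ _ _ U
      (fun z => \sum_k A z k 0 *: 'D_(delta_mx k 0) Zt z) _ oU).
      move=> z; rewrite inE => Uz; apply: esym.
      exact: (derive_coords (A z) (smooth_differentiable sZt Uz)).
    apply: (smooth_sum _ oU) => k _; apply: (smooth_scalemx oU).
      exact: smooth_entry.
    exact: smooth_derive.
  exact: smooth_differentiable sDA Uy.
have E3 := derive_moving_direction a oU Uy sZt dA.
have E4 := derive_mulmx a domA dZt.
have E5 := derive_moving_argument a oU Uy lom dom dA.
rewrite {1}/frame_cov (mulKVmx (uth Oy)).
apply: etrans (congr1 (fun t : E => t + _) (etrans E1 (etrans E2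
  (congr2 (fun s t : E => s + t) E3 E4)))) _.
rewrite E5 {2}/frame_cov mulmxDl.
have swap (b c d e f h : E) : b + c + (d + e + f) + h = b + d + c + e + f + h.
  by apply/matrixP => k' l; rewrite !mxE; ring.
exact: swap.
Qed.

Lemma cartan_connectionE (x : M) (v : tangent x) (Y : vfield M) (f : E -> E) :
  (\forall y \near ph x, field_coord Y y = f y) ->
  cartan_connection x v Y i = invmx (th (ph x)) *m frame_cov f (ph x) (v i).
Proof.
by move=> Yf; rewrite -(frame_cov_near (v i) (Oph x) Yf).
Qed.

Lemma cartan_connection_curvature x (X Y Z : vfield M) :
  smooth_at x X -> smooth_at x Y -> smooth_at x Z ->
  curvature cartan_connection X Y Z x i = invmx (th (ph x)) *m
    (R0 (th (ph x) *m X x i) (th (ph x) *m Y x i) *m (th (ph x) *m Z x i)).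
Proof.
move=> sX sY sZ; have [U [[oU Ux Uim] [sXc sYc sZc]]] := smooth_at_coord3 sX sY sZ.
have UO : U `<=` O by move=> y /Uim /imO.
have second (A : vfield M) :
    \forall y \near ph x, field_coord (fun z => cartan_connection z (A z) Z) y
      = invmx (th y) *m frame_cov (field_coord Z) y (field_coord A y).
  by apply: filterS (open_near oU Ux) => y /Uim /cartan_nabla_coord; apply.
rewrite /curvature !tangentD !tangentN.
have N1 := cartan_connectionE (X x) (second Y).
have N2 := cartan_connectionE (Y x) (second X).
have N3 : cartan_connection x (bracket X Y x) Z i = invmx (th (ph x))
    *m frame_cov (field_coord Z) (ph x) (bracket X Y x i) by [].
apply: etrans (congr2 (fun a b : E => a - b) (congr2 (fun a b : E => a - b) N1 N2) N3) _.
have covL := frame_cov_linear (Oph x) (smooth_differentiable sZc Ux).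
have br : frame_cov (field_coord Z) (ph x) (bracket X Y x i)
    = frame_cov (field_coord Z) (ph x) ('D_(X x i) (field_coord Y) (ph x))
    - frame_cov (field_coord Z) (ph x) ('D_(Y x i) (field_coord X) (ph x)).
  by rewrite (bracket_field_coord sX sY) addrC -scaleN1r covL scaleN1r addrC.
rewrite br (frame_cov_cov _ oU Ux UO sYc sZc) (frame_cov_cov _ oU Ux UO sXc sZc).
rewrite -!mulmxBr; congr (_ *m _); rewrite -(cartan_curvature cs _ _ (Oph x)).
have sZt : smooth_on U (fun t => th t *m field_coord Z t).
  by apply: smooth_mulmx => //; exact: subset_smooth_on sth.
rewrite !field_coordE (schwarz_mx (X x i) (Y x i) oU Ux sZt).
have fcE c : frame_cov (field_coord Z) (ph x) c
    = 'D_c (fun t => th t *m field_coord Z t) (ph x) + om (ph x) c *m (th (ph x) *m Z x i).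
  by rewrite /frame_cov field_coordE.
rewrite (fcE (X x i)) (fcE (Y x i)) mulmxDl mulmxBl [in RHS]mulmxBl -!mulmxA !mulmxDr.
have swap (f h s a b c d e k : E) :
    f + s + a + c + (d + e) - (h + s + b + d + (c + k)) - (f - h) = a - b + (e - k).
  by apply/matrixP => k' l; rewrite !mxE; ring.
exact: swap.
Qed.

Context (G g : set 'M[R]_m).
Hypothesis G1 : G 1%:M.
Hypothesis GM : forall k l, G k -> G l -> G (k *m l).
Hypothesis GV : forall k, G k -> G (invmx k).
Hypothesis GU : forall k, G k -> k \in unitmx.
Hypothesis gD : forall A B, g A -> g B -> g (A + B).
Hypothesis gB : forall A B, g A -> g B -> g (A - B).
Hypothesis maurer_cartan : forall (U : set E) (k : E -> 'M[R]_m) y a, open U ->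
  U y -> smooth_on U k -> (forall z, U z -> G (k z)) -> g (invmx (k y) *m 'D_a k y).
Hypothesis I0coset : forall u, exists A, I0 u = coset g A.
Hypothesis I0equivariant : quot_equivariant G I0.
Hypothesis R0equivariant : equivariant2 G R0.

Definition std_frame (x : M) (w : E) : tangent x :=
  mk_tangent x (invmx (th (ph x)) *m w).

Lemma std_frame_coord x (v : tangent x) : std_frame x (th (ph x) *m v i) = v.
Proof. by rewrite /std_frame mulKmx ?uth //; exact: mk_tangentK. Qed.

Definition cartan_frames (x : M) : set (E -> tangent x) :=
  [set p | exists2 k, G k & p = (fun w => std_frame x (k *m w))].

Arguments cartan_frames : clear implicits.

Lemma cartan_frames_iso x p : cartan_frames x p -> linear p /\ bijective p.
Proof.
move=> [k Gk ->]; split.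
  move=> c v w; rewrite /std_frame !mulmxDr -!scalemxAr.
  exact: mk_tangent_linear.
exists (fun v : tangent x => invmx k *m (th (ph x) *m v i)) => [w|v] /=.
  by rewrite mulKVmx ?uth // mulKmx ?GU.
by rewrite mulKVmx ?GU // std_frame_coord.
Qed.

Lemma cartan_frames_torsor x p q : cartan_frames x p ->
  cartan_frames x q <-> exists2 k, G k & q = (fun w => p (k *m w)).
Proof.
move=> [k Gk ->]; split=> [[l Gl ->]|[l Gl ->]].
  exists (invmx k *m l); first by apply: GM => //; exact: GV.
  by apply/funext => w; rewrite -!mulmxA mulKVmx ?GU.
by exists (k *m l); [exact: GM|apply/funext => w; rewrite mulmxA].
Qed.

Lemma std_section k : G k ->
  smooth_section cartan_frames setT (fun y w => std_frame y (k *m w)).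
Proof.
move=> Gk; split; [exact: openT|by move=> y _; exists k|move=> w j].
rewrite (one_chart j).
have oT : open (chart i @` (setT `&` dom i)) by apply: chart_image_open; exact: openT.
have sub : chart i @` (setT `&` dom i) `<=` im by move=> y [z [_ zi] <-]; exists z.
apply: (@eq_smooth_on _ _ _ _ (fun y => invmx (th y) *m (k *m w))) => //.
  by move=> y; rewrite inE => /sub /global_cochartK /= E1; rewrite -{1}E1.
apply: smooth_mulmx => //; last exact: smooth_cst.
apply: smooth_invmx => //; first by move=> y /sub/imO/uth.
by apply: subset_smooth_on sth => y /sub/imO.
Qed.

Lemma cartan_frames_section x :
  exists U s, U x /\ smooth_section cartan_frames U s.
Proof. by exists setT; eexists; split; [|exact: std_section G1]. Qed.

Definition cartan_Gstructure : Gstructure M G :=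
  GStructure cartan_frames_iso cartan_frames_torsor cartan_frames_section.

Lemma coset_mem u A : g 0 -> I0 u A -> coset g A = I0 u.
Proof.
move=> g0; have [B ->] := I0coset u => -[C gC <-].
apply/seteqP; split=> [_ [F gF <-]|_ [F gF <-]].
  by exists (C + F); [exact: gD|rewrite addrA].
by exists (F - C); [exact: gB|rewrite addrA addrAC addrK].
Qed.

(** A section is the standard one moved by a function [K] with values in the
    group. This conjugates the connection form, which by equivariance is harmless
    for the coset, and adds the Maurer-Cartan term [K^-1 dK], which lies in the
    Lie algebra. *)
Lemma connection_form_mem (U : set M) (s : frame_field M) x L u :
  g 0 -> smooth_section cartan_frames U s -> U x ->
  connection_form cartan_connection s x L -> I0 u (L u).
Proof.
move=> g0 [oU Us ss] Ux cL.
pose K y := th y *m linmx (fun w => s (ps y) w i).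
pose C := chart i @` (U `&` dom i).
have oC : open C by exact: chart_image_open.
have Cx : C (ph x) by exists x.
have CO : C `<=` O by move=> y [z [_ zi] <-]; exact/imO/global_chart_image.
have Kgauge z : U z -> G (K (ph z)) /\ forall w, s z w = std_frame z (K (ph z) *m w).
  move=> Uz; have [k Gk sk] := Us z Uz.
  suff -> : K (ph z) = k by split => // w; rewrite sk.
  apply: linmx_ext => w; rewrite /K -mulmxA mul_linmx.
    by rewrite global_chartK sk /= mulKVmx ?uth.
  by move=> c w1 w2; rewrite global_chartK sk /= !mulmxDr -!scalemxAr.
have sK : smooth_on C K.
  apply: smooth_mulmx => //; first exact: subset_smooth_on sth.
  apply: smooth_mxP => // k l; under eq_fun do rewrite mxE.
  by apply: smooth_entry => //; exact: (ss (delta_mx l 0) i).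
clearbody K; have [GK sKx] := Kgauge x Ux.
have nK w : \forall y \near ph x,
    field_coord (fun y => s y w) y = invmx (th y) *m (K y *m w).
  apply: filterS (open_near oC Cx) => y [z [Uz zi] <-].
  by rewrite field_coordE (Kgauge z Uz).2.
pose a := s x u i.
have aE : th (ph x) *m a = K (ph x) *m u by rewrite /a sKx /= mulKVmx ?uth.
have dK := smooth_differentiable sK Cx.
have LE : L u = invmx (K (ph x)) *m 'D_a K (ph x)
    + invmx (K (ph x)) *m om (ph x) a *m K (ph x).
  apply: linmx_ext => w; apply: (can_inj (mulKmx (GU GK))).
  have sLw : th (ph x) *m s x (L u *m w) i = K (ph x) *m (L u *m w).
    by rewrite sKx /= mulKVmx ?uth.
  rewrite -sLw -(cL u w) (cartan_connectionE _ (nK w)) (mulKVmx (uth (Oph x))).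
  have E1 : 'D_a (fun z => th z *m (invmx (th z) *m (K z *m w))) (ph x)
      = 'D_a K (ph x) *m w.
    have -> : 'D_a K (ph x) *m w = 'D_a (fun z => K z *m w) (ph x).
      by rewrite derive_mulmx // derive_cst mulmx0 addr0.
    by apply: (derive_on a oC Cx) => z; rewrite inE => /CO /uth uz; rewrite mulKVmx.
  rewrite /frame_cov E1 (mulKVmx (uth (Oph x))).
  by rewrite mulmxDl mulmxDr -!mulmxA !(mulKVmx (GU GK)).
have IL : I0 u (invmx (K (ph x)) *m om (ph x) a *m K (ph x)).
  have := cartan_inner cs a (Oph x); rewrite aE (I0equivariant u GK) => -[A IA <-].
  by rewrite !mulmxA mulVmx ?GU // mul1mx -mulmxA mulVmx ?GU // mulmx1.
rewrite -(coset_mem g0 IL); exists (invmx (K (ph x)) *m 'D_a K (ph x)).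
  apply: (maurer_cartan a oC Cx sK).
  by move=> _ [z [Uz zi] <-]; exact: (Kgauge z Uz).1.
by rewrite LE addrC.
Qed.

(** Every local section contributes the same coset by [connection_form_mem], and
    the section through the given frame with constant coefficients shows that
    the union over local sections is not empty. *)
Lemma cartan_inner_torsion x p u : g 0 -> cartan_frames x p ->
  inner_torsion cartan_connection g cartan_Gstructure (p u) = Adbar p (I0 u).
Proof.
move=> g0 Px; have [_ /bij_inj pinj] := cartan_frames_iso Px.
apply/seteqP; split=> F.
  move=> [U [s [L [u' [sec Ux cL pu]]]]].
  have IL := connection_form_mem u' g0 sec Ux cL.
  rewrite (coset_mem g0 IL) => -[A IA FA].
  have [_ + _] := sec => /(_ _ Ux) /(cartan_frames_torsor _ Px)[l Gl sl].
  have uE : u = l *m u' by apply: pinj; rewrite pu sl.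
  exists (l *m A *m invmx l).
    by rewrite uE (I0equivariant u' Gl); exists A.
  move=> w; have := FA (invmx l *m w).
  by rewrite sl mulKVmx ?GU // => ->; rewrite !mulmxA.
move=> [A IA FA]; have [k Gk pE] := Px.
pose s : frame_field M := fun y w => std_frame y (k *m w).
pose L v := invmx k *m om (ph x) (invmx (th (ph x)) *m (k *m v)) *m k.
have sec : smooth_section cartan_frames setT s by exact: std_section.
have cL : connection_form cartan_connection s x L.
  move=> v w; apply: (tangent_inj (chart_total x)).
  have nk : \forall y \near ph x,
      field_coord (fun y => s y w) y = invmx (th y) *m (k *m w).
    apply: filterS (open_near global_chart_image_open (global_chart_image x)).
    by move=> y [z zi <-]; rewrite field_coordE.
  rewrite (cartan_connectionE _ nk) /s /= /L; congr (_ *m _).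
  have E1 : 'D_(invmx (th (ph x)) *m (k *m v))
      (fun z => th z *m (invmx (th z) *m (k *m w))) (ph x) = 0.
    rewrite -[RHS](derive_cst (k *m w) (ph x) (invmx (th (ph x)) *m (k *m v))).
    by apply: (derive_on _ oO (Oph x)) => z; rewrite inE => /uth uz; rewrite mulKVmx.
  rewrite /frame_cov E1 add0r mulKVmx ?uth // !mulmxA mulmxV ?GU // mul1mx.
  by [].
exists setT, s, L, u; split => //; first by rewrite pE.
rewrite (coset_mem g0 (connection_form_mem u g0 sec I cL)).
by exists A => // w; have := FA w; rewrite pE.
Qed.

Lemma cartan_characteristic_tensors :
  g 0 -> alternating_bilinear R0 -> quot_linear g I0 ->
  characteristic_tensors cartan_connection g cartan_Gstructure
    (fun _ _ => 0) R0 I0.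
Proof.
move=> g0 altR linI; split; split => //.
- by split => // u c v w; rewrite scaler0 addr0.
- move=> x p X Y u v Px sX sY _ _; rewrite cartan_torsion_free //.
  have [lp _] := cartan_frames_iso Px.
  have := lp 1 0 0; rewrite !scale1r addr0 => /eqP.
  by rewrite -subr_eq0 opprD addNKr oppr_eq0 => /eqP.
- move=> x p X Y Z u v w [k Gk ->] sX sY sZ Xu Yv Zw.
  apply: (tangent_inj (chart_total x)).
  rewrite cartan_connection_curvature // Xu Yv Zw /= !mulKVmx ?uth //.
  by rewrite (R0equivariant _ _ Gk) -!mulmxA mulKmx ?GU.
- by move=> x p u Px; exact: cartan_inner_torsion.
Qed.

End GlobalChart.

Section BallChart.
Context {R : realType} {V : normedModType R}.

Context (p0 : V) (r : R) (r0 : 0 < r).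

(** A homeomorphism from the whole space onto the ball of radius [r] around [p0]. *)
Definition ball_chart (x : V) : V := p0 + (r / (1 + `|x|)) *: x.

Definition ball_cochart (y : V) : V := (r - `|y - p0|)^-1 *: (y - p0).

Let norm1 (x : V) : 0 < 1 + `|x|. Proof. by rewrite ltr_pwDl. Qed.

Lemma ball_chart_norm x : `|ball_chart x - p0| = r - r / (1 + `|x|).
Proof.
rewrite /ball_chart addrAC subrr add0r normrZ ger0_norm; last by rewrite ltW ?divr_gt0.
have := norm1 x; move: `|x| => t t0.
by field; rewrite gt_eqF.
Qed.

Lemma ball_chartK : cancel ball_chart ball_cochart.
Proof.
move=> x; rewrite /ball_cochart ball_chart_norm opprB addrC subrK.
rewrite /ball_chart addrAC subrr add0r scalerA mulVf ?scale1r //.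
by rewrite mulf_neq0 ?invr_neq0 ?gt_eqF.
Qed.

Lemma ball_chart_image : ball_chart @` setT = ball p0 r.
Proof.
rewrite -ball_normE; apply/seteqP; split=> [_ [x _ <-]|y] /=.
  by rewrite distrC ball_chart_norm ltrBlDr ltrDl divr_gt0.
rewrite distrC => yr; exists (ball_cochart y) => //.
rewrite /ball_chart /ball_cochart normrZ ger0_norm; last first.
  by rewrite invr_ge0 subr_ge0 ltW.
rewrite scalerA -[RHS](subrK p0) addrC; congr (_ + _).
rewrite -[RHS]scale1r; congr (_ *: _).
have : r - `|y - p0| != 0 by rewrite subr_eq0 gt_eqF.
move: `|y - p0| => t t0; field.
by rewrite t0 subrK gt_eqF.
Qed.

Lemma ball_chart_continuous x : {for x, continuous ball_chart}.
Proof.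
rewrite /prop_for /continuous_at /ball_chart; apply: cvgD; first exact: cvg_cst.
apply: cvgZ; last exact: cvg_id.
apply: cvgM; first exact: cvg_cst.
apply: cvgV; first by rewrite gt_eqF.
by apply: cvgD; [exact: cvg_cst|exact: cvg_norm].
Qed.

Lemma ball_cochart_continuous y : ball p0 r y -> {for y, continuous ball_cochart}.
Proof.
rewrite -ball_normE /= distrC => yr.
have sc : (fun z => z - p0) @ y --> y - p0 by apply: cvgB; [exact: cvg_id|exact: cvg_cst].
rewrite /prop_for /continuous_at /ball_cochart; apply: cvgZ; last exact: sc.
apply: cvgV; first by rewrite subr_eq0 gt_eqF.
by apply: cvgB; [exact: cvg_cst|exact: cvg_norm].
Qed.

Lemma ball_transition :
  smooth_on (ball_chart @` (setT `&` setT)) (ball_chart \o ball_cochart).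
Proof.
rewrite setTI ball_chart_image; have ob : open (ball p0 r) by exact: ball_open.
apply: (@eq_smooth_on _ _ _ _ idfun) => //; last first.
  by apply: smooth_linear => // x; exact: cvg_id.
by move=> y; rewrite inE -ball_chart_image => -[x _ <-] /=; rewrite ball_chartK.
Qed.

Lemma ball_chart_open : open (ball_chart @` setT).
Proof. by rewrite ball_chart_image; exact: ball_open. Qed.

Lemma ball_cochart_continuous_image y : (ball_chart @` setT) y ->
  {for y, continuous ball_cochart}.
Proof. by rewrite ball_chart_image; exact: ball_cochart_continuous. Qed.

End BallChart.

Section BallManifold.
Context {R : realType} {m : nat}.
Local Notation E := ('cV[R]_m).

(** Balls with rational centre and radius [1 / (k + 1)]. *)
Lemma second_countable_cV : @second_countable E.
Proof.
pose b (qk : 'cV[rat]_m * nat) : set E :=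
  ball (map_mx (@ratr R) qk.1) (qk.2.+1%:R^-1).
exists (range b); first exact: card_le_trans (card_image_le _ _) (countableP _).
split=> [_ [qk _ <-]|x U]; first exact: ball_open.
move=> /nbhs_ballP[e /= e0 eU].
pose k := Num.trunc (2 / e).
have k0 : 0 < (k.+1%:R : R)^-1 by rewrite invr_gt0.
have ke : (k.+1%:R : R)^-1 + k.+1%:R^-1 <= e.
  rewrite -mulr2n -(mulr_natl _ 2) ler_pdivrMr // mulrC -ler_pdivrMr //.
  exact/ltW/truncnS_gt.
have qex i : exists q : rat, `|x i 0 - ratr q| < k.+1%:R^-1.
  have lt : x i 0 - k.+1%:R^-1 < x i 0 + k.+1%:R^-1.
    by rewrite ltrD2l; apply: lt_trans k0; rewrite oppr_lt0.
  have [q] := rat_in_itvoo lt; rewrite in_itv /= => /andP[q1 q2].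
  by exists q; rewrite distrC ltr_distl q1 q2.
pose q : 'cV[rat]_m := \col_i sval (cid (qex i)).
have qx : ball (map_mx (@ratr R) q) (k.+1%:R^-1) x.
  by split => // i j; rewrite !mxE ord1 /ball /= distrC; case: cid.
exists (b (q, k)); first by split => //; exists (q, k).
move=> y qy; apply: eU; apply: le_ball ke _ _.
exact: ball_triangle (ball_sym qx) qy.
Qed.

Context (p0 : E) (r : R) (r0 : 0 < r).

(** The open ball as a manifold with one chart; its points are named by
    their images in the whole space under the inverse of the chart. *)
Definition ball_manifold : manifold R m :=
  @Manifold R m E (inhabits 0) (@norm_hausdorff _ _) second_countable_cV
    unit (fun=> setT) (fun=> ball_chart p0 r) (fun=> ball_cochart p0 r)
    (fun=> ex_intro _ tt I) (fun=> openT) (fun=> ball_chart_open p0 r0)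
    (fun _ x _ => ball_chartK p0 r0 x) (fun _ x _ => ball_chart_continuous (p0 := p0) (r := r) (x := x))
    (fun _ y => @ball_cochart_continuous_image _ _ p0 r r0 y) (fun _ _ => ball_transition p0 r0).

End BallManifold.

(** The coframe and the connection form define a connection on a ball inside
    their domain, the coframe being dual to a global section of the structure.
    Equivariance carries the constants from this section to all frames of the
    structure. *)
Lemma manifold_of_cartan (R : realType) (m : nat) (G g : set 'M[R]_m)
    (O : set 'cV[R]_m) R0 I0 th om p0 :
  G 1%:M -> (forall k l, G k -> G l -> G (k *m l)) ->
  (forall k, G k -> G (invmx k)) -> (forall k, G k -> k \in unitmx) ->
  g 0 -> (forall A B, g A -> g B -> g (A + B)) ->
  (forall A B, g A -> g B -> g (A - B)) ->
  (forall (U : set 'cV[R]_m) (k : 'cV[R]_m -> 'M[R]_m) y a, open U ->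
    U y -> smooth_on U k -> (forall z, U z -> G (k z)) ->
    g (invmx (k y) *m 'D_a k y)) ->
  (forall u, exists A, I0 u = coset g A) -> quot_equivariant G I0 ->
  equivariant2 G R0 -> alternating_bilinear R0 -> quot_linear g I0 ->
  O p0 -> cartan_structure O R0 I0 th om ->
  exists (M : manifold R m) (D : connection M) (P : Gstructure M G),
    torsion_free D /\ exists T0, characteristic_tensors D g P T0 R0 I0.
Proof.
move=> G1 GM GV GU g0 gD gB mc I0c I0e R0e R0a I0l Op cs.
have /nbhs_ballP[r /= r0 rO] := open_near (cartan_open cs) Op.
pose M := ball_manifold p0 r0.
have oc (j : idx M) : j = tt by case: j.
have ct (x : M) : dom (tt : idx M) x by [].
have imO : chart (tt : idx M) @` dom (tt : idx M) `<=` O.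
  by move=> y Cy; apply: rO; rewrite -(ball_chart_image p0 r0); exact: Cy.
exists M, (cartan_connection oc ct cs imO).
exists (cartan_Gstructure oc ct cs imO G1 GM GV GU).
split; first exact: cartan_torsion_free.
exists (fun _ _ => 0); exact: cartan_characteristic_tensors.
Qed.

(** * The Hermitian form and the unitary group *)

Section HermitianForms.
Context {R : realType} {n : nat}.
Local Notation H := ('cV[R]_(n + n)).
Local Notation J := (@J0 R n).

Lemma J0_sqr : J *m J = - 1%:M.
Proof.
rewrite /J0 mulmx_block !mul0mx !mulmx0 !mul1mx !add0r !addr0 mulmx1.
by rewrite (scalar_mx_block n n (1 : R)) opp_block_mx oppr0.
Qed.

Lemma J0_tr : J^T = - J.
Proof.
by rewrite /J0 tr_block_mx !trmx0 linearN /= trmx1 opp_block_mx !oppr0 opprK.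
Qed.

Lemma J0K (X : H) : J *m (J *m X) = - X.
Proof. by rewrite mulmxA J0_sqr mulNmx mul1mx. Qed.

Lemma h0C (X Y : H) : h0 X Y = h0 Y X.
Proof.
rewrite /h0 -[RHS]/((Y^T *m X) 0 0) -[Y^T *m X]trmxK trmx_mul trmxK.
by rewrite [in RHS]mxE.
Qed.

Lemma h0Dl (X Y Z : H) : h0 (X + Y) Z = h0 X Z + h0 Y Z.
Proof. by rewrite /h0 linearD /= mulmxDl mxE. Qed.

Lemma h0Zl c (X Z : H) : h0 (c *: X) Z = c * h0 X Z.
Proof. by rewrite /h0 linearZ /= -scalemxAl mxE. Qed.

Lemma h0Nl (X Z : H) : h0 (- X) Z = - h0 X Z.
Proof. by rewrite -scaleN1r h0Zl mulN1r. Qed.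

Lemma h0Dr (X Y Z : H) : h0 Z (X + Y) = h0 Z X + h0 Z Y.
Proof. by rewrite h0C h0Dl !(h0C Z). Qed.

Lemma h0Zr c (X Z : H) : h0 Z (c *: X) = c * h0 Z X.
Proof. by rewrite h0C h0Zl (h0C Z). Qed.

Lemma h0Nr (X Z : H) : h0 Z (- X) = - h0 Z X.
Proof. by rewrite h0C h0Nl (h0C Z). Qed.

Lemma h00l (X : H) : h0 0 X = 0.
Proof. by rewrite -(scale0r 0) h0Zl mul0r. Qed.

Lemma h0_adj (A : 'M[R]_(n + n)) (X Y : H) : h0 (A *m X) Y = h0 X (A^T *m Y).
Proof. by rewrite /h0 trmx_mul mulmxA. Qed.

Lemma h0J (X Y : H) : h0 (J *m X) (J *m Y) = h0 X Y.
Proof. by rewrite h0_adj J0_tr mulNmx J0K opprK. Qed.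

Lemma h0_Jr (X Y : H) : h0 X (J *m Y) = - h0 (J *m X) Y.
Proof. by rewrite (h0_adj _ X Y) J0_tr mulNmx h0Nr opprK. Qed.

Lemma h0_JC (X Y : H) : h0 (J *m Y) X = - h0 (J *m X) Y.
Proof. by rewrite h0C h0_Jr. Qed.

Lemma h0_Jxx (X : H) : h0 (J *m X) X = 0.
Proof.
apply/eqP; have /eqP := h0_JC X X; rewrite -subr_eq0 opprK -mulr2n mulrn_eq0.
by rewrite orFb.
Qed.

Lemma h0_ge0 (X : H) : 0 <= h0 X X.
Proof.
by rewrite /h0 mxE; apply: sumr_ge0 => k _; rewrite mxE -expr2 sqr_ge0.
Qed.

Lemma h0_eq0 (X : H) : h0 X X = 0 -> X = 0.
Proof.
rewrite /h0 mxE => X0; apply/matrixP => k j; rewrite ord1 mxE.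
apply/eqP; rewrite -sqrf_eq0.
have ge0 l : true -> 0 <= X^T 0 l * X l 0 by rewrite mxE -expr2 sqr_ge0.
by have := psumr_eq0P ge0 X0 isT (i := k); rewrite mxE -expr2 => ->.
Qed.

Lemma unit_vector : (0 < n)%N -> exists X : H, h0 X X = 1.
Proof.
move=> n0; have i : 'I_(n + n) by exists 0%N; rewrite addn_gt0 n0.
exists (delta_mx i 0); rewrite /h0 mxE (bigD1 i) //= !mxE !eqxx mulr1.
by rewrite big1 ?addr0 // => k ki; rewrite !mxE (negbTE ki) mul0r.
Qed.

Lemma outer_mul (P Q Z : H) : (P *m Q^T) *m Z = h0 Q Z *: P.
Proof.
rewrite -mulmxA [Q^T *m Z]mx11_scalar.
by apply/matrixP => i j; rewrite mul_mx_scalar mxE.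
Qed.

(** A vector and its complex multiple are linearly independent; this is how the
    scalar coefficients of the normal forms are compared. *)
Lemma complex_coefs (p q p' q' : R) (X : H) : h0 X X = 1 ->
  p *: X + q *: (J *m X) = p' *: X + q' *: (J *m X) -> p = p' /\ q = q'.
Proof.
move=> X1 E1; split.
  have := congr1 (h0^~ X) E1.
  by rewrite /= !h0Dl !h0Zl h0_Jxx X1 !mulr0 !addr0 !mulr1.
have := congr1 (h0^~ (J *m X)) E1.
by rewrite /= !h0Dl !h0Zl !h0J h0_Jr h0_Jxx X1 oppr0 !mulr0 !add0r !mulr1.
Qed.

End HermitianForms.

Section UnitaryGroup.
Context {R : realType} {n : nat}.
Local Notation H := ('cV[R]_(n + n)).
Local Notation V := ('cV[R]_(n + n + 1)).
Local Notation gl := ('M[R]_(n + n + 1)).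

Definition Jhat : gl := block_mx J0 0 0 0.

Lemma Jhat_tr : Jhat^T = - Jhat.
Proof.
by rewrite /Jhat tr_block_mx J0_tr !trmx0 [RHS]opp_block_mx !oppr0.
Qed.

Lemma vecE (v : V) : v = vec (usubmx v) (dsubmx v 0 0).
Proof. by rewrite /vec -mx11_scalar vsubmxK. Qed.

Lemma vec_linear c (X Y : H) (s t : R) :
  vec (c *: X + Y) (c * s + t) = c *: vec X s + vec Y t.
Proof.
rewrite /vec scale_col_mx add_col_mx; congr col_mx.
by rewrite scale_scalar_mx -raddfD.
Qed.

Lemma block_vec (A : 'M[R]_(n + n)) (x y : H) (d : R) (X : H) (s : R) :
  block_mx A x (flat y) d%:M *m vec X s = vec (A *m X + s *: x) (h0 y X + d * s).
Proof.
rewrite /vec mul_block_col; congr col_mx.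
  by rewrite mul_mx_scalar.
rewrite -scalar_mxM /h0 /flat [X in X + _]mx11_scalar.
by rewrite -raddfD.
Qed.

(** Membership in the Lie algebra, and below in the group, by linear or quadratic
    equations on the whole matrix: such equations can be differentiated. *)
Lemma un0P (C : gl) : un0 C <->
  [/\ C^T = - C, C *m Jhat = Jhat *m C & C *m e0 = 0].
Proof.
split=> [[A [Aa AJ] <-]|[Ca CJ Ce]].
  split.
  - by rewrite tr_block_mx Aa !trmx0 opp_block_mx !oppr0.
  - by rewrite /Jhat !mulmx_block !mul0mx !mulmx0 !addr0 AJ.
  - by rewrite /e0 /vec mul_block_col !mul0mx !mulmx0 !addr0 col_mx0.
have := Ce; rewrite -{1}[C]submxK /e0 /vec mul_block_col !mulmx0 !add0r.
rewrite !mulmx1 -col_mx0 => /eq_col_mx[Cur Cdr].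
have := Ca; rewrite -{1 2}[C]submxK tr_block_mx opp_block_mx Cur Cdr.
move=> /eq_block_mx[Cul Cdl _ _].
have Cdl0 : dlsubmx C = 0 by apply: trmx_inj; rewrite Cdl oppr0 trmx0.
exists (ulsubmx C); last by rewrite -[RHS]submxK Cur Cdr Cdl0.
split=> //; move: CJ; rewrite -{1 2}[C]submxK /Jhat !mulmx_block Cur Cdr Cdl0.
by rewrite !mul0mx !mulmx0 !addr0 => /eq_block_mx[].
Qed.

Lemma Un1P (k : gl) : Un1 k <->
  [/\ k^T *m k = 1%:M, k *m Jhat = Jhat *m k & k *m e0 = e0].
Proof.
split=> [[A [Aa AJ] <-]|[Ca CJ Ce]].
  split.
  - rewrite tr_block_mx !trmx0 trmx1 mulmx_block !mul0mx !mulmx0 !addr0 add0r mulmx1.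
    by rewrite Aa -scalar_mx_block.
  - by rewrite /Jhat !mulmx_block !mul0mx !mulmx0 !addr0 AJ.
  - by rewrite /e0 /vec mul_block_col !mul0mx !mulmx0 !addr0 add0r mul1mx.
have := Ce; rewrite -{1}[k]submxK /e0 /vec mul_block_col !mulmx0 !add0r.
rewrite !mulmx1 => /eq_col_mx[Cur Cdr].
have := Ca; rewrite -{1 2}[k]submxK tr_block_mx Cur Cdr trmx0 trmx1.
rewrite mulmx_block !mulmx0 !mul0mx !mul1mx !mulmx1 !add0r (scalar_mx_block (n + n) 1 (1 : R)).
move=> /eq_block_mx[Cul Cdl Cdl0 _].
rewrite Cdl0 trmx0 mul0mx addr0 in Cul.
exists (ulsubmx k); last by rewrite -[RHS]submxK Cur Cdr Cdl0.
split=> //; move: CJ; rewrite -{1 2}[k]submxK /Jhat !mulmx_block Cur Cdr Cdl0.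
by rewrite !mul0mx !mulmx0 !addr0 => /eq_block_mx[].
Qed.

Lemma Un1_1 : Un1 (1%:M : gl).
Proof. by apply/Un1P; rewrite trmx1 !mul1mx mulmx1. Qed.

Lemma Un1_unit (k : gl) : Un1 k -> k \in unitmx.
Proof. by move=> /Un1P[/mulmx1_unit[]]. Qed.

Lemma Un1_inv (k : gl) : Un1 k -> invmx k = k^T.
Proof.
move=> Uk; have [k1 _ _] := (Un1P k).1 Uk.
by rewrite -[RHS]mulmx1 -(mulmxV (Un1_unit Uk)) mulmxA k1 mul1mx.
Qed.

Lemma Un1M (k l : gl) : Un1 k -> Un1 l -> Un1 (k *m l).
Proof.
move=> /Un1P[k1 kJ ke] /Un1P[l1 lJ le]; apply/Un1P; split.
- by rewrite trmx_mul mulmxA -(mulmxA l^T) k1 mulmx1 l1.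
- by rewrite -mulmxA lJ mulmxA kJ mulmxA.
- by rewrite -mulmxA le ke.
Qed.

Lemma Un1V (k : gl) : Un1 k -> Un1 (invmx k).
Proof.
move=> Uk; have [k1 kJ ke] := (Un1P k).1 Uk; apply/Un1P; split.
- by rewrite (Un1_inv Uk) trmxK -(Un1_inv Uk) mulmxV ?Un1_unit.
- apply: (can_inj (mulKmx (Un1_unit Uk))).
  by rewrite mulmxA mulmxV ?Un1_unit // mul1mx mulmxA kJ -mulmxA mulmxV ?Un1_unit // mulmx1.
- by rewrite -{1}ke mulKmx ?Un1_unit.
Qed.

Lemma un0_0 : un0 (0 : gl).
Proof. by apply/un0P; rewrite trmx0 oppr0 !mul0mx mulmx0. Qed.

Lemma un0B (A B : gl) : un0 A -> un0 B -> un0 (A - B).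
Proof.
move=> /un0P[At AJ Ae] /un0P[Bt BJ Be]; apply/un0P; split.
- by rewrite linearB /= At Bt opprB opprK addrC.
- by rewrite mulmxBl mulmxBr AJ BJ.
- by rewrite mulmxBl Ae Be subrr.
Qed.

Lemma un0D (A B : gl) : un0 A -> un0 B -> un0 (A + B).
Proof.
move=> uA uB; rewrite -[B]opprK; apply: un0B => //.
by rewrite -[- B]sub0r; apply: un0B => //; exact: un0_0.
Qed.

Lemma un0_comm (A B : gl) : un0 A -> un0 B -> un0 (A *m B - B *m A).
Proof.
move=> /un0P[At AJ Ae] /un0P[Bt BJ Be]; apply/un0P; split.
- by rewrite linearB /= !trmx_mul At Bt !mulNmx !mulmxN !opprK opprB.
- by rewrite mulmxBl mulmxBr -!mulmxA BJ AJ !mulmxA BJ AJ.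
- by rewrite mulmxBl -!mulmxA Ae Be !mulmx0 subrr.
Qed.

End UnitaryGroup.

Section UnitaryCurves.
Context {R : realType} {W : normedModType R} {n : nat}.
Local Notation gl := ('M[R]_(n + n + 1)).

Lemma derive_trmx p q (A : W -> 'M[R]_(p, q)) x v : differentiable A x ->
  'D_v (fun y => (A y)^T) x = ('D_v A x)^T.
Proof.
move=> dA; have dT := differentiable_trmx dA.
apply/matrixP => i j; rewrite -derive_entry // mxE -derive_entry //.
by under eq_fun do rewrite mxE.
Qed.

Lemma derive_mulmxl p q r (A : W -> 'M[R]_(p, q)) (B : 'M[R]_(q, r)) x v :
  differentiable A x -> 'D_v (fun y => A y *m B) x = 'D_v A x *m B.
Proof. by move=> dA; rewrite derive_mulmx // derive_cst mulmx0 addr0. Qed.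

Lemma derive_mulmxr p q r (A : 'M[R]_(p, q)) (B : W -> 'M[R]_(q, r)) x v :
  differentiable B x -> 'D_v (fun y => A *m B y) x = A *m 'D_v B x.
Proof. by move=> dB; rewrite derive_mulmx // derive_cst mul0mx add0r. Qed.

Lemma derive_un0 (U : set W) (C : W -> gl) y a : open U -> U y ->
  differentiable C y -> (forall z, U z -> un0 (C z)) -> un0 ('D_a C y).
Proof.
move=> oU Uy dC uC; apply/un0P; split.
- rewrite -derive_trmx // -deriveN; last exact: diff_derivable.
  by apply: (derive_on _ oU Uy) => z; rewrite inE => /uC/un0P[].
- rewrite -derive_mulmxl // -derive_mulmxr //.
  by apply: (derive_on _ oU Uy) => z; rewrite inE => /uC/un0P[].
- rewrite -derive_mulmxl // -[RHS](derive_cst 0 y a).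
  by apply: (derive_on _ oU Uy) => z; rewrite inE => /uC/un0P[].
Qed.

(** Differentiate the equations of [Un1P] along the curve. *)
Lemma maurer_cartan_Un1 (U : set W) (k : W -> gl) y a : open U -> U y ->
  smooth_on U k -> (forall z, U z -> Un1 (k z)) -> un0 (invmx (k y) *m 'D_a k y).
Proof.
move=> oU Uy sk uk; have dk := smooth_differentiable sk Uy.
have dkT := differentiable_trmx dk.
rewrite (Un1_inv (uk _ Uy)); have [k1 kJ ke] := (Un1P (k y)).1 (uk y Uy).
have kTJ : (k y)^T *m Jhat = Jhat *m (k y)^T.
  apply: trmx_inj; rewrite !trmx_mul trmxK Jhat_tr mulNmx mulmxN; congr (- _).
  by rewrite kJ.
apply/un0P; split.
- rewrite trmx_mul trmxK; apply/eqP; rewrite -subr_eq0 opprK; apply/eqP.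
  rewrite -derive_trmx // -derive_mulmx // -[RHS](derive_cst (1%:M : gl) y a).
  by apply: (derive_on _ oU Uy) => z; rewrite inE => /uk/Un1P[].
- have DJ : 'D_a k y *m Jhat = Jhat *m 'D_a k y.
    rewrite -derive_mulmxl // -derive_mulmxr //.
    by apply: (derive_on _ oU Uy) => z; rewrite inE => /uk/Un1P[].
  by rewrite -mulmxA DJ !mulmxA kTJ.
- have De : 'D_a k y *m e0 = 0.
    rewrite -derive_mulmxl // -[RHS](derive_cst e0 y a).
    by apply: (derive_on _ oU Uy) => z; rewrite inE => /uk/Un1P[].
  by rewrite -mulmxA De mulmx0.
Qed.

End UnitaryCurves.

(** * Curvature tensors of Kaehler type *)

Section AlternatingBilinear.
Context {R : realType} {V W : lmodType R} (F : V -> V -> W).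
Hypothesis altF : alternating_bilinear F.

Lemma altDl u v w : F (u + v) w = F u w + F v w.
Proof. by have [_ Fl _] := altF; have := Fl w 1 u v; rewrite !scale1r. Qed.

Lemma altDr u v w : F w (u + v) = F w u + F w v.
Proof. by have [Fr _ _] := altF; have := Fr w 1 u v; rewrite !scale1r. Qed.

Lemma alt0l w : F 0 w = 0.
Proof. by apply: (addrI (F 0 w)); rewrite -altDl !addr0. Qed.

Lemma alt0r w : F w 0 = 0.
Proof. by apply: (addrI (F w 0)); rewrite -altDr !addr0. Qed.

Lemma altZl c u w : F (c *: u) w = c *: F u w.
Proof. by have [_ Fl _] := altF; have := Fl w c u 0; rewrite !addr0 alt0l addr0. Qed.

Lemma altZr c u w : F w (c *: u) = c *: F w u.
Proof. by have [Fr _ _] := altF; have := Fr w c u 0; rewrite !addr0 alt0r addr0. Qed.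

Lemma altNl u w : F (- u) w = - F u w.
Proof. by rewrite -scaleN1r altZl scaleN1r. Qed.

Lemma altC u v : F v u = - F u v.
Proof.
have [_ _ Fa] := altF; apply/eqP; rewrite -addr_eq0 addrC.
by have := Fa (u + v); rewrite altDl !altDr !Fa addr0 add0r => ->.
Qed.

End AlternatingBilinear.

Section KahlerCurvature.
Context {R : realType} {n : nat}.
Local Notation H := ('cV[R]_(n + n)).
Local Notation J := (@J0 R n).

(** The algebraic symmetries of the curvature of a Kaehler metric, for the tensor
    [h0 (F X Y *m Z) W]. *)
Record kahler_tensor (T : H -> H -> H -> H -> R) : Prop := KahlerTensor {
  kahlerD1 : forall X X' Y Z W, T (X + X') Y Z W = T X Y Z W + T X' Y Z W;
  kahlerN1 : forall X Y Z W, T (- X) Y Z W = - T X Y Z W;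
  kahlerD3 : forall X Y Z Z' W, T X Y (Z + Z') W = T X Y Z W + T X Y Z' W;
  kahlerN3 : forall X Y Z W, T X Y (- Z) W = - T X Y Z W;
  kahlerC12 : forall X Y Z W, T Y X Z W = - T X Y Z W;
  kahlerC34 : forall X Y Z W, T X Y W Z = - T X Y Z W;
  kahlerJ34 : forall X Y Z W, T X Y (J *m Z) (J *m W) = T X Y Z W;
  kahler_bianchi : forall X Y Z W, T X Y Z W + T Y Z X W + T Z X Y W = 0 }.

Section Symmetries.
Variables (T : H -> H -> H -> H -> R) (kT : kahler_tensor T).

Let D1 := kahlerD1 kT. Let N1 := kahlerN1 kT. Let D3 := kahlerD3 kT.
Let N3 := kahlerN3 kT. Let C12 := kahlerC12 kT. Let C34 := kahlerC34 kT.

Let D2 X Y Y' Z W : T X (Y + Y') Z W = T X Y Z W + T X Y' Z W.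
Proof. by rewrite C12 D1 !(C12 X) opprD !opprK. Qed.

Let N2 X Y Z W : T X (- Y) Z W = - T X Y Z W.
Proof. by rewrite C12 N1 (C12 X) opprK. Qed.

Let D4 X Y Z W W' : T X Y Z (W + W') = T X Y Z W + T X Y Z W'.
Proof. by rewrite C34 D3 !(C34 X Y Z) opprD !opprK. Qed.

Let N4 X Y Z W : T X Y Z (- W) = - T X Y Z W.
Proof. by rewrite C34 N3 (C34 X Y Z) opprK. Qed.

Lemma kahler_pair X Y Z W : T X Y Z W = T Z W X Y.
Proof.
have b := kahler_bianchi kT.
move: (b X Y Z W) (b Y Z W X) (b Z W X Y) (b W X Y Z).
rewrite (C12 X Z Y W) (C34 Y Z X W) (C34 Z W X Y) (C12 Y W Z X) (C34 Y W X Z).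
rewrite (C12 X W Z Y) (C34 X W Y Z) (C34 X Z Y W) (C12 X W Y Z) (C34 X Y Z W).
lra.
Qed.

Let J12 X Y Z W : T (J *m X) (J *m Y) Z W = T X Y Z W.
Proof. by rewrite kahler_pair (kahlerJ34 kT) kahler_pair. Qed.

(** Polarising the quartic form of holomorphic sectional curvatures and using the
    Bianchi identity, the sectional curvature of the plane of [X], [Y] is [-3]
    times that of the plane of [X], [J *m Y]. Doing this twice multiplies it by 9,
    so it vanishes; a second polarisation kills the whole tensor. *)
Lemma kahler_zero : (forall X, T X (J *m X) (J *m X) X = 0) ->
  forall X Y Z W, T X Y Z W = 0.
Proof.
move=> T0.
have six X Y : T X (J *m X) (J *m Y) Y + 2 * T X (J *m Y) (J *m Y) X = 0.
  have q1 := T0 (X + Y); have q2 := T0 (X - Y).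
  have qx := T0 X; have qy := T0 Y.
  rewrite !mulmxDr !mulmxN !(D1, D2, D3, D4, N1, N2, N3, N4) in q1 q2.
  have t1 : T Y (J *m Y) (J *m X) X = T X (J *m X) (J *m Y) Y.
    by rewrite kahler_pair C12 C34 opprK.
  have t2 : T Y (J *m X) (J *m Y) X = T X (J *m Y) (J *m Y) X.
    by rewrite -(J12 Y) J0K N2 C12 opprK.
  have t3 : T X (J *m Y) (J *m X) Y = T X (J *m Y) (J *m Y) X.
    by rewrite -(kahlerJ34 kT X _ (J *m X)) J0K N3 C34 opprK.
  have t4 : T Y (J *m X) (J *m X) Y = T X (J *m Y) (J *m Y) X.
    by rewrite -(J12 Y) J0K N2 C12 opprK t3.
  lra.
have three X Y : T X Y Y X = - (3 * T X (J *m Y) (J *m Y) X).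
  have b := kahler_bianchi kT X (J *m X) (J *m Y) Y.
  have t1 : T (J *m X) (J *m Y) X Y = - T X Y Y X by rewrite J12 C34.
  have t2 : T (J *m Y) X (J *m X) Y = - T X (J *m Y) (J *m Y) X.
    by rewrite C12 -(kahlerJ34 kT X _ (J *m X)) J0K N3 C34 opprK.
  have := six X Y; lra.
have sect X Y : T X Y Y X = 0.
  have e1 := three X Y; have e2 := three X (J *m Y).
  rewrite J0K N2 N3 opprK in e2; lra.
have sect1 X Y W : T X Y Y W = 0.
  have := sect (X + W) Y; rewrite !(D1, D4) !sect.
  have -> : T W Y Y X = T X Y Y W by rewrite kahler_pair C12 C34 opprK.
  lra.
move=> X Y Z W.
have anti A B C F : T A C B F = - T A B C F.
  by have := sect1 A (B + C) F; rewrite !(D2, D3) !sect1; lra.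
have := kahler_bianchi kT X Y Z W.
have -> : T Y Z X W = T X Y Z W by rewrite anti C12 opprK.
have -> : T Z X Y W = T X Y Z W by rewrite C12 anti opprK.
lra.
Qed.

End Symmetries.

Lemma kahler_lin (T S : H -> H -> H -> H -> R) (c : R) :
  kahler_tensor T -> kahler_tensor S ->
  kahler_tensor (fun X Y Z W => T X Y Z W - c * S X Y Z W).
Proof.
move=> [a1 a2 a3 a4 a5 a6 a7 a8] [b1 b2 b3 b4 b5 b6 b7 b8]; split.
- by move=> X X' Y Z W; rewrite a1 b1; ring.
- by move=> X Y Z W; rewrite a2 b2; ring.
- by move=> X Y Z Z' W; rewrite a3 b3; ring.
- by move=> X Y Z W; rewrite a4 b4; ring.
- by move=> X Y Z W; rewrite a5 b5; ring.
- by move=> X Y Z W; rewrite a6 b6; ring.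
- by move=> X Y Z W; rewrite a7 b7.
- move=> X Y Z W; have := a8 X Y Z W; have := b8 X Y Z W.
  move: (S _ _ _ _) (S _ _ _ _) (S _ _ _ _) => s1 s2 s3 E1 E2.
  have -> : 0 = 0 - c * 0 :> R by ring.
  by rewrite -{1}E2 -E1; ring.
Qed.

Lemma Kop_h0 (X Y Z W : H) : h0 (Kop X Y Z) W = 4^-1 *
  (h0 Y Z * h0 X W - h0 X Z * h0 Y W
   + omega0 Y Z * omega0 X W - omega0 X Z * omega0 Y W
   - 2 * omega0 X Y * omega0 Z W).
Proof. by rewrite /Kop h0Zl !(h0Dl, h0Nl, h0Zl) /omega0. Qed.

(** The curvature endomorphism [Kop X Y], of constant holomorphic sectional
    curvature 1, as a matrix. *)
Definition kahler_op (X Y : H) : 'M[R]_(n + n) :=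
  4^-1 *: (X *m Y^T - Y *m X^T + J *m X *m (J *m Y)^T - J *m Y *m (J *m X)^T
           - (2 * omega0 X Y) *: J).

Lemma kahler_op_mul (X Y Z : H) : kahler_op X Y *m Z = Kop X Y Z.
Proof.
rewrite /kahler_op /Kop -scalemxAl.
rewrite !(mulmxBl, mulmxDl) !mulNmx !outer_mul.
by rewrite -!scalemxAl.
Qed.

Lemma omega0C (X Y : H) : omega0 Y X = - omega0 X Y.
Proof. exact: h0_JC. Qed.

Lemma omega0Dl (X Y Z : H) : omega0 (X + Y) Z = omega0 X Z + omega0 Y Z.
Proof. by rewrite /omega0 mulmxDr h0Dl. Qed.

Lemma omega0Nl (X Z : H) : omega0 (- X) Z = - omega0 X Z.
Proof. by rewrite /omega0 mulmxN h0Nl. Qed.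

Lemma kahler_Kop : kahler_tensor (fun X Y Z W => h0 (Kop X Y Z) W).
Proof.
split.
- by move=> X X' Y Z W; rewrite !Kop_h0 !(h0Dl, omega0Dl); ring.
- by move=> X Y Z W; rewrite !Kop_h0 !(h0Nl, omega0Nl); ring.
- by move=> X Y Z Z' W; rewrite !Kop_h0 /omega0 !(h0Dr, mulmxDr, h0Dl); ring.
- by move=> X Y Z W; rewrite !Kop_h0 /omega0 !(h0Nr, mulmxN, h0Nl); ring.
- by move=> X Y Z W; rewrite !Kop_h0 (omega0C X Y); ring.
- move=> X Y Z W; rewrite !Kop_h0 (omega0C Z W); ring.
- move=> X Y Z W; rewrite !Kop_h0 /omega0 !h0J !h0_Jr; ring.
- move=> X Y Z W; rewrite !Kop_h0 (omega0C X Y) (omega0C X Z) (omega0C Y Z).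
  by rewrite (h0C Y X) (h0C Z X) (h0C Z Y); ring.
Qed.

Lemma kahler_of_curvature (F : H -> H -> 'M[R]_(n + n)) :
  alternating_bilinear F -> (forall X Y, un (F X Y)) ->
  (forall X Y Z, F X Y *m Z + F Y Z *m X + F Z X *m Y = 0) ->
  kahler_tensor (fun X Y Z W => h0 (F X Y *m Z) W).
Proof.
move=> Fl Fu Fb; split.
- by move=> X X' Y Z W; rewrite (altDl Fl) mulmxDl h0Dl.
- by move=> X Y Z W; rewrite (altNl Fl) mulNmx h0Nl.
- by move=> X Y Z Z' W; rewrite mulmxDr h0Dl.
- by move=> X Y Z W; rewrite mulmxN h0Nl.
- by move=> X Y Z W; rewrite (altC Fl) mulNmx h0Nl.
- by move=> X Y Z W; have [Ft _] := Fu X Y; rewrite h0_adj Ft mulNmx h0Nr h0C.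
- by move=> X Y Z W; have [_ FJ] := Fu X Y; rewrite mulmxA FJ -mulmxA h0J.
- by move=> X Y Z W; rewrite -!h0Dl Fb h00l.
Qed.

(** The complex reflection-type map [1 - c v v^*] with [v = X - X0] and
    [c = (v^* X)^-1] sends [X] to [X0]; it is unitary because [X] and [X0] have
    the same length. *)
Lemma unitary_transitive (X X0 : H) : h0 X X = 1 -> h0 X0 X0 = 1 ->
  exists2 A, Un A & A *m X = X0.
Proof.
move=> X1 X01; have [->|neq] := eqVneq X X0.
  by exists 1%:M; rewrite ?mul1mx //; split; rewrite ?trmx1 ?mul1mx ?mulmx1.
pose v := X - X0; pose p := h0 v X; pose q := h0 (J *m v) X.
have vv : h0 v v = 2 * p.
  by rewrite /p /v !(h0Dl, h0Dr, h0Nl, h0Nr) X1 X01 (h0C X0 X); ring.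
have p0 : 0 < p.
  have : h0 v v != 0.
    by apply: contra_neq neq => /h0_eq0 /eqP; rewrite subr_eq0 => /eqP.
  rewrite vv => n0; rewrite lt_def; apply/andP; split.
    by apply: contra_neq n0 => ->; rewrite mulr0.
  by have := h0_ge0 v; rewrite vv pmulr_rge0.
have d0 : p ^+ 2 + q ^+ 2 != 0.
  by rewrite gt_eqF // ltr_pwDl ?sqr_ge0 // exprn_gt0.
pose c1 := p / (p ^+ 2 + q ^+ 2); pose c2 := - q / (p ^+ 2 + q ^+ 2).
have XvE : X - v = X0 by rewrite /v opprB addrC subrK.
clearbody v; pose Jv := J *m v.
pose r1 := c1 *: v - c2 *: Jv; pose r2 := c1 *: Jv + c2 *: v.
pose A : 'M[R]_(n + n) := 1%:M - (v *m r1^T + Jv *m r2^T).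
have AE Z : A *m Z = Z - (h0 r1 Z *: v + h0 r2 Z *: Jv).
  by rewrite mulmxBl mul1mx mulmxDl !outer_mul.
have AtE Z : A^T *m Z = Z - (h0 v Z *: r1 + h0 Jv Z *: r2).
  rewrite linearB /= linearD /= (trmx_mul v) (trmx_mul Jv) !trmxK trmx1 mulmxBl mul1mx mulmxDl.
  by rewrite !outer_mul.
have r1E Z : h0 r1 Z = c1 * h0 v Z - c2 * h0 Jv Z by rewrite h0Dl h0Nl !h0Zl.
have r2E Z : h0 r2 Z = c1 * h0 Jv Z + c2 * h0 v Z by rewrite h0Dl !h0Zl.
have JvJv : h0 Jv Jv = 2 * p by rewrite h0J.
have Jvv : h0 Jv v = 0 by exact: h0_Jxx.
exists A; last first.
  rewrite AE r1E r2E -/p -/q.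
  have -> : c1 * p - c2 * q = 1 by rewrite /c1 /c2; field.
  have -> : c1 * q + c2 * p = 0 by rewrite /c1 /c2; field.
  by rewrite scale1r scale0r addr0.
split; apply: linmx_ext => Z.
  rewrite mul1mx -mulmxA AE AtE !(h0Dr, h0Nr, h0Zr) (h0C v Jv) vv JvJv Jvv r1E r2E.
  rewrite /r1 /r2; move: (h0 v Z) (h0 Jv Z) => s t.
  apply/matrixP => i j; rewrite !mxE /c1 /c2.
  by move: (Z i j) (v i j) (Jv i j) => z1 v1 w1; field.
rewrite -!mulmxA !AE mulmxBr mulmxDr -!scalemxAr J0K !r1E !r2E.
rewrite (h0_Jr v) -/Jv {2}/Jv h0_Jr /Jv J0K h0Nl.
by apply/matrixP => i j; rewrite !mxE; ring.
Qed.

(** A Kaehler curvature invariant under all unitary maps has the same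
    holomorphic sectional curvature in every plane, and is determined by it. *)
Lemma invariant_kahler_curvature (F : H -> H -> 'M[R]_(n + n)) : (0 < n)%N ->
  alternating_bilinear F -> (forall X Y, un (F X Y)) ->
  (forall X Y Z, F X Y *m Z + F Y Z *m X + F Z X *m Y = 0) ->
  (forall (A : 'M[R]_(n + n)) (X Y Z : H), Un A -> F (A *m X) (A *m Y) *m (A *m Z) = A *m (F X Y *m Z)) ->
  exists kappa, forall X Y Z, F X Y *m Z = kappa *: Kop X Y Z.
Proof.
move=> n0 Fl Fu Fb Finv; have [X0 X01] := @unit_vector R n n0.
have kF := kahler_of_curvature Fl Fu Fb.
pose hol X := h0 (F X (J *m X) *m (J *m X)) X.
exists (hol X0) => X Y Z.
have hol_unit U : h0 U U = 1 -> hol U = hol X0.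
  move=> U1; have [A uA <-] := unitary_transitive X01 U1; have [At AJ] := uA.
  rewrite /hol !(mulmxA J) -AJ -(mulmxA A) Finv //.
  by rewrite h0_adj (mulmxA A^T) At mul1mx.
have holZ c U : hol (c *: U) = c ^+ 4 * hol U.
  rewrite /hol -!scalemxAr (altZl Fl) (altZr Fl) -!scalemxAl !h0Zl h0Zr; ring.
have holE U : hol U = hol X0 * h0 U U ^+ 2.
  have [U0|U0] := eqVneq (h0 U U) 0.
    rewrite U0 (h0_eq0 U0) expr0n mulr0 -(scale0r (0 : H)) holZ.
    by rewrite expr0n mul0r.
  pose c := Num.sqrt (h0 U U).
  have c2 : c ^+ 2 = h0 U U by rewrite sqr_sqrtr // h0_ge0.
  have c0 : c != 0 by apply: contra_neq U0 => c0; rewrite -c2 c0 expr0n.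
  have U1 : h0 (c^-1 *: U) (c^-1 *: U) = 1.
    by rewrite h0Zl h0Zr -c2; field.
  have -> : U = c *: (c^-1 *: U) by rewrite scalerA divff // scale1r.
  rewrite holZ (hol_unit _ U1) h0Zl h0Zr U1; ring.
have kT := kahler_lin (hol X0) kF kahler_Kop.
have T0 : forall X, h0 (F X (J *m X) *m (J *m X)) X
    - hol X0 * h0 (Kop X (J *m X) (J *m X)) X = 0.
  move=> U; rewrite -/(hol U) holE Kop_h0 /omega0 !J0K !h0J !h0Nl !h0_Jr.
  by rewrite !h0_Jxx; field.
apply/eqP; rewrite -subr_eq0; apply/eqP; apply: h0_eq0.
rewrite h0Dl h0Nl h0Zl; exact: (kahler_zero kT T0).
Qed.

End KahlerCurvature.

(** * The curvature forced by the inner torsion *)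

Section InnerTorsionLift.
Context {R : realType} {n : nat} (a b alpha beta gamma delta : R).
Local Notation H := ('cV[R]_(n + n)).
Local Notation V := ('cV[R]_(n + n + 1)).
Local Notation gl := ('M[R]_(n + n + 1)).
Local Notation J := (@J0 R n).

Definition lie_mx m (A B : 'M[R]_m) : 'M[R]_m := A *m B - B *m A.

Definition torsion_lift (v : V) : gl :=
  lambda_nf a b alpha beta gamma delta (usubmx v) (dsubmx v 0 0).

Let P (X : H) : H := alpha *: X + beta *: (J *m X).
Let Q (X : H) : H := gamma *: X + delta *: (J *m X).

Lemma usubmx_vec (X : H) (s : R) : usubmx (vec X s) = X.
Proof. exact: col_mxKu. Qed.

Lemma dsubmx_vec (X : H) (s : R) : dsubmx (vec X s) 0 0 = s.
Proof. by rewrite /vec col_mxKd mxE eqxx mulr1n. Qed.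

Lemma lift_vec (X : H) (s : R) : torsion_lift (vec X s)
  = block_mx (a * s)%:M (P X) (flat (Q X)) (b * s)%:M.
Proof. by rewrite /torsion_lift usubmx_vec dsubmx_vec. Qed.

Lemma lift_linear : linear torsion_lift.
Proof.
move=> c u v; rewrite (vecE u) (vecE v) -vec_linear !lift_vec.
rewrite scale_block_mx add_block_mx !scale_scalar_mx -!raddfD; congr block_mx.
- by congr _%:M; ring.
- by apply/matrixP => i j; rewrite /P mulmxDr -scalemxAr !mxE; ring.
- by apply/matrixP => i j; rewrite /Q /flat mulmxDr -scalemxAr !mxE; ring.
- by congr _%:M; ring.
Qed.

Lemma liftD u v : torsion_lift (u + v) = torsion_lift u + torsion_lift v.
Proof. by have := lift_linear 1 u v; rewrite !scale1r. Qed.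

Lemma lift0 : torsion_lift 0 = 0.
Proof. by apply: (addrI (torsion_lift 0)); rewrite -liftD !addr0. Qed.

Lemma liftZ c u : torsion_lift (c *: u) = c *: torsion_lift u.
Proof. by have := lift_linear c u 0; rewrite lift0 !addr0. Qed.

Lemma liftN u : torsion_lift (- u) = - torsion_lift u.
Proof. by rewrite -scaleN1r liftZ scaleN1r. Qed.

(** The normal form is made of unitary invariants, so it commutes with the
    infinitesimal action of the Lie algebra on its argument and its values. *)
Lemma lift_un0 (C : gl) v : un0 C -> lie_mx C (torsion_lift v) = torsion_lift (C *m v).
Proof.
move=> [A [At AJ] <-]; rewrite (vecE v); move: (usubmx v) (dsubmx v 0 0) => X s.
have -> : block_mx A 0 0 0 *m vec X s = vec (A *m X) 0.
  by rewrite /vec mul_block_col !mul0mx !addr0 raddf0.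
rewrite !lift_vec /lie_mx !mulmx_block !mul0mx !mulmx0 !addr0 !mulr0.
rewrite mul_mx_scalar mul_scalar_mx opp_block_mx add_block_mx subrr oppr0 !addr0 add0r.
rewrite !raddf0; congr block_mx.
  by rewrite /P mulmxDr -!scalemxAr !mulmxA AJ.
  apply: trmx_inj; rewrite /flat linearN /= trmx_mul !trmxK At mulNmx opprK.
  by rewrite /Q mulmxDr -!scalemxAr !mulmxA AJ.
by rewrite addr0.
Qed.

(** The right-hand side of the torsion equation which is left when the
    connection form is the lift itself: horizontal vectors are rescaled and
    rotated along the vertical direction, and the vertical component is a
    multiple of the Kaehler form. *)
Lemma lift_torsion (X Z : H) (s t : R) :
  torsion_lift (vec X s) *m vec Z t - torsion_lift (vec Z t) *m vec X s
  = vec ((a - alpha) *: (s *: Z - t *: X) - beta *: (J *m (s *: Z - t *: X)))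
        (2 * delta * omega0 X Z).
Proof.
rewrite !lift_vec !block_vec !mul_scalar_mx -[- vec _ _]scaleN1r addrC -vec_linear.
congr vec.
  apply/matrixP => i j.
  rewrite /P mulmxBr -!scalemxAr !mxE; ring.
by rewrite /Q !(h0Dl, h0Zl) (h0C Z X) -!/(omega0 _ _) (omega0C X Z); ring.
Qed.

(** The curvature of a connection form equal to the lift of the coframe. A term
    with values in the Lie algebra only changes it by elements of the Lie
    algebra, so it fixes all components of [R0] transverse to the Lie algebra. *)
Definition base_curv (u v : V) : gl :=
  lie_mx (torsion_lift u) (torsion_lift v) - torsion_lift (torsion_lift u *m v - torsion_lift v *m u).

Lemma base_curv_alt : alternating_bilinear base_curv.
Proof.
have swap c (p q r s x y : gl) :
    c *: p + q - (c *: r + s) - (c *: x + y) = c *: (p - r - x) + (q - s - y).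
  by apply/matrixP => i j; rewrite !mxE; ring.
split=> [u c v w|v c u w|u]; last by rewrite /base_curv /lie_mx !subrr lift0 subr0.
all: rewrite /base_curv /lie_mx !lift_linear !mulmxDl !mulmxDr -!scalemxAl -!scalemxAr.
all: have -> (x y z t : V) : c *: x + y - (c *: z + t) = c *: (x - z) + (y - t)
  by rewrite scalerBr opprD addrACA.
all: by rewrite lift_linear swap.
Qed.

Lemma lift_torsion_He (X : H) :
  torsion_lift (vec X 0) *m e0 - torsion_lift e0 *m vec X 0
  = vec ((alpha - a) *: X + beta *: (J *m X)) 0.
Proof.
rewrite /e0 lift_torsion /omega0 h0C h00l mulr0; congr vec.
by rewrite scaler0 sub0r scale1r mulmxN !scalerN opprK -scaleNr opprB.
Qed.

Lemma base_curv_He (X : H) : base_curv (vec X 0) e0 =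
  block_mx 0 ((- alpha ^+ 2 + b * alpha + beta ^+ 2) *: X
                + (beta * (b - 2 * alpha)) *: (J *m X))
    (flat (((2 * a - alpha - b) * gamma + beta * delta) *: X
           + ((2 * a - alpha - b) * delta - beta * gamma) *: (J *m X))) 0.
Proof.
have tor := lift_torsion_He X.
rewrite /base_curv tor /e0 !lift_vec /lie_mx !mulr0 !mulr1 !raddf0.
rewrite [P 0]/P [Q 0]/Q !mulmx0 !scaler0 !addr0 /flat trmx0.
rewrite !mulmx_block !mul0mx !mulmx0 !addr0 !add0r !opp_block_mx !add_block_mx.
rewrite !mul_mx_scalar !mul_scalar_mx !oppr0 !addr0.
congr block_mx.
  rewrite /P; apply/matrixP => i j.
  rewrite !mulmxDr -!scalemxAr !J0K !mxE; ring.
rewrite /Q; apply/matrixP => i j.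
rewrite !mulmxDr -!scalemxAr !J0K !mxE; ring.
Qed.

(** The block of [base_curv] acting on horizontal vectors. *)
Definition base_HH (X Y : H) : 'M[R]_(n + n) :=
  P X *m (Q Y)^T - P Y *m (Q X)^T - (2 * a * delta * omega0 X Y)%:M.

Lemma base_HH_mul (X Y Z : H) : base_HH X Y *m Z
  = h0 (Q Y) Z *: P X - h0 (Q X) Z *: P Y - (2 * a * delta * omega0 X Y) *: Z.
Proof. by rewrite /base_HH !mulmxBl !outer_mul mul_scalar_mx. Qed.

Lemma base_curv_HH (X Y : H) : base_curv (vec X 0) (vec Y 0) =
  block_mx (base_HH X Y) 0 0
    (2 * (delta * alpha - gamma * beta - delta * b) * omega0 X Y)%:M.
Proof.
have tor : torsion_lift (vec X 0) *m vec Y 0 - torsion_lift (vec Y 0) *m vec X 0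
    = vec 0 (2 * delta * omega0 X Y).
  by rewrite lift_torsion !scale0r subrr mulmx0 !scaler0 subrr.
rewrite /base_curv tor !lift_vec /lie_mx !mulr0 !raddf0.
rewrite [P 0]/P [Q 0]/Q !mulmx0 !scaler0 !addr0 /flat trmx0.
rewrite !mulmx_block !mul0mx !mulmx0 !addr0 !add0r !opp_block_mx !add_block_mx.
rewrite !oppr0 !addr0; congr block_mx.
  by rewrite /base_HH; congr (_ - _%:M); ring.
rewrite [X in X - _ - _]mx11_scalar [X in _ - X - _]mx11_scalar -!/(h0 _ _).
rewrite -!raddfB; congr _%:M; rewrite /= /P /Q.
rewrite !(h0Dl, h0Dr, h0Zl, h0Zr) !h0J !h0_Jr (h0C Y X) (h0_JC X Y) /omega0; ring.
Qed.

Lemma alt_vec (W : lmodType R) (F : V -> V -> W) (X Y : H) (s t : R) :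
  alternating_bilinear F -> F (vec X s) (vec Y t)
    = F (vec X 0) (vec Y 0) + t *: F (vec X 0) e0 - s *: F (vec Y 0) e0.
Proof.
move=> aF; have vE (Z : H) (r : R) : vec Z r = vec Z 0 + r *: e0.
  by rewrite addrC /e0 -vec_linear scaler0 add0r mulr1 addr0.
have [_ _ Fa] := aF.
rewrite (vE X s) (vE Y t) !(altDl aF) !(altDr aF) !(altZl aF) !(altZr aF) Fa.
by rewrite !scaler0 addr0 (altC aF (vec Y 0) e0) scalerN.
Qed.

End InnerTorsionLift.

Section ConnectionSplitting.
Context {R : realType} {n : nat} (a b alpha beta gamma delta : R).
Local Notation V := ('cV[R]_(n + n + 1)).
Local Notation gl := ('M[R]_(n + n + 1)).
Local Notation lam := (@torsion_lift R n a b alpha beta gamma delta).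

(** With [om] the sum of the lift of the coframe and a form [Ga] with values in
    the Lie algebra, the mixed terms cancel by [lift_un0] and the torsion
    equation: the curvature is that of the lift plus that of [Ga]. *)
Lemma curvature_split (th : V -> gl) (Ga : V -> V -> gl) (y u v : V) :
  differentiable th y -> (forall w, differentiable (Ga^~ w) y) ->
  (forall w, un0 (Ga y w)) ->
  let om z w := lam (th z *m w) + Ga z w in
  'D_u th y *m v - 'D_v th y *m u
    = om y v *m (th y *m u) - om y u *m (th y *m v) ->
  'D_u (om^~ v) y - 'D_v (om^~ u) y + lie_mx (om y u) (om y v)
    = base_curv a b alpha beta gamma delta (th y *m u) (th y *m v)
      + ('D_u (Ga^~ v) y - 'D_v (Ga^~ u) y + lie_mx (Ga y u) (Ga y v)).
Proof.
move=> dth dGa uGa om tor.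
have lcont (w : V) : differentiable (fun z => th z *m w) y.
  by apply: differentiable_mulmx => //; exact: differentiable_cst.
have dlam c w : differentiable (fun z => lam (th z *m w)) y /\
    'D_c (fun z => lam (th z *m w)) y = lam ('D_c th y *m w).
  pose S k (z : V) : gl := (th z *m w) k 0 *: lam (delta_mx k 0).
  have -> : (fun z => lam (th z *m w)) = \sum_k S k.
    apply/funext => z; rewrite fct_sumE; apply: linear_coords.
    exact: lift_linear.
  have dk k : differentiable (fun z => (th z *m w) k 0) y.
    exact/differentiable_entry/lcont.
  have dS k : differentiable (S k) y by exact: differentiableZl.
  split; first exact: differentiable_sum.
  rewrite derive_sum; last by move=> k; exact: diff_derivable.
  rewrite [RHS](linear_coords _ (@lift_linear R n a b alpha beta gamma delta)).
  apply: eq_bigr => k _.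
  rewrite /S derive_scalemx // derive_cst scaler0 addr0; congr (_ *: _).
  by rewrite derive_entry ?derive_mulmxl.
have dom c w : 'D_c (om^~ w) y = lam ('D_c th y *m w) + 'D_c (Ga^~ w) y.
  have [dl <-] := dlam c w.
  by apply: deriveD; apply: diff_derivable.
have E1 : lam ('D_u th y *m v) - lam ('D_v th y *m u)
    = lam (om y v *m (th y *m u) - om y u *m (th y *m v)).
  by rewrite -tor liftD liftN.
rewrite !dom; move: E1; rewrite /om; set x := th y *m u; set z := th y *m v.
have cu := lift_un0 a b alpha beta gamma delta z (uGa u).
have cv := lift_un0 a b alpha beta gamma delta x (uGa v).
move: (uGa u) (uGa v) cu cv; move: (Ga y u) (Ga y v) => A B _ _ cu cv.
move: (lam ('D_u th y *m v)) (lam ('D_v th y *m u)) => L1 L2.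
have -> : lam ((lam z + B) *m x - (lam x + A) *m z)
    = lie_mx B (lam x) - lie_mx A (lam z) - lam (lam x *m z - lam z *m x).
  rewrite cu cv -!liftN -!liftD opprB; congr lam.
  by rewrite !mulmxDl opprD addrACA addrC.
move=> /(canRL (subrK _)) ->.
rewrite /base_curv /lie_mx !mulmxDl !mulmxDr.
move: ('D_u _ _) ('D_v _ _) (lam (lam x *m z - lam z *m x)) (lam x) (lam z) => d1 d2 l3 l1 l2.
move: (l1 *m l2) (l2 *m l1) (l1 *m B) (B *m l1) (l2 *m A) (A *m l2) (A *m B) (B *m A).
by move=> *; apply/matrixP => i j; rewrite !mxE; ring.
Qed.

End ConnectionSplitting.

(** * The first Bianchi identity *)

Section Bianchi.
Context {R : realType} {m : nat}.
Local Notation E := ('cV[R]_m).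

Lemma derive_sub p q (f g : E -> 'M[R]_(p, q)) x v :
  differentiable f x -> differentiable g x ->
  'D_v (fun y => f y - g y) x = 'D_v f x - 'D_v g x.
Proof. by move=> df dg; apply: deriveB; exact: diff_derivable. Qed.

(** In the names below [s], [d], [m] and [w] stand for second derivatives of the
    coframe, derivatives of the connection form applied to the coframe, the
    connection form applied to derivatives of the coframe, and double products
    of connection forms; the suffix gives the order of the directions. *)
Let cyclic_cancellation (sab sbc sca dab dba dac dca dbc dcb mabc macb mbac mbca
    mcab mcba wabc wacb wbac wbca wcab wcba : E) :
  mcab - mcba = wcba - wcab -> mabc - macb = wacb - wabc ->
  mbca - mbac = wbac - wbca ->
  sca - sbc = (dcb + mbca) - (dca + macb) ->
  sab - sca = (dac + mcab) - (dab + mbac) ->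
  sbc - sab = (dba + mabc) - (dbc + mcba) ->
  (dab - dba + (wabc - wbac)) + (dbc - dcb + (wbca - wcba))
    + (dca - dac + (wcab - wacb)) = 0.
Proof.
move=> e1 e2 e3 e4 e5 e6; apply/matrixP => i j.
have entry (A B : E) : A = B -> A i j = B i j by move=> ->.
move: (entry _ _ e1) (entry _ _ e2) (entry _ _ e3).
move: (entry _ _ e4) (entry _ _ e5) (entry _ _ e6).
by rewrite !mxE; lra.
Qed.

(** Exterior derivative of the torsion equation: the second derivatives of the
    coframe cancel in the cyclic sum, and inserting the torsion equation in the
    first derivatives leaves the curvature. *)
Lemma cartan_bianchi (O : set E) R0 I0 th om (y u v w : E) :
  cartan_structure O R0 I0 th om -> O y ->
  R0 u v *m w + R0 v w *m u + R0 w u *m v = 0.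
Proof.
move=> cs Oy; have oO := cartan_open cs.
have uy := cartan_unit cs Oy; have sth := cartan_smooth_th cs.
pose a := invmx (th y) *m u; pose b := invmx (th y) *m v.
pose c := invmx (th y) *m w.
have [ua vb wc] : [/\ u = th y *m a, v = th y *m b & w = th y *m c].
  by split; rewrite mulKVmx.
rewrite {1 2 3}ua {1 2 3}vb {1 2 3}wc; move: a b c {ua vb wc} => a b c.
have dth := smooth_differentiable sth Oy.
have dDth (x : E) : differentiable ('D_x th) y.
  exact: smooth_differentiable (smooth_derive x sth) Oy.
have dom (x : E) : differentiable (om^~ x) y.
  exact: smooth_differentiable (cartan_smooth_om cs x) Oy.
have dthx (x : E) : differentiable (fun z => th z *m x) y.
  by apply: differentiable_mulmx => //; exact: differentiable_cst.
have dDthx (x t : E) : differentiable (fun z => 'D_x th z *m t) y.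
  by apply: differentiable_mulmx => //; exact: differentiable_cst.
have domth (x t : E) : differentiable (fun z => om z x *m (th z *m t)) y.
  exact: differentiable_mulmx.
have second (r s t : E) :
    'D_r ('D_s th) y *m t - 'D_r ('D_t th) y *m s
    = ('D_r (om^~ t) y *m (th y *m s) + om y t *m ('D_r th y *m s))
    - ('D_r (om^~ s) y *m (th y *m t) + om y s *m ('D_r th y *m t)).
  have E1 : 'D_r (fun z => 'D_s th z *m t - 'D_t th z *m s) y
      = 'D_r (fun z => om z t *m (th z *m s) - om z s *m (th z *m t)) y.
    by apply: (derive_on r oO Oy) => z; rewrite inE => Oz; exact: (cartan_torsion cs).
  have F1 := derive_sub r (dDthx s t) (dDthx t s).
  have F2 := derive_sub r (domth t s) (domth s t).
  have G1 (p q : E) : 'D_r (fun z => 'D_p th z *m q) y = 'D_r ('D_p th) y *m q.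
    exact: derive_mulmxl.
  have G2 (p q : E) : 'D_r (fun z => om z p *m (th z *m q)) y
      = 'D_r (om^~ p) y *m (th y *m q) + om y p *m ('D_r th y *m q).
    by rewrite (derive_mulmx r (dom p) (dthx q)) (derive_mulmxl q r dth).
  apply: etrans (esym (congr2 (fun A B : E => A - B) (G1 s t) (G1 t s))) _.
  apply: etrans (esym F1) _; apply: etrans E1 _; apply: etrans F2 _.
  by rewrite (G2 t s) (G2 s t).
have tor (r s t : E) : om y t *m ('D_r th y *m s) - om y t *m ('D_s th y *m r)
    = om y t *m (om y s *m (th y *m r)) - om y t *m (om y r *m (th y *m s)).
  have T1 := congr1 (mulmx (om y t)) (cartan_torsion cs r s Oy).
  apply: etrans (esym (mulmxBr _ _ _)) _; apply: etrans T1 _.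
  exact: mulmxBr.
have cur (r s t : E) : R0 (th y *m r) (th y *m s) *m (th y *m t)
    = 'D_r (om^~ s) y *m (th y *m t) - 'D_s (om^~ r) y *m (th y *m t)
      + (om y r *m (om y s *m (th y *m t)) - om y s *m (om y r *m (th y *m t))).
  by rewrite -(cartan_curvature cs _ _ Oy) mulmxDl !mulmxBl !mulmxA.
have sw p q := schwarz_mx p q oO Oy sth.
have := second b c a; rewrite (sw c b) (sw a b).
have := second a b c; rewrite (sw c a).
have := second c a b; rewrite !cur.
have := tor c a b; have := tor b c a; have := tor a b c.
exact: cyclic_cancellation.
Qed.

End Bianchi.

(** * Necessity of the normal forms *)

Section ExteriorDerivative.
Context {R : realType} {m : nat}.
Local Notation E := ('cV[R]_m).

(** The exterior derivative of a form [s] applied twice, on three constant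
    fields. *)
Lemma exterior_square (O : set E) (s : E -> E -> R) (y a b c : E) :
  open O -> O y -> (forall u, smooth_on O (s^~ u)) ->
  'D_c (fun z => 'D_a (s^~ b) z - 'D_b (s^~ a) z) y
  + 'D_a (fun z => 'D_b (s^~ c) z - 'D_c (s^~ b) z) y
  + 'D_b (fun z => 'D_c (s^~ a) z - 'D_a (s^~ c) z) y = 0.
Proof.
move=> oO Oy ss.
have dDs (u v w : E) : derivable ('D_u (s^~ v)) y w.
  apply: diff_derivable; exact: smooth_differentiable (smooth_derive u (ss v)) Oy.
have split_sub (u v w : E) : 'D_w (fun z => 'D_u (s^~ v) z - 'D_v (s^~ u) z) y
    = 'D_w ('D_u (s^~ v)) y - 'D_w ('D_v (s^~ u)) y.
  by apply: deriveB; exact: dDs.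
have sw (u v w : E) : 'D_u ('D_v (s^~ w)) y = 'D_v ('D_u (s^~ w)) y.
  exact: (schwarz v u oO Oy (ss w)).
have cancel (p q r p' q' r' : R) : p = p' -> q = q' -> r = r' ->
    p - q' + (r - p') + (q - r') = 0 by move=> -> -> ->; ring.
apply: etrans (congr2 (fun A B : R => A + B) (congr2 (fun A B : R => A + B)
  (split_sub a b c) (split_sub b c a)) (split_sub c a b)) _.
exact: (cancel _ _ _ _ _ _ (sw c a b) (sw b c a) (sw a b c)).
Qed.

End ExteriorDerivative.

Section HorizontalForm.
Context {R : realType} {n : nat}.
Local Notation H := ('cV[R]_(n + n)).
Local Notation V := ('cV[R]_(n + n + 1)).
Local Notation gl := ('M[R]_(n + n + 1)).
Local Notation J := (@J0 R n).

Lemma omega0Dr (X Y Z : H) : omega0 Z (X + Y) = omega0 Z X + omega0 Z Y.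
Proof. exact: h0Dr. Qed.

Lemma omega0Zr c (X Z : H) : omega0 Z (c *: X) = c * omega0 Z X.
Proof. exact: h0Zr. Qed.

Lemma omega0Zl c (X Z : H) : omega0 (c *: X) Z = c * omega0 X Z.
Proof. by rewrite /omega0 -scalemxAr h0Zl. Qed.

(** The form [omega0] on the horizontal components. *)
Definition hform (u v : V) : R := ((Jhat *m u)^T *m v) 0 0.

Lemma hform_vec (X Y : H) (s t : R) : hform (vec X s) (vec Y t) = omega0 X Y.
Proof.
rewrite /hform /Jhat /vec mul_block_col !mul0mx !addr0 tr_col_mx trmx0.
by rewrite mul_row_col mul0mx addr0.
Qed.

Lemma hformC u v : hform v u = - hform u v.
Proof. by rewrite (vecE u) (vecE v) !hform_vec omega0C. Qed.

Lemma hformBl u v w : hform (u - v) w = hform u w - hform v w.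
Proof.
rewrite (vecE u) (vecE v) (vecE w) -scaleN1r addrC -vec_linear !hform_vec.
by rewrite omega0Dl omega0Zl mulN1r addrC.
Qed.

(** Elements of the Lie algebra are infinitesimal symplectic maps. *)
Lemma hform_un0 (C : gl) u v : un0 C -> hform (C *m u) v = hform (C *m v) u.
Proof.
move=> [A [At AJ] <-]; rewrite (vecE u) (vecE v).
move: (usubmx u) (dsubmx u 0 0) (usubmx v) (dsubmx v 0 0) => X s Y t.
have AE (Z : H) (r : R) : block_mx A 0 0 0 *m vec Z r = vec (A *m Z) 0.
  by rewrite /vec mul_block_col !mul0mx !addr0 raddf0.
have AJE (Z : H) : J *m (A *m Z) = A *m (J *m Z) by rewrite !mulmxA AJ.
rewrite !AE !hform_vec /omega0 (AJE X) (h0_adj A) At mulNmx h0Nr -(h0_Jr X).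
exact: h0C.
Qed.

Lemma derive_hform (f g : V -> V) (z c : V) :
  differentiable f z -> differentiable g z ->
  'D_c (fun t => hform (f t) (g t)) z
    = hform ('D_c f z) (g z) + hform (f z) ('D_c g z).
Proof.
move=> df dg; have dJf : differentiable (fun t => Jhat *m f t) z.
  by apply: differentiable_mulmx => //; exact: differentiable_cst.
have dT := differentiable_trmx dJf.
rewrite derive_entry; last exact: differentiable_mulmx.
rewrite (derive_mulmx c dT dg) (derive_trmx c dJf) (derive_mulmxr _ c df).
by rewrite mxE.
Qed.

Lemma derive_trace (A : V -> gl) (z c : V) : differentiable A z ->
  'D_c (fun t => \tr (A t)) z = \tr ('D_c A z).
Proof.
move=> dA.
have -> : (fun t => \tr (A t)) = \sum_i (fun t => A t i i).
  by apply/funext => t; rewrite fct_sumE.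
rewrite derive_sum; last first.
  by move=> i; apply: diff_derivable; exact: differentiable_entry.
by apply: eq_bigr => i _; rewrite derive_entry.
Qed.

Lemma trace_outer (X Y : H) : \tr (X *m Y^T) = h0 Y X.
Proof. by rewrite mxtrace_mulC /h0 /mxtrace big_ord1. Qed.

Lemma trace_J_Kop (G : 'M[R]_(n + n)) (kappa : R) X Y :
  (forall Z, G *m Z = kappa *: Kop X Y Z) ->
  \tr (J *m G) = kappa * (n.+1)%:R * omega0 X Y.
Proof.
move=> GK; have -> : G = kappa *: kahler_op X Y.
  by apply: linmx_ext => Z; rewrite GK -scalemxAl kahler_op_mul.
have t1 (U W : H) : \tr (J *m (U *m W^T)) = h0 W (J *m U).
  by rewrite mulmxA trace_outer.
have t2 : \tr (J *m J) = - (n + n)%:R by rewrite J0_sqr linearN /= mxtrace_scalar.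
rewrite -scalemxAr mxtraceZ -scalemxAr mxtraceZ !(mulmxBr, mulmxDr) -scalemxAr.
rewrite !(linearB, linearD) /= !t1 mxtraceZ t2 !J0K !h0Nr.
rewrite (h0C Y) (h0C X) -[h0 (J *m Y) X]/(omega0 Y X) (omega0C X Y).
rewrite -[h0 (J *m X) Y]/(omega0 X Y) natrD -natr1.
by field.
Qed.

End HorizontalForm.

Section Necessity.
Context {R : realType} {n : nat} (n0 : (0 < n)%N).
Local Notation H := ('cV[R]_(n + n)).
Local Notation V := ('cV[R]_(n + n + 1)).
Local Notation gl := ('M[R]_(n + n + 1)).
Local Notation J := (@J0 R n).
Context (I0 : V -> set gl) (a b alpha beta gamma delta : R).
Context (R0 : V -> V -> gl) (c0 c1 c2 c3 c4 : R) (B : H -> H -> 'M[R]_(n + n)).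
Hypothesis I0nf : inner_torsion_nf I0 a b alpha beta gamma delta.
Hypothesis R0alt : alternating_bilinear R0.
Hypothesis Balt : alternating_bilinear B.
Hypothesis Beq : equivariant2 Un B.
Hypothesis R0nf : curvature_nf R0 c0 c1 c2 c3 c4 B.

Local Notation lam := (@torsion_lift R n a b alpha beta gamma delta).
Local Notation base := (@base_curv R n a b alpha beta gamma delta).
Local Notation baseHH := (@base_HH R n a alpha beta gamma delta).

Lemma inner_torsion_lift v : I0 v = coset un0 (lam v).
Proof. by rewrite (vecE v) I0nf /torsion_lift -vecE. Qed.

Context (O : set V) (th : V -> gl) (om : V -> V -> gl).
Hypothesis cs : cartan_structure O R0 I0 th om.

(** The part of the connection form with values in the Lie algebra. *)
Let Ga z w := om z w - lam (th z *m w).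

Let omE z w : om z w = lam (th z *m w) + Ga z w.
Proof. by rewrite addrC subrK. Qed.

Lemma connection_part_un0 z w : O z -> un0 (Ga z w).
Proof.
move=> Oz; have := cartan_inner cs w Oz; rewrite inner_torsion_lift => -[C uC E1].
by rewrite /Ga -E1 addrAC subrr add0r.
Qed.

Let dth z : O z -> differentiable th z.
Proof. exact: smooth_differentiable (cartan_smooth_th cs). Qed.

Lemma connection_part_smooth w : smooth_on O (Ga^~ w).
Proof.
have oO := cartan_open cs; have sth := cartan_smooth_th cs.
have -> : Ga^~ w = (fun z => om z w
    + \sum_k (- (th z *m w) k 0) *: lam (delta_mx k 0)).
  apply/funext => z; rewrite /Ga; congr (_ + _).
  rewrite -liftN (linear_coords _ (@lift_linear R n a b alpha beta gamma delta)).
  by apply: eq_bigr => k _; rewrite mxE.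
apply: smoothD => //; first exact: (cartan_smooth_om cs).
apply: smooth_sum => // k _; apply: smooth_scale_cst => //.
have -> : (fun z => - (th z *m w) k 0) = (fun z => (th z *m (- w)) k 0).
  by apply/funext => z; rewrite mulmxN [in RHS]mxE.
apply: smooth_entry => //; apply: smooth_mulmx => //; exact: smooth_cst.
Qed.

Let dGa z w : O z -> differentiable (Ga^~ w) z.
Proof. exact: smooth_differentiable (connection_part_smooth w). Qed.

Let N z u v := 'D_u (Ga^~ v) z - 'D_v (Ga^~ u) z + lie_mx (Ga z u) (Ga z v).

Lemma curvature_decomposition z u v : O z ->
  R0 (th z *m u) (th z *m v) - base (th z *m u) (th z *m v) = N z u v.
Proof.
move=> Oz; apply/eqP; rewrite subr_eq addrC eq_sym; apply/eqP.
have omf w : (fun t => lam (th t *m w) + Ga t w) = om^~ w.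
  by apply/funext => t; rewrite -omE.
rewrite -(cartan_curvature cs _ _ Oz) -!omf.
have := @curvature_split R n a b alpha beta gamma delta th Ga z u v (dth Oz)
  (fun w => dGa w Oz) (fun w => connection_part_un0 w Oz).
move=> /=; rewrite -!omE => /(_ (cartan_torsion cs _ _ Oz)) <-.
by rewrite /lie_mx.
Qed.

Lemma curvature_un0 z u v : O z -> un0 (N z u v).
Proof.
move=> Oz; have oO := cartan_open cs.
have dG c w : un0 ('D_c (Ga^~ w) z).
  by apply: (derive_un0 c oO Oz (dGa w Oz)) => t; exact: connection_part_un0.
apply: un0D; first by apply: un0B; exact: dG.
by apply: un0_comm; exact: connection_part_un0.
Qed.

Context (y : V).
Hypothesis Oy : O y.

(** The coframe is invertible, so a single point of the domain already controls
    [R0] on all pairs of vectors. *)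
Lemma curvature_mod u v : un0 (R0 u v - base u v).
Proof.
have uy := cartan_unit cs Oy.
rewrite -[u](mulKVmx uy) -[v](mulKVmx uy) curvature_decomposition //.
exact: curvature_un0.
Qed.

Let F X Y := B X Y - baseHH X Y.

(** These blocks of [R0] are transverse to the Lie algebra, hence equal to those
    of [base_curv]; they are compared on [X] and [J *m X] for a unit vector. *)
Lemma curvature_coefficients :
  [/\ c1 = - alpha ^+ 2 + b * alpha + beta ^+ 2,
      c2 = beta * (b - 2 * alpha),
      c3 = (2 * a - alpha - b) * gamma + beta * delta,
      c4 = (2 * a - alpha - b) * delta - beta * gamma &
      c0 = 2 * (delta * alpha - gamma * beta - delta * b)].
Proof.
have [X X1] := @unit_vector R n n0.
have [A _] := curvature_mod (vec X 0) e0.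
rewrite R0nf.1 base_curv_He opp_block_mx add_block_mx.
move=> /eq_block_mx[_ /esym/eqP + /esym/eqP + _].
rewrite subr_eq0 => /eqP /(complex_coefs X1) [-> ->].
rewrite subr_eq0 => /eqP /trmx_inj /(complex_coefs X1) [-> ->].
have [A' _] := curvature_mod (vec X 0) (vec (J *m X) 0).
rewrite R0nf.2 base_curv_HH opp_block_mx add_block_mx.
move=> /eq_block_mx[_ _ _ /(congr1 (fun M : 'M[R]_1 => M 0 0))].
rewrite !mxE eqxx !mulr1n /omega0 h0J X1 !mulr1 => /esym/eqP.
by rewrite subr_eq0 => /eqP ->.
Qed.

Lemma excess_curvature_un X Y : un (F X Y).
Proof.
have [A uA] := curvature_mod (vec X 0) (vec Y 0).
rewrite R0nf.2 base_curv_HH opp_block_mx add_block_mx.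
by move=> /eq_block_mx[AE _ _ _]; rewrite /F -AE.
Qed.

Lemma horizontal_bianchi X Y Z : B X Y *m Z + B Y Z *m X + B Z X *m Y = 0.
Proof.
have := cartan_bianchi (vec X 0) (vec Y 0) (vec Z 0) cs Oy.
rewrite !R0nf.2 /vec !mul_block_col !mul0mx !addr0 !raddf0 ?mulmx0 ?addr0.
by rewrite !add_col_mx -col_mx0 => /eq_col_mx[].
Qed.

(** The vertical component of the Bianchi identity for [X], [J *m X] and [e0],
    where [X] is a unit vector. *)
Lemma mixed_bianchi : c0 = 2 * c4.
Proof.
have [X X1] := @unit_vector R n n0.
have := cartan_bianchi (vec X 0) (vec (J *m X) 0) e0 cs Oy.
rewrite R0nf.2 R0nf.1 (altC R0alt (vec X 0) e0) R0nf.1.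
rewrite /e0 mulNmx /vec !mul_block_col !mul0mx !mulmx0 !mulmx1 !raddf0 ?mulmx0.
rewrite !addr0 !add0r opp_col_mx !add_col_mx => /(congr1 dsubmx).
rewrite col_mxKd raddf0 [flat _ *m X]mx11_scalar [flat _ *m (J *m X)]mx11_scalar.
rewrite /flat -!/(h0 _ _) => /(congr1 (fun M : 'M[R]_1 => M 0 0)).
rewrite !(h0Dl, h0Zl) J0K !h0Nl h0J h0_Jr h0_Jxx X1 /omega0 h0J X1 !mxE eqxx.
rewrite !mulr1n => h; lra.
Qed.

Lemma no_contact_twist : delta * (alpha - a) = 0.
Proof.
by have := mixed_bianchi; have [_ _ _ -> ->] := curvature_coefficients; lra.
Qed.

Let P (X : H) : H := alpha *: X + beta *: (J *m X).
Let Q (X : H) : H := gamma *: X + delta *: (J *m X).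

(** The excess of [B] over the forced part, corrected by a multiple of [J] so as to
    satisfy the Bianchi identity. *)
Let Kahler X Y : 'M[R]_(n + n) := F X Y + (2 * beta * delta * omega0 X Y) *: J.

Lemma Kahler_mul X Y Z : B X Y *m Z = h0 (Q Y) Z *: P X - h0 (Q X) Z *: P Y
    - (2 * a * delta * omega0 X Y) *: Z
    - (2 * beta * delta * omega0 X Y) *: (J *m Z) + Kahler X Y *m Z.
Proof.
rewrite /Kahler /F mulmxDl mulmxBl base_HH_mul -scalemxAl.
by apply/matrixP => i j; rewrite ![in RHS]mxE ?(mxE _ _ i j); ring.
Qed.

Lemma Kahler_un X Y : un (Kahler X Y).
Proof.
have [Ft FJ] := excess_curvature_un X Y; split.
  by rewrite /Kahler linearD linearZ /= Ft J0_tr scalerN [RHS]opprD.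
by rewrite /Kahler mulmxDl mulmxDr FJ -scalemxAl -scalemxAr.
Qed.

Lemma h0_Q X Z : h0 (Q X) Z = gamma * h0 X Z + delta * omega0 X Z.
Proof. by rewrite /Q h0Dl !h0Zl. Qed.

Lemma KahlerE X Y Z : Kahler X Y *m Z = B X Y *m Z
    - ((gamma * h0 Y Z + delta * omega0 Y Z) *: P X
      - (gamma * h0 X Z + delta * omega0 X Z) *: P Y
      - (2 * a * delta * omega0 X Y) *: Z
      - (2 * beta * delta * omega0 X Y) *: (J *m Z)).
Proof.
rewrite Kahler_mul !h0_Q; move: (Kahler X Y *m Z) (J *m Z) (P X) (P Y) => A C U W.
by apply/matrixP => i j; rewrite !mxE; ring.
Qed.

Lemma P_linear : linear P.
Proof.
move=> c X Y; rewrite /P mulmxDr -scalemxAr.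
by move: (J *m X) (J *m Y) => A C; apply/matrixP => i j; rewrite !mxE; ring.
Qed.

Lemma Kahler_alt : alternating_bilinear Kahler.
Proof.
split=> [X c Y Y'|Y c X X'|X].
- apply: linmx_ext => Z; rewrite KahlerE [RHS]mulmxDl -scalemxAl !KahlerE P_linear.
  rewrite (altDr Balt) (altZr Balt) mulmxDl -scalemxAl.
  rewrite !(h0Dl, h0Zl, omega0Dl, omega0Zl, omega0Dr, omega0Zr).
  move: (B X Y *m Z) (B X Y' *m Z) (J *m Z) (P X) (P Y) (P Y') => *.
  by apply/matrixP => i j; rewrite !mxE; ring.
- apply: linmx_ext => Z; rewrite KahlerE [RHS]mulmxDl -scalemxAl !KahlerE P_linear.
  rewrite (altDl Balt) (altZl Balt) mulmxDl -scalemxAl.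
  rewrite !(h0Dl, h0Zl, omega0Dl, omega0Zl, omega0Dr, omega0Zr).
  move: (B X Y *m Z) (B X' Y *m Z) (J *m Z) (P X) (P X') (P Y) => *.
  by apply/matrixP => i j; rewrite !mxE; ring.
- have [_ _ Ba] := Balt.
  apply: linmx_ext => Z; rewrite KahlerE Ba !mul0mx /omega0 h0_Jxx !mulr0 !scale0r.
  by rewrite subrr !subr0.
Qed.

(** The cyclic sum of the explicit terms is a multiple of [delta * (alpha - a)]. *)
Lemma Kahler_bianchi X Y Z :
  Kahler X Y *m Z + Kahler Y Z *m X + Kahler Z X *m Y = 0.
Proof.
have nt := no_contact_twist.
rewrite !KahlerE /P (omega0C X Y) (omega0C Y Z) (omega0C Z X).
rewrite (h0C Y X) (h0C Z Y) (h0C X Z).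
have := horizontal_bianchi X Y Z.
move: (B X Y *m Z) (B Y Z *m X) (B Z X *m Y) (J *m X) (J *m Y) (J *m Z).
move=> A C D U W T E1.
have -> : A = - C - D.
  by apply/eqP; rewrite -subr_eq0 opprD !opprK addrA E1.
have e i j : 2 * (omega0 X Y * Z i j + omega0 Y Z * X i j + omega0 Z X * Y i j)
  * (delta * (alpha - a)) = 0 by rewrite nt mulr0.
apply/matrixP => i j; rewrite !mxE -[RHS]oppr0 -(e i j); ring.
Qed.

Lemma Kahler_invariant (A : 'M[R]_(n + n)) (X Y Z : H) : Un A ->
  Kahler (A *m X) (A *m Y) *m (A *m Z) = A *m (Kahler X Y *m Z).
Proof.
move=> uA; have [At AJ] := uA.
have Au : A \in unitmx by have [] := mulmx1_unit At.
have hA (U W : H) : h0 (A *m U) (A *m W) = h0 U W.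
  by rewrite h0_adj (mulmxA A^T) At mul1mx.
have JA (U : H) : J *m (A *m U) = A *m (J *m U) by rewrite !mulmxA AJ.
have oA (U W : H) : omega0 (A *m U) (A *m W) = omega0 U W.
  by rewrite /omega0 JA hA.
have PA U : P (A *m U) = A *m P U by rewrite /P JA mulmxDr -!scalemxAr.
rewrite !KahlerE !hA !oA !PA JA (Beq _ _ uA) -!mulmxA mulKmx //.
by rewrite !(mulmxBr A) -!scalemxAr.
Qed.

Lemma Kahler_multiple :
  exists kappa, forall X Y Z, Kahler X Y *m Z = kappa *: Kop X Y Z.
Proof.
exact: (invariant_kahler_curvature n0 Kahler_alt Kahler_un Kahler_bianchi
  Kahler_invariant).
Qed.

Let G u v := R0 u v - base u v.

Lemma curvature_difference_alt : alternating_bilinear G.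
Proof.
have bA := @base_curv_alt R n a b alpha beta gamma delta.
have ext (p q r s : gl) (c : R) : c *: p + q - (c *: r + s) = c *: (p - r) + (q - s).
  by apply/matrixP => i j; rewrite !mxE; ring.
split=> [u c v w|v c u w|u]; rewrite /G.
- by rewrite (altDr R0alt) (altZr R0alt) (altDr bA) (altZr bA) ext.
- by rewrite (altDl R0alt) (altZl R0alt) (altDl bA) (altZl bA) ext.
- by have [_ _ ->] := R0alt; have [_ _ ->] := bA; rewrite subrr.
Qed.

(** Pairing with the complex structure makes the excess curvature a scalar
    two-form, a multiple of the Kaehler form. *)
Lemma trace_curvature_difference kappa u v : delta = 0 ->
  (forall X Y Z, Kahler X Y *m Z = kappa *: Kop X Y Z) ->
  \tr (Jhat *m G u v) = kappa * (n.+1)%:R * hform u v.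
Proof.
move=> d0 KK; have [e1 e2 e3 e4 _] := curvature_coefficients.
have GHe X : G (vec X 0) e0 = 0.
  by rewrite /G R0nf.1 base_curv_He e1 e2 e3 e4 subrr.
rewrite (vecE u) (vecE v) hform_vec (alt_vec _ _ _ _ curvature_difference_alt).
move: (usubmx u) (usubmx v) => X Y.
rewrite !GHe !scaler0 addr0 subr0 /G R0nf.2 base_curv_HH opp_block_mx add_block_mx.
rewrite /Jhat mulmx_block !mul0mx !addr0 mxtrace_block mxtrace0 addr0.
have -> : B X Y - baseHH X Y = Kahler X Y.
  have z0 : 2 * beta * delta * omega0 X Y = 0 by rewrite d0 mulr0 mul0r.
  by rewrite /Kahler z0 scale0r addr0.
exact: (trace_J_Kop (KK X Y)).
Qed.

(** The trace of [J] against the Lie algebra part of the connection form is a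
    potential for a multiple of [kappa] times [omega0] pulled back by the coframe.
    When [alpha - a] does not vanish that pullback is not closed, because the
    torsion equation rescales it along the vertical direction. *)
Lemma holomorphic_curvature_eq0 kappa : alpha <> a ->
  (forall X Y Z, Kahler X Y *m Z = kappa *: Kop X Y Z) -> kappa = 0.
Proof.
move=> neq KK; have oO := cartan_open cs.
have aa : alpha - a != 0 by rewrite subr_eq0; apply/eqP.
have d0 : delta = 0.
  by have /eqP := no_contact_twist; rewrite mulf_eq0 (negbTE aa) orbF => /eqP.
pose s z u : R := \tr (Jhat *m Ga z u).
have dJG (z u : V) : O z -> differentiable (fun t => Jhat *m Ga t u) z.
  move=> Oz; apply: differentiable_mulmx; first exact: differentiable_cst.
  exact: dGa.
have ss u : smooth_on O (s^~ u).
  apply: smooth_sum => // k _; apply: smooth_entry => //.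
  apply: smooth_mulmx => //; [exact: smooth_cst|exact: connection_part_smooth].
have ds (z u v : V) : O z ->
    'D_u (s^~ v) z - 'D_v (s^~ u) z
    = kappa * (n.+1)%:R * hform (th z *m u) (th z *m v).
  move=> Oz; rewrite -(trace_curvature_difference _ _ d0 KK) /G.
  rewrite (curvature_decomposition u v Oz) /N mulmxDr linearD /=.
  have Dtr (c w : V) : 'D_c (s^~ w) z = \tr (Jhat *m 'D_c (Ga^~ w) z).
    by rewrite /s (derive_trace c (dJG z w Oz)) (derive_mulmxr _ c (dGa w Oz)).
  have lie0 (A C : gl) : un0 A -> \tr (Jhat *m lie_mx A C) = 0.
    move=> /un0P[_ AJ _]; rewrite /lie_mx mulmxBr linearB /= !mulmxA -AJ.
    by rewrite [X in _ - X]mxtrace_mulC !mulmxA subrr.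
  rewrite lie0 ?addr0; last exact: connection_part_un0.
  by rewrite !Dtr mulmxBr linearB.
have [X X1] := @unit_vector R n n0.
have uy := cartan_unit cs Oy.
pose u := invmx (th y) *m vec X 0; pose v := invmx (th y) *m vec (J *m X) 0.
pose w := invmx (th y) *m e0.
have [uE vE wE] : [/\ th y *m u = vec X 0, th y *m v = vec (J *m X) 0 & th y *m w = e0].
  by split; rewrite mulKVmx.
have dth' (r : V) : differentiable (fun z => th z *m r) y.
  by apply: differentiable_mulmx; [exact: dth|exact: differentiable_cst].
have Ds (p q r : V) : 'D_p (fun z => 'D_q (s^~ r) z - 'D_r (s^~ q) z) y
  = kappa * (n.+1)%:R * (hform ('D_p th y *m q) (th y *m r)
                         + hform (th y *m q) ('D_p th y *m r)).
  have E1 : 'D_p (fun z => 'D_q (s^~ r) z - 'D_r (s^~ q) z) y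
    = 'D_p (fun z => kappa * (n.+1)%:R * hform (th z *m q) (th z *m r)) y.
    by apply: (derive_on p oO Oy) => z; rewrite inE => Oz; exact: ds.
  have dh : derivable (fun z => hform (th z *m q) (th z *m r)) y p.
    apply: diff_derivable; apply: differentiable_entry.
    apply: differentiable_mulmx; last exact: dth'.
    apply: differentiable_trmx; apply: differentiable_mulmx; last exact: dth'.
    exact: differentiable_cst.
  apply: etrans E1 _; apply: etrans (deriveZ _ dh) _.
  rewrite (derive_hform p (dth' q) (dth' r)).
  by rewrite !(derive_mulmxl _ _ (dth Oy)).
have := exterior_square u v w oO Oy ss.
move=> /(etrans (esym (congr2 (fun A C : R => A + C) (congr2 (fun A C : R => A + C)
  (Ds w u v) (Ds u v w)) (Ds v w u)))).
rewrite uE vE wE /e0.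
have he (p : V) : hform p (vec 0 1) = 0.
  by rewrite (vecE p) hform_vec /omega0 h0C h00l.
have he' (p : V) : hform (vec 0 1) p = 0 by rewrite hformC he oppr0.
rewrite !he !he' !addr0 !add0r.
(* The derivative of the coframe along the vertical vector [w]: the rescaling
   prescribed by the lift, up to a unitary rotation which preserves [hform]. *)
have twist (r t : V) (Y : H) : th y *m r = vec Y 0 -> hform ('D_w th y *m r) t
    - hform ('D_r th y *m w) t
    = hform (vec ((alpha - a) *: Y + beta *: (J *m Y)) 0) t
      - hform (Ga y w *m vec Y 0) t.
  move=> rE; have [_ _ Ge] := (un0P (Ga y r)).1 (connection_part_un0 r Oy).
  have A1 : om y r *m e0 = lam (vec Y 0) *m e0.
    by rewrite omE rE; move: (Ga y r) Ge => Gr Ge; rewrite mulmxDl Ge addr0.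
  have A2 : om y w *m vec Y 0 = lam e0 *m vec Y 0 + Ga y w *m vec Y 0.
    by rewrite omE wE; move: (Ga y w) => Gw; rewrite mulmxDl.
  have tE : 'D_w th y *m r - 'D_r th y *m w
      = vec ((alpha - a) *: Y + beta *: (J *m Y)) 0 - Ga y w *m vec Y 0.
    rewrite -(lift_torsion_He a b alpha beta gamma delta) -addrA -opprD -A1 -A2.
    by rewrite -{1}wE -{1}rE; exact: (cartan_torsion cs).
  by rewrite -!hformBl tE.
have t1 := twist u (vec (J *m X) 0) X uE.
have t2 := twist v (vec X 0) (J *m X) vE.
have gE := hform_un0 (vec X 0) (vec (J *m X) 0) (connection_part_un0 w Oy).
have h1 : hform (vec ((alpha - a) *: X + beta *: (J *m X)) 0) (vec (J *m X) 0)
    = alpha - a.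
  rewrite hform_vec omega0Dl !omega0Zl /omega0 h0J X1 J0K h0Nl h0_Jr h0_Jxx; ring.
have h2 : hform (vec ((alpha - a) *: (J *m X) + beta *: (J *m (J *m X))) 0)
    (vec X 0) = a - alpha.
  rewrite hform_vec omega0Dl !omega0Zl /omega0 !J0K mulmxN !h0Nl h0_Jxx X1; ring.
rewrite (hformC ('D_u th y *m w)) (hformC ('D_w th y *m v)) => E1.
have E2 : kappa * (n.+1)%:R * (2 * (alpha - a)) = 0.
  have -> : 2 * (alpha - a) = 0 + (hform ('D_w th y *m u) (vec (J *m X) 0)
      - hform ('D_w th y *m v) (vec X 0))
      - hform ('D_u th y *m w) (vec (J *m X) 0)
      + hform ('D_v th y *m w) (vec X 0).
    move: t1 t2; rewrite h1 h2 gE; lra.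
  by apply: etrans _ E1; ring.
move/eqP: E2; rewrite !mulf_eq0 (negbTE aa) pnatr_eq0 /= pnatr_eq0 !orbF.
by move/eqP.
Qed.

Theorem cartan_necessary : I0 <> (fun=> coset un0 0) ->
  delta * (alpha - a) = 0 /\
  (case_i a b alpha beta gamma delta c0 c1 c2 c3 c4 B \/
   case_ii a b alpha beta gamma delta c0 c1 c2 c3 c4 B).
Proof.
move=> I0nz; split; first exact: no_contact_twist.
have [e1 e2 e3 e4 e0] := curvature_coefficients; have e04 := mixed_bianchi.
have [kappa KK] := Kahler_multiple.
have [ea|/eqP na] := eqVneq alpha a.
  left; split => //.
  - move=> [za zb zbeta zgamma zdelta]; apply: I0nz; apply/funext => v.
    rewrite inner_torsion_lift; congr coset.
    rewrite /torsion_lift /lambda_nf ea za zb zbeta zgamma zdelta /flat.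
    by rewrite !mul0r !scale0r !addr0 trmx0 !raddf0 block_mx0.
  - split; [rewrite e1|rewrite e2|rewrite e3|rewrite e4|by []]; rewrite ea; ring.
  - exists kappa => X Y Z; rewrite Kahler_mul KK /P /Q ea //.
right; have k0 := holomorphic_curvature_eq0 na KK.
have d0 : delta = 0.
  have /eqP := no_contact_twist; rewrite mulf_eq0 subr_eq0 => /orP[/eqP //|/eqP].
  by move/na.
split => //.
- split; [rewrite e1|rewrite e2|rewrite e3|rewrite e4|split => //; rewrite e04 e4]; rewrite ?d0; ring.
- move=> X Y Z; rewrite Kahler_mul KK k0 scale0r addr0 d0 !mulr0 !mul0r !scale0r !subr0.
  by rewrite !h0_Q d0 !mul0r !addr0 -!scalerA -scalerBr.
Qed.

End Necessity.

(** * Models built from a horizontal coframe *)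

Section Models.
Context {R : realType} {n : nat}.
Local Notation H := ('cV[R]_(n + n)).
Local Notation V := ('cV[R]_(n + n + 1)).
Local Notation gl := ('M[R]_(n + n + 1)).
Local Notation J := (@J0 R n).
Context (I0 : V -> set gl) (a b alpha beta gamma delta : R) (R0 : V -> V -> gl).
Hypothesis I0nf : inner_torsion_nf I0 a b alpha beta gamma delta.
Local Notation lam := (@torsion_lift R n a b alpha beta gamma delta).
Local Notation base := (@base_curv R n a b alpha beta gamma delta).

Definition hincl : 'M[R]_(n + n + 1, n + n) := col_mx 1%:M 0.

Definition hblock (G : 'M[R]_(n + n)) : gl := block_mx G 0 0 0.

Lemma vec_hincl (X : H) (s : R) : vec X s = hincl *m X + s *: e0.
Proof.
rewrite /e0 /hincl mul_col_mx mul1mx mul0mx.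
have -> : col_mx X 0 = vec X 0 by rewrite /vec raddf0.
by rewrite addrC -vec_linear scaler0 add0r mulr1 addr0.
Qed.

Lemma hblock_hincl G : hblock G = hincl *m G *m hincl^T.
Proof.
rewrite /hblock /hincl mul_col_mx mul1mx mul0mx tr_col_mx trmx1 trmx0.
by rewrite mul_col_row mulmx1 !mulmx0 !mul0mx.
Qed.

Lemma hblock_vec G (X : H) (s : R) : hblock G *m vec X s = vec (G *m X) 0.
Proof. by rewrite /hblock /vec mul_block_col !mul0mx !addr0 raddf0. Qed.

Lemma hblock_un0 G : un G -> un0 (hblock G).
Proof. by move=> uG; exists G. Qed.

Context (O : set V) (Om : H -> H -> 'M[R]_(n + n)).
Hypothesis R0E : forall u v, R0 u v = base u v + hblock (Om (usubmx u) (usubmx v)).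
Context (thH : V -> V -> H) (eta : V -> V -> R) (G : V -> V -> 'M[R]_(n + n)).
Hypothesis oO : open O.
Hypothesis thH_linear : forall z, linear (thH z).
Hypothesis eta_linear : forall z c u v, eta z (c *: u + v) = c * eta z u + eta z v.
Hypothesis G_linear : forall z, linear (G z).
Hypothesis nondegenerate : forall z w, O z -> thH z w = 0 -> eta z w = 0 -> w = 0.
Hypothesis thH_smooth : forall w, smooth_on O (thH^~ w).
Hypothesis eta_smooth : forall w, smooth_on O (eta^~ w).
Hypothesis G_smooth : forall w, smooth_on O (G^~ w).
Hypothesis G_un : forall z w, O z -> un (G z w).
Hypothesis horizontal_torsion : forall z u v, O z ->
  'D_u (thH^~ v) z - 'D_v (thH^~ u) z
  = G z v *m thH z u - G z u *m thH z v
    - ((a - alpha) *: (eta z u *: thH z v - eta z v *: thH z u)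
       - beta *: (J *m (eta z u *: thH z v - eta z v *: thH z u))).
Hypothesis vertical_torsion : forall z u v, O z ->
  'D_u (eta^~ v) z - 'D_v (eta^~ u) z
  = - (2 * delta * omega0 (thH z u) (thH z v)).
Hypothesis horizontal_curvature : forall z u v, O z ->
  'D_u (G^~ v) z - 'D_v (G^~ u) z + lie_mx (G z u) (G z v)
  = Om (thH z u) (thH z v).

(** The ansatz of all models: a horizontal coframe [thH], a vertical coframe
    [eta], and the lift of both plus a form [G] with values in the unitary Lie
    algebra. *)
Definition model_coframe (z : V) : gl := linmx (fun w => vec (thH z w) (eta z w)).

Definition model_form (z w : V) : gl := lam (model_coframe z *m w) + hblock (G z w).

Lemma model_coframeE z w : model_coframe z *m w = vec (thH z w) (eta z w).
Proof.
by rewrite mul_linmx // => c u v; rewrite thH_linear eta_linear vec_linear.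
Qed.

Let smooth_vec w : smooth_on O (fun z => vec (thH z w) (eta z w)).
Proof.
under eq_fun do rewrite vec_hincl; apply: smoothD => //.
  by apply: smooth_mulmx => //; exact: smooth_cst.
exact: smooth_scale_cst.
Qed.

Lemma model_coframe_smooth : smooth_on O model_coframe.
Proof.
apply: smooth_mxP => // k l; under eq_fun do rewrite mxE.
exact: smooth_entry.
Qed.

Let smooth_hblock w : smooth_on O (fun z => hblock (G z w)).
Proof.
under eq_fun do rewrite hblock_hincl.
by apply: smooth_mulmx; rewrite //; first apply: smooth_mulmx => //; exact: smooth_cst.
Qed.

Lemma derive_model_coframe z u v : O z -> 'D_u model_coframe z *m v
  = vec ('D_u (thH^~ v) z) ('D_u (eta^~ v) z).
Proof.
move=> Oz; have dc := smooth_differentiable model_coframe_smooth Oz.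
rewrite -(derive_mulmxl v u dc).
have -> : (fun y => model_coframe y *m v)
    = (fun y => hincl *m thH y v) + (fun y => eta y v *: e0).
  by apply/funext => y; rewrite model_coframeE vec_hincl.
have dt := smooth_differentiable (thH_smooth v) Oz.
have de := smooth_differentiable (eta_smooth v) Oz.
have dht : differentiable (fun y => hincl *m thH y v) z.
  by apply: differentiable_mulmx => //; exact: differentiable_cst.
have dee : differentiable (fun y => eta y v *: (e0 : V)) z.
  exact: differentiableZl.
rewrite deriveD; [|exact: diff_derivable..].
rewrite (derive_mulmxr _ u dt) vec_hincl; congr (_ + _).
by rewrite derive_scalemx // derive_cst scaler0 addr0.
Qed.

Lemma derive_hblock z u v : O z ->
  'D_u (fun y => hblock (G y v)) z = hblock ('D_u (G^~ v) z).
Proof.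
move=> Oz; have dG := smooth_differentiable (G_smooth v) Oz.
under eq_fun do rewrite hblock_hincl.
rewrite derive_mulmxl; last first.
  by apply: differentiable_mulmx => //; exact: differentiable_cst.
by rewrite (derive_mulmxr _ u dG) hblock_hincl.
Qed.

Lemma model_torsion z u v : O z ->
  'D_u model_coframe z *m v - 'D_v model_coframe z *m u
  = model_form z v *m (model_coframe z *m u)
    - model_form z u *m (model_coframe z *m v).
Proof.
move=> Oz; apply: etrans (congr2 (fun A C : V => A - C)
  (derive_model_coframe u v Oz) (derive_model_coframe v u Oz)) _.
rewrite /model_form !model_coframeE.
have vecB (X Y : H) (s t : R) : vec X s - vec Y t = vec (X - Y) (s - t).
  by rewrite addrC -scaleN1r -vec_linear scaleN1r mulN1r addrC [- t + s]addrC.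
rewrite vecB horizontal_torsion // vertical_torsion //.
rewrite !mulmxDl !hblock_vec [in RHS]opprD [RHS]addrACA vecB subr0.
have := lift_torsion a b alpha beta gamma delta (thH z u) (thH z v) (eta z u) (eta z v).
move=> /(congr1 -%R); rewrite opprB => ->.
by rewrite addrC vecB sub0r.
Qed.

(** By [curvature_split] the structure equations decouple into the equations for
    [thH], [eta] and [G] assumed above. *)
Lemma model_cartan :
  cartan_structure O R0 I0 model_coframe model_form.
Proof.
have mL z w : model_form z w = lam (model_coframe z *m w) + hblock (G z w) by [].
split => //.
- move=> z Oz c u v; rewrite /model_form mulmxDr -scalemxAr lift_linear G_linear.
  have -> : hblock (c *: G z u + G z v) = c *: hblock (G z u) + hblock (G z v).
    by rewrite /hblock scale_block_mx add_block_mx !scaler0 !addr0.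
  by rewrite scalerDr addrACA.
- move=> z Oz; apply: unitmx_ker0 => w; rewrite model_coframeE /vec -col_mx0.
  move=> /eq_col_mx[t0 /(congr1 (fun M : 'M[R]_1 => M 0 0))].
  rewrite !mxE eqxx mulr1n col_mx0 => ez; exact: (nondegenerate Oz t0 ez).
- exact: model_coframe_smooth.
- move=> w; apply: smoothD => //.
  have -> : (fun z => lam (model_coframe z *m w))
      = (fun z => \sum_k (model_coframe z *m w) k 0 *: lam (delta_mx k 0)).
    apply/funext => z; apply: linear_coords; exact: lift_linear.
  apply: smooth_sum => // k _; apply: smooth_scale_cst => //.
  apply: smooth_entry => //; apply: smooth_mulmx => //; last exact: smooth_cst.
  exact: model_coframe_smooth.
- by move=> z u v Oz; exact: model_torsion.
- move=> z u v Oz; have dc := smooth_differentiable model_coframe_smooth Oz.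
  have dG w : differentiable (fun y => hblock (G y w)) z.
    exact: smooth_differentiable (smooth_hblock w) Oz.
  have uG w : un0 (hblock (G z w)) by apply: hblock_un0; exact: G_un.
  have := @curvature_split R n a b alpha beta gamma delta _
    (fun y w => hblock (G y w)) z u v dc dG uG (model_torsion u v Oz).
  rewrite R0E => -> ; congr (_ + _).
  rewrite !derive_hblock // !model_coframeE !usubmx_vec -horizontal_curvature //.
  rewrite /lie_mx /hblock !mulmx_block !mul0mx !mulmx0 !addr0.
  by rewrite !opp_block_mx !add_block_mx !oppr0 !addr0.
- move=> z w Oz; rewrite (vecE (model_coframe z *m w)) I0nf.
  exists (hblock (G z w)); first by apply: hblock_un0; exact: G_un.
  by rewrite /model_form /torsion_lift.
Qed.

End Models.

(** * Derivatives of explicit formulas *)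

Section DerivativeRules.
Context {R : realType} {W : normedModType R}.
Implicit Types (z u : W) (f g : W -> R).

(** Differentiability and the value of one directional derivative, bundled so
    that derivatives of explicit formulas can be assembled rule by rule. *)
Definition has_derivative (X : normedModType R) (f : W -> X) z u (d : X) :=
  differentiable f z /\ 'D_u f z = d.

Lemma has_derivative_cst (X : normedModType R) (c : X) z u :
  has_derivative (fun=> c) z u 0.
Proof. by split; [exact: differentiable_cst|exact: derive_cst]. Qed.

Lemma has_derivativeD (X : normedModType R) (f g : W -> X) z u df dg :
  has_derivative f z u df -> has_derivative g z u dg ->
  has_derivative (fun y => f y + g y) z u (df + dg).
Proof.
move=> [f1 <-] [g1 <-]; split; first exact: differentiableD.
by apply: deriveD; exact: diff_derivable.
Qed.

Lemma has_derivativeN (X : normedModType R) (f : W -> X) z u df :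
  has_derivative f z u df -> has_derivative (fun y => - f y) z u (- df).
Proof.
move=> [f1 <-]; split; first exact: differentiableN.
by apply: deriveN; exact: diff_derivable.
Qed.

Lemma has_derivativeM f g z u df dg :
  has_derivative f z u df -> has_derivative g z u dg ->
  has_derivative (fun y => f y * g y) z u (df * g z + f z * dg).
Proof.
move=> [f1 <-] [g1 <-]; split; first exact: differentiableM.
rewrite addrC [_ * g z]mulrC.
by apply: deriveM; exact: diff_derivable.
Qed.

Lemma has_derivativeV f z u df : f z != 0 -> has_derivative f z u df ->
  has_derivative (fun y => (f y)^-1) z u (- ((f z)^-1 ^+ 2 * df)).
Proof.
move=> f0 [f1 <-]; split; first exact: differentiableV.
rewrite deriveV //; last exact: diff_derivable.
by rewrite scaleNr exprVn.
Qed.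

Lemma has_derivative_scale p q f (A : W -> 'M[R]_(p, q)) z u df dA :
  has_derivative f z u df -> has_derivative A z u dA ->
  has_derivative (fun y => f y *: A y) z u (df *: A z + f z *: dA).
Proof.
move=> [f1 <-] [A1 <-]; split; first exact: differentiable_scalemx.
exact: derive_scalemx.
Qed.

Lemma has_derivative_mulmx p q r (A : W -> 'M[R]_(p, q)) (B : W -> 'M[R]_(q, r))
    z u dA dB : has_derivative A z u dA -> has_derivative B z u dB ->
  has_derivative (fun y => A y *m B y) z u (dA *m B z + A z *m dB).
Proof.
move=> [A1 <-] [B1 <-]; split; first exact: differentiable_mulmx.
exact: derive_mulmx.
Qed.

Lemma has_derivative_mulmxl p q r (A : W -> 'M[R]_(p, q)) (B : 'M[R]_(q, r))
    z u dA : has_derivative A z u dA ->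
  has_derivative (fun y => A y *m B) z u (dA *m B).
Proof.
move=> hA; have := has_derivative_mulmx hA (has_derivative_cst B z u).
by rewrite mulmx0 addr0.
Qed.

Lemma has_derivative_mulmxr p q r (A : 'M[R]_(p, q)) (B : W -> 'M[R]_(q, r))
    z u dB : has_derivative B z u dB ->
  has_derivative (fun y => A *m B y) z u (A *m dB).
Proof.
move=> hB; have := has_derivative_mulmx (has_derivative_cst A z u) hB.
by rewrite mul0mx add0r.
Qed.

Lemma has_derivative_trmx p q (A : W -> 'M[R]_(p, q)) z u dA :
  has_derivative A z u dA -> has_derivative (fun y => (A y)^T) z u dA^T.
Proof.
move=> [A1 <-]; split; last exact: derive_trmx.
exact: differentiable_trmx.
Qed.

Lemma has_derivative_h0 n (X Y : W -> 'cV[R]_(n + n)) z u dX dY :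
  has_derivative X z u dX -> has_derivative Y z u dY ->
  has_derivative (fun y => h0 (X y) (Y y)) z u (h0 dX (Y z) + h0 (X z) dY).
Proof.
move=> hX hY; have := has_derivative_mulmx (has_derivative_trmx hX) hY.
move=> [d1 d2]; split; first exact: differentiable_entry.
by rewrite derive_entry // d2 mxE.
Qed.

End DerivativeRules.

Section ModelCoordinates.
Context {R : realType} {n : nat}.
Local Notation V := ('cV[R]_(n + n + 1)).

Lemma has_derivative_linear m (A : 'M[R]_(m, n + n + 1)) (z u : V) :
  has_derivative (fun y => A *m y) z u (A *m u).
Proof.
by apply: has_derivative_mulmxr; split; [exact: ex_diff|exact: derive_id].
Qed.

Lemma smooth_mulmx_id m (A : 'M[R]_(m, n + n + 1)) (U : set V) : open U ->
  smooth_on U (fun y : V => A *m y).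
Proof.
move=> oU; apply: smooth_mulmx => //; first exact: smooth_cst.
by apply: (smooth_linear (L := idfun) oU) => z; exact: cvg_id.
Qed.

Lemma usubmxM (z : V) : usubmx z = row_mx 1%:M 0 *m z.
Proof. by rewrite -[z in RHS]vsubmxK mul_row_col mul1mx mul0mx addr0. Qed.

Lemma dsubmxM (z : V) : dsubmx z = row_mx 0 1%:M *m z.
Proof. by rewrite -[z in RHS]vsubmxK mul_row_col mul1mx mul0mx add0r. Qed.

Lemma has_derivative_usubmx (z u : V) :
  has_derivative (fun y : V => usubmx y) z u (usubmx u).
Proof.
under eq_fun do rewrite usubmxM; rewrite usubmxM; exact: has_derivative_linear.
Qed.

Lemma has_derivative_last (z u : V) :
  has_derivative (fun y : V => dsubmx y 0 0) z u (dsubmx u 0 0).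
Proof.
under eq_fun do rewrite dsubmxM; rewrite dsubmxM.
have [d1 d2] := has_derivative_linear (row_mx 0 1%:M : 'M[R]_(1, n + n + 1)) z u.
by split; [exact: differentiable_entry|rewrite derive_entry // d2].
Qed.

Lemma smooth_usubmx (U : set V) : open U -> smooth_on U (fun y : V => usubmx y).
Proof. by move=> oU; under eq_fun do rewrite usubmxM; exact: smooth_mulmx_id. Qed.

Lemma smooth_last (U : set V) : open U -> smooth_on U (fun y : V => dsubmx y 0 0).
Proof.
move=> oU; under eq_fun do rewrite dsubmxM.
by apply: smooth_entry => //; exact: smooth_mulmx_id.
Qed.

Lemma smooth_h0 (U : set V) (X Y : V -> 'cV[R]_(n + n)) : open U ->
  smooth_on U X -> smooth_on U Y -> smooth_on U (fun z => h0 (X z) (Y z)).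
Proof.
move=> oU sX sY; apply: smooth_entry => //; apply: smooth_mulmx => //.
exact: smooth_trmx.
Qed.

(** Sublevel sets of smooth functions are open; this makes the domains of the
    models open. *)
Lemma open_positive (f : V -> R) : smooth_on setT f -> open [set z | 0 < f z].
Proof.
move=> sf; have cf : continuous f by move=> z; exact: (sf 0).
rewrite (_ : [set z | 0 < f z] = f @^-1` [set r | 0 < r]) //.
by apply: open_comp; [move=> z _; exact: cf|exact: open_gt].
Qed.

End ModelCoordinates.

(** * The model with two scaling rates *)

Section CurvatureNormalForm.
Context {R : realType} {n : nat} (a b alpha beta gamma delta : R).
Local Notation H := ('cV[R]_(n + n)).
Local Notation V := ('cV[R]_(n + n + 1)).
Local Notation gl := ('M[R]_(n + n + 1)).

(** When the coefficients are the forced ones, only the curvature of the form with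
    values in the Lie algebra remains to be realised. *)
Lemma curvature_nf_base (R0 : V -> V -> gl) (c0 c1 c2 c3 c4 : R)
    (B Om : H -> H -> 'M[R]_(n + n)) :
  alternating_bilinear R0 -> curvature_nf R0 c0 c1 c2 c3 c4 B ->
  c1 = - alpha ^+ 2 + b * alpha + beta ^+ 2 -> c2 = beta * (b - 2 * alpha) ->
  c3 = (2 * a - alpha - b) * gamma + beta * delta ->
  c4 = (2 * a - alpha - b) * delta - beta * gamma ->
  c0 = 2 * (delta * alpha - gamma * beta - delta * b) ->
  (forall X Y (Z : H), B X Y *m Z = base_HH a alpha beta gamma delta X Y *m Z
                              + Om X Y *m Z) ->
  forall u v, R0 u v = base_curv a b alpha beta gamma delta u v
                       + hblock (Om (usubmx u) (usubmx v)).
Proof.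
move=> R0alt [RHe RHH] e1 e2 e3 e4 e5 eB u v.
have ebase := @base_curv_alt R n a b alpha beta gamma delta.
rewrite (vecE u) (vecE v) (alt_vec _ _ _ _ R0alt) (alt_vec _ _ _ _ ebase).
rewrite !usubmx_vec !RHe RHH base_curv_HH !base_curv_He -e1 -e2 -e3 -e4 -e5.
have -> : B (usubmx u) (usubmx v) = base_HH a alpha beta gamma delta (usubmx u)
    (usubmx v) + Om (usubmx u) (usubmx v).
  by apply: linmx_ext => Z; rewrite mulmxDl eB.
rewrite [RHS]addrAC [X in _ = X - _]addrAC; congr (_ + _ - _).
by rewrite /hblock add_block_mx !addr0.
Qed.

End CurvatureNormalForm.

Section NonKahlerModel.
Context {R : realType} {n : nat} (a b alpha beta gamma : R).
Local Notation H := ('cV[R]_(n + n)).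
Local Notation V := ('cV[R]_(n + n + 1)).
Local Notation J := (@J0 R n).
Local Notation tau z := (dsubmx z 0 0 : R).
Local Notation c := (a - alpha).

Let D (z : V) : R := 1 + c * tau z.
Let O : set V := [set z | 0 < D z].
Let thH (z w : V) : H := (D z)^-1 *: usubmx w.
Let eta (z w : V) : R := (D z)^-1 * tau w.
Let G (z w : V) : 'M[R]_(n + n) := (beta * eta z w) *: J.

Let smooth_D U : open U -> smooth_on U D.
Proof.
move=> oU; apply: smoothD => //; first exact: smooth_cst.
by apply: smoothM => //; [exact: smooth_cst|exact: smooth_last].
Qed.

Let oO : open O.
Proof. by apply: open_positive; apply: smooth_D; exact: openT. Qed.

Let smooth_DV : smooth_on O (fun z => (D z)^-1).
Proof. by apply: smoothV => // [z /lt0r_neq0|]; last exact: smooth_D. Qed.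

Let dDV z u : O z ->
  has_derivative (fun y => (D y)^-1) z u (- ((D z)^-1 ^+ 2 * (c * tau u))).
Proof.
move=> Oz; apply: has_derivativeV; first exact: lt0r_neq0.
have hl := has_derivativeM (has_derivative_cst c z u) (has_derivative_last z u).
have := has_derivativeD (has_derivative_cst (1 : R) z u) hl.
by rewrite mul0r !add0r.
Qed.

(** Both coframes are the standard ones divided by an affine function of the
    vertical coordinate; its slope is the difference of the scaling rates [a] and
    [alpha]. The vertical coframe is closed, so the rotation [beta * eta] of the
    horizontal planes adds no curvature. *)
Lemma nonkahler_model_cartan I0 R0 :
  inner_torsion_nf I0 a b alpha beta gamma 0 ->
  (forall u v, R0 u v = base_curv a b alpha beta gamma 0 u v) ->
  exists (O : set V) th om, O 0 /\ cartan_structure O R0 I0 th om.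
Proof.
move=> I0nf R0E; exists O, (model_coframe thH eta),
  (model_form a b alpha beta gamma 0 thH eta G); split.
  by rewrite /O /D /= !mxE mulr0 addr0 ltr01.
have deta z u v : O z -> 'D_u (eta^~ v) z = - ((D z)^-1 ^+ 2 * (c * tau u)) * tau v.
  move=> Oz; have [_ ->] := has_derivativeM (dDV u Oz) (has_derivative_cst (tau v) z u).
  by rewrite mulr0 addr0.
have sG w : smooth_on O (fun z => eta z w).
  by apply: smoothM => //; exact: smooth_cst.
apply: (@model_cartan R n I0 a b alpha beta gamma 0 R0 I0nf O (fun _ _ => 0)) => //.
- by move=> u v; rewrite R0E /hblock block_mx0 addr0.
- by move=> z e u v; rewrite /thH linearP scalerDr !scalerA mulrC.
- by move=> z e u v; rewrite /eta !mxE; ring.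
- move=> z e u v; rewrite /G /eta; apply/matrixP => i j; rewrite !mxE; ring.
- move=> z w Oz; have D0 : (D z)^-1 != 0 by rewrite invr_eq0 lt0r_neq0.
  rewrite /thH /eta => /eqP; rewrite scaler_eq0 (negbTE D0) => /eqP w0.
  move=> /eqP; rewrite mulf_eq0 (negbTE D0) => /eqP w1.
  by rewrite (vecE w) w0 w1 /vec raddf0 col_mx0.
- by move=> w; apply: smooth_scale_cst.
- by move=> w; apply: smooth_scale_cst => //; apply: smoothM => //; exact: smooth_cst.
- move=> z w Oz; rewrite /G; split; first by rewrite linearZ /= J0_tr scalerN.
  by rewrite -scalemxAl -scalemxAr.
- move=> z u v Oz.
  have dth e f : 'D_e (thH^~ f) z = - ((D z)^-1 ^+ 2 * (c * tau e)) *: usubmx f.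
    have [_ ->] := has_derivative_scale (dDV e Oz) (has_derivative_cst (usubmx f) z e).
    by rewrite scaler0 addr0.
  rewrite !dth /G /thH /eta -!scalemxAl -!scalemxAr mulmxBr -!scalemxAr.
  move: (J *m usubmx u) (J *m usubmx v) => Ju Jv.
  by apply/matrixP => i j; rewrite !mxE; ring.
- by move=> z u v Oz; rewrite !deta //; ring.
- move=> z u v Oz.
  have dG e f : 'D_e (G^~ f) z = (beta * 'D_e (eta^~ f) z) *: J.
    have he : has_derivative (eta^~ f) z e ('D_e (eta^~ f) z).
      by split => //; exact: smooth_differentiable (sG f) Oz.
    have [_ ->] := has_derivative_scale
      (has_derivativeM (has_derivative_cst beta z e) he) (has_derivative_cst J z e).
    by rewrite mul0r add0r scaler0 addr0.
  rewrite !dG !deta // /G /lie_mx -!scalemxAl -!scalemxAr.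
  by apply/matrixP => i j; rewrite !mxE; ring.
Qed.

End NonKahlerModel.

(** * The model over a complex space form *)

Section KahlerModelAlgebra.
Context {R : realType} {n : nat}.
Local Notation H := ('cV[R]_(n + n)).
Local Notation gl := ('M[R]_(n + n)).
Local Notation J := (@J0 R n).

(** Twice the projection of the elementary skew map [X *m Y^T - Y *m X^T] to the
    complex linear ones. *)
Definition unitary_wedge (X Y : H) : gl :=
  X *m Y^T + J *m X *m (J *m Y)^T - Y *m X^T - J *m Y *m (J *m X)^T.

(** On the diagonal, the skew Hermitian operator which is [J] times the squared
    length on the complex line of [X] and 0 on its orthogonal complement. *)
Definition complex_square (X Y : H) : gl :=
  J *m X *m Y^T - Y *m (J *m X)^T.

Lemma trmx_mulJ (Z : H) : Z^T *m J = - (J *m Z)^T.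
Proof. by rewrite trmx_mul J0_tr mulmxN opprK. Qed.

Lemma unitary_wedge_un (X Y : H) : un (unitary_wedge X Y).
Proof.
have JT := trmx_mulJ; split.
  rewrite /unitary_wedge; move: (J *m X) (J *m Y) => JX JY.
  by apply/matrixP => i j; rewrite !mxE !big_ord1 !mxE; ring.
rewrite /unitary_wedge !(mulmxBl, mulmxBr, mulmxDl, mulmxDr, mulNmx, mulmxN).
rewrite -!(mulmxA _ _ J) !JT !mulmxA J0_sqr !mulNmx !mul1mx.
have JN (A : H) : (- A)^T = - A^T by rewrite linearN.
rewrite !JN !mulmxN; move: (J *m X) (J *m Y) => JX JY.
by apply/matrixP => i j; rewrite !mxE !big_ord1 !mxE; ring.
Qed.

Lemma complex_square_un (X : H) : un (complex_square X X).
Proof.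
have JT := trmx_mulJ; split; rewrite /complex_square.
  move: (J *m X) => JX.
  by apply/matrixP => i j; rewrite !mxE !big_ord1 !mxE; ring.
rewrite !(mulmxDl, mulmxDr, mulNmx, mulmxN).
rewrite -!(mulmxA _ _ J) !JT !mulmxA J0_sqr !mulNmx !mul1mx.
have JN (A : H) : (- A)^T = - A^T by rewrite linearN.
rewrite !JN !mulmxN; move: (J *m X) => JX.
by apply/matrixP => i j; rewrite !mxE !big_ord1 !mxE; ring.
Qed.

Lemma un_lin (c : R) (A B : gl) : un A -> un B -> un (c *: A + B).
Proof.
move=> [At AJ] [Bt BJ]; split; last first.
  by rewrite mulmxDl mulmxDr -scalemxAl -scalemxAr AJ BJ.
by rewrite linearD linearZ /= At Bt scalerN opprD.
Qed.

Lemma J0_un : un J.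
Proof. by split; [exact: J0_tr|]. Qed.

Context (k h : R) (x : H).
(** A unitary coframe of the complex space form of holomorphic sectional curvature
    [16 * k], for either sign of [k], and its Levi-Civita connection form. Here
    [x] is the position and [h] stands for [(1 + k * h0 x x)^-1]. The radial
    coordinate is chosen so that everything is rational: for [k] positive the
    point [x] lies at distance [atan (sqrt k * |x|) / sqrt k] from the origin. The
    names starting with [fubini_d] are the derivatives in the direction [u]. *)
Definition fubini_dh (u : H) : R := - (h ^+ 2 * (2 * k * h0 x u)).
Definition fubini_phase (w : H) : R := 2 * k * (h * omega0 x w).
Definition fubini_dphase (u w : H) : R :=
  2 * k * (fubini_dh u * omega0 x w + h * omega0 u w).
Definition fubini_coframe (w : H) : H :=
  h *: (w - fubini_phase w *: (J *m x)).
Definition fubini_dcoframe (u w : H) : H :=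
  fubini_dh u *: (w - fubini_phase w *: (J *m x))
  - h *: (fubini_dphase u w *: (J *m x) + fubini_phase w *: (J *m u)).
Definition fubini_form (w : H) : gl :=
  (2 * k * h) *: (unitary_wedge x w + fubini_phase w *: complex_square x x)
  - (2 * h * fubini_phase w) *: J.
Definition fubini_dform (u w : H) : gl :=
  (2 * k * fubini_dh u) *: (unitary_wedge x w + fubini_phase w *: complex_square x x)
  + (2 * k * h) *: (unitary_wedge u w + fubini_dphase u w *: complex_square x x
      + fubini_phase w *: (complex_square x u + complex_square u x))
  - (2 * (fubini_dh u * fubini_phase w + h * fubini_dphase u w)) *: J.

Local Notation dh := fubini_dh.
Local Notation q := fubini_phase.
Local Notation dq := fubini_dphase.
Local Notation th := fubini_coframe.
Local Notation dth := fubini_dcoframe.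
Local Notation G := fubini_form.
Local Notation dG := fubini_dform.

Lemma fubini_phase_linear c u v : q (c *: u + v) = c * q u + q v.
Proof. by rewrite /fubini_phase omega0Dr omega0Zr; ring. Qed.

Lemma fubini_coframe_linear : linear th.
Proof.
move=> c u v; rewrite /fubini_coframe fubini_phase_linear.
by move: (J *m x) => Jx; apply/matrixP => i j; rewrite !mxE; ring.
Qed.

Lemma fubini_form_linear : linear G.
Proof.
move=> c u v; rewrite /fubini_form fubini_phase_linear /unitary_wedge.
have -> : J *m (c *: u + v) = c *: (J *m u) + J *m v.
  by rewrite mulmxDr -scalemxAr.
move: (J : gl) (complex_square x x) (J *m x) (J *m u) (J *m v) => I S Jx Ju Jv.
by apply/matrixP => i j; rewrite !mxE !big_ord1 !mxE; ring.
Qed.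

Lemma fubini_form_un w : un (G w).
Proof.
have un00 : un (0 : gl) by split; rewrite ?trmx0 ?oppr0 // mul0mx mulmx0.
rewrite /fubini_form -scaleNr; apply: un_lin.
  rewrite addrC; apply: un_lin; first exact: complex_square_un.
  exact: unitary_wedge_un.
by rewrite -[_ *: _]addr0; apply: un_lin => //; exact: J0_un.
Qed.

Hypothesis hD : h * (1 + k * h0 x x) = 1.

Let D0 : 1 + k * h0 x x != 0.
Proof. by apply: contra_eq_neq hD => ->; rewrite mulr0 eq_sym oner_eq0. Qed.

Let hE : h = (1 + k * h0 x x)^-1.
Proof. by rewrite -[LHS](mulfK D0) hD mul1r. Qed.

Let GE (w Y : H) : G w *m Y = (2 * k * h) *: (h0 w Y *: x + omega0 w Y *: (J *m x)
  - h0 x Y *: w - omega0 x Y *: (J *m w)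
  + q w *: (h0 x Y *: (J *m x) - omega0 x Y *: x)) - (2 * h * q w) *: (J *m Y).
Proof.
rewrite mulmxBl -!scalemxAl mulmxDl -scalemxAl /unitary_wedge /complex_square.
by rewrite 3!mulmxBl mulmxDl !outer_mul.
Qed.

Lemma fubini_torsion (u v : H) : dth u v - dth v u = G v *m th u - G u *m th v.
Proof.
rewrite !GE /fubini_dcoframe /fubini_coframe.
rewrite -!scalemxAr !mulmxBr -!scalemxAr !J0K.
rewrite /fubini_phase /fubini_dphase /fubini_dh /omega0.
rewrite !(h0Dr, h0Zr, h0Nr, h0J, h0_Jr, h0_Jxx) (h0C u x) (h0C v x) (h0C v u).
rewrite (h0_JC u v) (h0_JC x u) (h0_JC x v).
move: D0; rewrite hE.
move: (h0 x x) (h0 x u) (h0 x v) (h0 u v) => N p p' g.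
move: (h0 (J *m x) u) (h0 (J *m x) v) (h0 (J *m u) v) => r r' w DN.
move: (J *m x) (J *m u) (J *m v) => Jx Ju Jv.
apply/matrixP => i j; rewrite !mxE.
move: (x i j) (Jx i j) (u i j) (v i j) (Ju i j) (Jv i j) => *.
by field.
Qed.

Let dGE (u w Y : H) : dG u w *m Y = (2 * k * dh u) *: (h0 w Y *: x
    + omega0 w Y *: (J *m x) - h0 x Y *: w - omega0 x Y *: (J *m w)
    + q w *: (h0 x Y *: (J *m x) - omega0 x Y *: x))
  + (2 * k * h) *: (h0 w Y *: u + omega0 w Y *: (J *m u)
      - h0 u Y *: w - omega0 u Y *: (J *m w)
      + dq u w *: (h0 x Y *: (J *m x) - omega0 x Y *: x)
      + q w *: (h0 u Y *: (J *m x) - omega0 x Y *: u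
                + (h0 x Y *: (J *m u) - omega0 u Y *: x)))
  - (2 * (dh u * q w + h * dq u w)) *: (J *m Y).
Proof.
rewrite mulmxBl -!scalemxAl; congr (_ - _).
rewrite mulmxDl -!scalemxAl /unitary_wedge /complex_square.
congr (_ *: _ + _ *: _).
  by rewrite mulmxDl -scalemxAl 3!mulmxBl mulmxDl !outer_mul.
by rewrite 2!mulmxDl -!scalemxAl !(mulmxDl, mulNmx) !outer_mul.
Qed.

Lemma fubini_curvature (u v : H) :
  dG u v - dG v u + lie_mx (G u) (G v) = (16 * k) *: kahler_op (th u) (th v).
Proof.
apply: linmx_ext => Y.
have dist (A B C D : gl) : (A - B + lie_mx C D) *m Y
    = A *m Y - B *m Y + (C *m (D *m Y) - D *m (C *m Y)).
  by rewrite /lie_mx mulmxDl !mulmxBl !mulmxA.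
rewrite dist -scalemxAl kahler_op_mul /Kop.
rewrite !dGE !GE /fubini_coframe.
have JD (A B : H) : J *m (A + B) = J *m A + J *m B by exact: mulmxDr.
have JN (A : H) : J *m (- A) = - (J *m A) by exact: mulmxN.
have JZ c (A : H) : J *m (c *: A) = c *: (J *m A) by rewrite -scalemxAr.
rewrite !(JD, JN, JZ, J0K).
rewrite /fubini_phase /fubini_dphase /fubini_dh /omega0 !(JD, JN, JZ, J0K).
rewrite !(h0Dl, h0Zl, h0Nl, h0Dr, h0Zr, h0Nr).
rewrite !(h0J, h0_Jr, h0_Jxx) (h0C u x) (h0C v x) (h0C v u).
rewrite (h0_JC u v) (h0_JC x u) (h0_JC x v).
move: D0; rewrite hE.
move: (h0 x x) (h0 x u) (h0 x v) (h0 u v) => N p p' g.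
move: (h0 (J *m x) u) (h0 (J *m x) v) (h0 (J *m u) v) => r r' w DN.
move: (h0 x Y) (h0 u Y) (h0 v Y) => Yx Yu Yv.
move: (h0 (J *m x) Y) (h0 (J *m u) Y) (h0 (J *m v) Y) => Zx Zu Zv.
move: (J *m x) (J *m u) (J *m v) (J *m Y) => Jx Ju Jv JY.
apply/matrixP => i j; rewrite !mxE.
move: (x i j) (Jx i j) (u i j) (v i j) (Ju i j) (Jv i j) (Y i j) (JY i j) => *.
by field.
Qed.

(** The form [h ^+ 2 * omega0 x _] is a primitive of the Kaehler form, up to a
    factor. *)
Lemma fubini_potential (u v : H) :
  dh u * (h * omega0 x v) + h * (dh u * omega0 x v + h * omega0 u v)
  - (dh v * (h * omega0 x u) + h * (dh v * omega0 x u + h * omega0 v u))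
  = 2 * omega0 (th u) (th v).
Proof.
rewrite /fubini_coframe /fubini_dh /fubini_phase /omega0.
have JD (A B : H) : J *m (A + B) = J *m A + J *m B by exact: mulmxDr.
have JN (A : H) : J *m (- A) = - (J *m A) by exact: mulmxN.
have JZ c (A : H) : J *m (c *: A) = c *: (J *m A) by rewrite -scalemxAr.
rewrite !(JD, JN, JZ, J0K) !(h0Dl, h0Zl, h0Nl, h0Dr, h0Zr, h0Nr).
rewrite !(h0J, h0_Jr, h0_Jxx) (h0C u x) (h0_JC u v).
by move: D0; rewrite hE; move: (h0 x x) (h0 x u) (h0 x v) => *; field.
Qed.

End KahlerModelAlgebra.

Section KahlerModel.
Context {R : realType} {n : nat} (a b beta gamma delta k : R).
Local Notation H := ('cV[R]_(n + n)).
Local Notation V := ('cV[R]_(n + n + 1)).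
Local Notation J := (@J0 R n).
Local Notation x z := (usubmx z : H).
Local Notation tau z := (dsubmx z 0 0 : R).

Let N (z : V) : R := h0 (x z) (x z).
(* The coframe degenerates where [1 - k * N z] vanishes; for positive [k] this is
   the cut locus of the origin. *)
Let O : set V := [set z | 0 < 1 + k * N z] `&` [set z | 0 < 1 - k * N z].
Let h (z : V) : R := (1 + k * N z)^-1.
Let thH (z w : V) : H := fubini_coframe k (h z) (x z) (x w).
Let eta (z w : V) : R := tau w - delta * (h z * (h z * omega0 (x z) (x w))).
Let GN (z w : V) : 'M[R]_(n + n) := fubini_form k (h z) (x z) (x w).
Let G (z w : V) : 'M[R]_(n + n) := GN z w + (beta * eta z w) *: J.

Let smooth_x U : open U -> smooth_on U (fun z : V => x z).
Proof. exact: smooth_usubmx. Qed.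

Let smooth_Jx U : open U -> smooth_on U (fun z : V => J *m x z).
Proof. by move=> oU; apply: smooth_mulmx => //; [exact: smooth_cst|exact: smooth_x]. Qed.

Let smooth_N U : open U -> smooth_on U N.
Proof. by move=> oU; apply: smooth_h0 => //; exact: smooth_x. Qed.

Let oO : open O.
Proof.
have pos c : open [set z | 0 < 1 + c * N z].
  apply: open_positive; apply: smoothD; [exact: openT|exact: smooth_cst|].
  by apply: smoothM; [exact: openT|exact: smooth_cst|apply: smooth_N; exact: openT].
apply: openI; first exact: pos.
by have := pos (- k); under eq_set do rewrite mulNr.
Qed.

Let D0 z : O z -> 1 + k * N z != 0.
Proof. by move=> [/lt0r_neq0]. Qed.

Let hD z : O z -> h z * (1 + k * N z) = 1.
Proof. by move=> Oz; rewrite /h mulVf // D0. Qed.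

Let smooth_h : smooth_on O h.
Proof.
apply: smoothV => //; apply: smoothD => //; first exact: smooth_cst.
by apply: smoothM => //; [exact: smooth_cst|exact: smooth_N].
Qed.

Let smooth_om (w : V) : smooth_on O (fun z => omega0 (x z) (x w)).
Proof. by apply: smooth_h0 => //; [exact: smooth_Jx|exact: smooth_cst]. Qed.

Let smooth_phase (w : V) : smooth_on O (fun z => fubini_phase k (h z) (x z) (x w)).
Proof.
by apply: smoothM => //; [exact: smooth_cst|apply: smoothM => //].
Qed.

Let smooth_th w : smooth_on O (thH^~ w).
Proof.
apply: smooth_scalemx => //; apply: smoothD => //; first exact: smooth_cst.
under eq_fun do rewrite -scaleNr -mulN1r.
apply: smooth_scalemx => //; last exact: smooth_Jx.
by apply: smoothM => //; exact: smooth_cst.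
Qed.

Let smooth_eta w : smooth_on O (eta^~ w).
Proof.
apply: smoothD => //; first exact: smooth_cst.
under eq_fun do rewrite -mulNr.
apply: smoothM => //; first exact: smooth_cst.
by do 2 (apply: smoothM => //).
Qed.

Let smooth_outer (X Y : V -> H) : smooth_on O X -> smooth_on O Y ->
  smooth_on O (fun z => X z *m (Y z)^T).
Proof.
move=> sX sY; apply: smooth_mulmx => //.
exact: smooth_trmx.
Qed.

Let smoothB (X Y : V -> 'M[R]_(n + n)) : smooth_on O X -> smooth_on O Y ->
  smooth_on O (fun z => X z - Y z).
Proof.
move=> sX sY; apply: smoothD => //; under eq_fun do rewrite -scaleN1r.
by apply: smooth_scalemx => //; exact: smooth_cst.
Qed.

Let smooth_GN w : smooth_on O (GN^~ w).
Proof.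
have sx := smooth_x oO; have sJ := smooth_Jx oO.
have cst (c : R) : smooth_on O (fun=> c) by exact: smooth_cst.
have cv (X : H) : smooth_on O (fun=> X) by exact: smooth_cst.
apply: smoothB; apply: smooth_scalemx => //.
- by do 2 (apply: smoothM => //).
- apply: smoothD => //; last first.
    by apply: smooth_scalemx => //; apply: smoothB; exact: smooth_outer.
  do 2 (apply: smoothB; last exact: smooth_outer).
  by apply: smoothD => //; exact: smooth_outer.
- by do 2 (apply: smoothM => //).
- exact: smooth_cst.
Qed.

Let dx (z u : V) : has_derivative (fun y : V => x y) z u (x u).
Proof. exact: has_derivative_usubmx. Qed.

Let dh (z u : V) : O z -> has_derivative h z u (fubini_dh k (h z) (x z) (x u)).
Proof.
move=> Oz; have dN := has_derivativeM (has_derivative_cst k z u)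
  (has_derivative_h0 (dx z u) (dx z u)).
have dD := has_derivativeD (has_derivative_cst (1 : R) z u) dN.
have := has_derivativeV (f := fun y => 1 + k * N y) (D0 Oz) dD.
rewrite (_ : - _ = fubini_dh k (h z) (x z) (x u)) //.
by rewrite /fubini_dh (h0C (x u)) /h; ring.
Qed.

Let dom (z u : V) (w : V) :
  has_derivative (fun y => omega0 (x y) (x w)) z u (omega0 (x u) (x w)).
Proof.
have := has_derivative_h0 (has_derivative_mulmxr J (dx z u))
  (has_derivative_cst (x w) z u).
by rewrite (h0C _ 0) h00l addr0.
Qed.

Let dhom (z u w : V) : O z -> has_derivative (fun y => h y * omega0 (x y) (x w)) z u
  (fubini_dh k (h z) (x z) (x u) * omega0 (x z) (x w) + h z * omega0 (x u) (x w)).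
Proof. by move=> Oz; exact: has_derivativeM (dh u Oz) (dom z u w). Qed.

Let dphase (z u w : V) : O z ->
  has_derivative (fun y => fubini_phase k (h y) (x y) (x w)) z u
    (fubini_dphase k (h z) (x z) (x u) (x w)).
Proof.
move=> Oz.
have := has_derivativeM (has_derivative_cst (2 * k) z u) (dhom u w Oz).
by rewrite mul0r add0r.
Qed.

Let dth (z u w : V) : O z ->
  'D_u (thH^~ w) z = fubini_dcoframe k (h z) (x z) (x u) (x w).
Proof.
move=> Oz; have [_ ->] := has_derivative_scale (dh u Oz) (has_derivativeD
  (has_derivative_cst (x w) z u) (has_derivativeN (has_derivative_scale
    (dphase u w Oz) (has_derivative_mulmxr J (dx z u))))).
by rewrite add0r scalerN.
Qed.

Let deta (z u w : V) : O z -> has_derivative (eta^~ w) z u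
  (- (delta * (fubini_dh k (h z) (x z) (x u) * (h z * omega0 (x z) (x w))
     + h z * (fubini_dh k (h z) (x z) (x u) * omega0 (x z) (x w)
              + h z * omega0 (x u) (x w))))).
Proof.
move=> Oz; have := has_derivativeD (has_derivative_cst (tau w) z u)
  (has_derivativeN (has_derivativeM (has_derivative_cst delta z u)
    (has_derivativeM (dh u Oz) (dhom u w Oz)))).
by rewrite mul0r !add0r.
Qed.

Let dGN (z u w : V) : O z ->
  has_derivative (GN^~ w) z u (fubini_dform k (h z) (x z) (x u) (x w)).
Proof.
move=> Oz; have dJx := has_derivative_mulmxr J (dx z u).
have W1 := has_derivativeD (has_derivative_mulmxl (x w)^T (dx z u))
  (has_derivative_mulmxl (J *m x w)^T dJx).
have W2 := has_derivativeD W1 (has_derivativeN (has_derivative_mulmxr (x w)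
  (has_derivative_trmx (dx z u)))).
have W3 := has_derivativeD W2 (has_derivativeN (has_derivative_mulmxr (J *m x w)
  (has_derivative_trmx dJx))).
have S := has_derivativeD (has_derivative_mulmx dJx (has_derivative_trmx (dx z u)))
  (has_derivativeN (has_derivative_mulmx (dx z u) (has_derivative_trmx dJx))).
have h1 := has_derivativeM (has_derivative_cst (2 * k) z u) (dh u Oz).
have h2 := has_derivativeM (has_derivativeM (has_derivative_cst (2 : R) z u) (dh u Oz))
  (dphase u w Oz).
have := has_derivativeD (has_derivative_scale h1
  (has_derivativeD W3 (has_derivative_scale (dphase u w Oz) S)))
  (has_derivativeN (has_derivative_scale h2 (has_derivative_cst J z u))).
rewrite (_ : _ + - _ = fubini_dform k (h z) (x z) (x u) (x w)) //.
rewrite /fubini_dform /unitary_wedge /complex_square.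
rewrite scaler0 !mul0r !add0r addr0.
move: (fubini_dphase _ _ _ _ _) (fubini_dh _ _ _ _) (fubini_phase _ _ _ _) => p1 p2 p3.
move: (J : 'M[R]_(n + n)) (x z) (x u) (x w) (J *m x z) (J *m x u) (J *m x w).
move=> I X U W JX JU JW.
by apply/matrixP => i j; rewrite !mxE !big_ord1 !mxE; ring.
Qed.

Let deta_antisym z (u v : V) : O z -> 'D_u (eta^~ v) z - 'D_v (eta^~ u) z
  = - (2 * delta * omega0 (thH z u) (thH z v)).
Proof.
move=> Oz; have [_ ->] := deta u v Oz; have [_ ->] := deta v u Oz.
rewrite [2 * delta]mulrC -mulrA /thH.
rewrite -(fubini_potential (hD Oz) (x u) (x v)); ring.
Qed.

(** The product of a complex space form with a line. The vertical coframe is the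
    coordinate of the line minus [delta] times a potential of the Kaehler form,
    which produces the twist required by the lift; turning the horizontal planes
    with speed [beta * eta] absorbs [beta] and contributes the curvature
    [- 2 * beta * delta * omega0 X Y] along [J]. *)
Lemma kahler_model_cartan I0 R0 :
  inner_torsion_nf I0 a b a beta gamma delta ->
  (forall u v, R0 u v = base_curv a b a beta gamma delta u v
     + hblock ((16 * k) *: kahler_op (usubmx u) (usubmx v)
               - (2 * beta * delta * omega0 (usubmx u) (usubmx v)) *: J)) ->
  exists (O : set V) th om, O 0 /\ cartan_structure O R0 I0 th om.
Proof.
move=> I0nf R0E; exists O, (model_coframe thH eta),
  (model_form a b a beta gamma delta thH eta G); split.
  have N0 : N 0 = 0 by rewrite /N (_ : x (0 : V) = 0) ?h00l // linear0.
  by split; rewrite /= N0 mulr0 ?subr0 ?addr0 ltr01.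
apply: (@model_cartan R n I0 a b a beta gamma delta R0 I0nf O (fun X Y : H =>
  (16 * k) *: kahler_op X Y - (2 * beta * delta * omega0 X Y) *: J)) => //.
- by move=> z c u v; rewrite /thH linearP; exact: fubini_coframe_linear.
- by move=> z c u v; rewrite /eta !linearP /= omega0Dr omega0Zr !mxE; ring.
- move=> z c u v; rewrite /G /GN linearP fubini_form_linear.
  have -> : eta z (c *: u + v) = c * eta z u + eta z v.
    by rewrite /eta !linearP /= omega0Dr omega0Zr !mxE; ring.
  move: (fubini_form _ _ _ _) (fubini_form _ _ _ _) => A A'.
  by apply/matrixP => i j; rewrite !mxE; ring.
- move=> z w Oz; rewrite /thH /eta /fubini_coframe => /eqP.
  have h1 := hD Oz; have hz : h z != 0.
    by apply: contra_eq_neq h1 => ->; rewrite mul0r eq_sym oner_eq0.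
  rewrite scaler_eq0 (negbTE hz) orFb subr_eq0 => /eqP xw.
  (* Pairing with the complex multiple of the position kills the phase, because
     the factor 1 - k |x|^2 is positive on the domain. *)
  have om0 : omega0 (x z) (x w) = 0.
    have /eqP := congr1 (omega0 (x z)) xw; rewrite omega0Zr /fubini_phase.
    rewrite [omega0 (x z) (J *m x z)]h0J -/(N z) -subr_eq0.
    have -> : omega0 (x z) (x w) - 2 * k * (h z * omega0 (x z) (x w)) * N z
        = omega0 (x z) (x w) * (h z * (1 - k * N z)).
      rewrite -[X in X - _]mulr1 -[X in _ * X - _]h1; ring.
    rewrite mulf_eq0 mulf_eq0 (negbTE hz) orFb => /orP[/eqP //|].
    by case: Oz => _ /lt0r_neq0/negbTE ->.
  rewrite om0 !mulr0 subr0 => tw.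
  rewrite (vecE w) tw xw /fubini_phase om0 !mulr0 scale0r /vec.
  by rewrite raddf0 col_mx0.
- move=> w; apply: smoothD => //.
  apply: smooth_scalemx => //; last exact: smooth_cst.
  by apply: smoothM => //; exact: smooth_cst.
- move=> z w Oz; rewrite /G addrC; apply: un_lin; first exact: J0_un.
  exact: fubini_form_un.
- move=> z u v Oz; rewrite !dth // (fubini_torsion (hD Oz)) subrr scale0r sub0r.
  rewrite opprK /G -/(GN z u) -/(GN z v) -/(thH z u) -/(thH z v).
  move: (GN z u) (GN z v) (thH z u) (thH z v) (eta z u) (eta z v) => A A' t t' e e'.
  rewrite !mulmxDl -!scalemxAl mulmxBr -!scalemxAr.
  move: (A *m _) (A' *m _) (J *m t) (J *m t') => C C' Jt Jt'.
  by apply/matrixP => i j; rewrite !mxE; ring.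
- move=> z u v Oz.
  have dG e f : 'D_e (G^~ f) z = fubini_dform k (h z) (x z) (x e) (x f)
      + (beta * 'D_e (eta^~ f) z) *: J.
    have he : has_derivative (eta^~ f) z e ('D_e (eta^~ f) z).
      by split => //; exact: smooth_differentiable (smooth_eta f) Oz.
    have [_ ->] := has_derivativeD (dGN e f Oz) (has_derivative_scale
      (has_derivativeM (has_derivative_cst beta z e) he) (has_derivative_cst J z e)).
    by rewrite mul0r add0r scaler0 addr0.
  rewrite !dG -/(thH z u) -/(thH z v).
  have comm (A A' : 'M[R]_(n + n)) (s t : R) : un A -> un A' ->
      lie_mx (A + s *: J) (A' + t *: J) = lie_mx A A'.
    move=> [_ AJ] [_ AJ']; rewrite /lie_mx !mulmxDl !mulmxDr -!scalemxAl -!scalemxAr.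
    rewrite AJ AJ'; move: (A *m A') (A' *m A) (J *m A) (J *m A') (J *m J).
    by move=> *; apply/matrixP => i j; rewrite !mxE; ring.
  rewrite /G comm; try exact: fubini_form_un.
  rewrite -(fubini_curvature (hD Oz)).
  have := deta_antisym u v Oz; rewrite -!/(GN _ _).
  move: (fubini_dform _ _ _ _ _) (fubini_dform _ _ _ _ _) (lie_mx _ _).
  move: ('D_u _ z) ('D_v _ z) (omega0 _ _) => s t o F F' L E.
  have -> : s = t - 2 * delta * o by rewrite -[s](subrK t) E addrC.
  by apply/matrixP => i j; rewrite !mxE; ring.
Qed.

End KahlerModel.

(** * The classification *)

Section Sufficiency.
Context {R : realType} {n : nat}.
Local Notation H := ('cV[R]_(n + n)).
Local Notation V := ('cV[R]_(n + n + 1)).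
Local Notation gl := ('M[R]_(n + n + 1)).
Local Notation J := (@J0 R n).
Context (I0 : V -> set gl) (a b alpha beta gamma delta : R).
Context (R0 : V -> V -> gl) (c0 c1 c2 c3 c4 : R) (B : H -> H -> 'M[R]_(n + n)).
Hypothesis I0nf : inner_torsion_nf I0 a b alpha beta gamma delta.
Hypothesis R0alt : alternating_bilinear R0.
Hypothesis R0nf : curvature_nf R0 c0 c1 c2 c3 c4 B.

(** The Kaehler term [kappa] is realised by the curvature [16 * k] of the space
    form, whence the factor 16. *)
Lemma case_i_cartan : case_i a b alpha beta gamma delta c0 c1 c2 c3 c4 B ->
  exists (O : set V) th om, O 0 /\ cartan_structure O R0 I0 th om.
Proof.
move=> [alphaE _ [e1 e2 e3 e4 e0] [kappa eB]].
have k16 : 16 * (kappa / 16) = kappa by field.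
have I0nf' := I0nf; rewrite alphaE in I0nf'.
apply: (kahler_model_cartan (k := kappa / 16) I0nf') => u v.
rewrite k16 (curvature_nf_base (a := a) (b := b) (alpha := alpha) (beta := beta)
  (gamma := gamma) (delta := delta) (Om := fun X Y => kappa *: kahler_op X Y
  - (2 * beta * delta * omega0 X Y) *: J) R0alt R0nf) ?alphaE //.
- by rewrite e1; ring.
- by rewrite e3; ring.
- by rewrite e4; ring.
- by rewrite e0 e4; ring.
- move=> X Y Z; rewrite eB base_HH_mul /= mulmxBl -scalemxAl kahler_op_mul.
  by rewrite -scalemxAl addrA [RHS]addrAC.
Qed.

Lemma case_ii_cartan : case_ii a b alpha beta gamma delta c0 c1 c2 c3 c4 B ->
  exists (O : set V) th om, O 0 /\ cartan_structure O R0 I0 th om.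
Proof.
move=> [_ delta0 [e1 e2 e3 e4 [e0 _]] eB].
have I0nf' := I0nf; rewrite delta0 in I0nf'.
apply: (nonkahler_model_cartan I0nf') => u v.
rewrite (curvature_nf_base (a := a) (b := b) (alpha := alpha) (beta := beta)
  (gamma := gamma) (delta := 0) (Om := fun _ _ => 0) R0alt R0nf) //.
- by rewrite /hblock block_mx0 addr0.
- by rewrite e3; ring.
- by rewrite e4; ring.
- by rewrite e0; ring.
- move=> X Y Z; rewrite base_HH_mul eB mul0mx !scale0r !addr0 !h0Zl mulr0 mul0r scale0r subr0.
  by rewrite scalerBr !scalerA.
Qed.

End Sufficiency.

Theorem theorem4p8 (R : realType) (n : nat) (hn : (1 <= n)%N)
  (I0 : 'cV[R]_(n + n + 1) -> set 'M[R]_(n + n + 1))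
  (a b alpha beta gamma delta : R)
  (R0 : 'cV[R]_(n + n + 1) -> 'cV[R]_(n + n + 1) -> 'M[R]_(n + n + 1))
  (c0 c1 c2 c3 c4 : R)
  (B : 'cV[R]_(n + n) -> 'cV[R]_(n + n) -> 'M[R]_(n + n))
  (hI0lin : quot_linear un0 I0)
  (hI0eq : quot_equivariant Un1 I0)
  (hI0nz : I0 <> (fun=> coset un0 0))
  (hI0nf : inner_torsion_nf I0 a b alpha beta gamma delta)
  (hR0lin : alternating_bilinear R0)
  (hR0eq : equivariant2 Un1 R0)
  (hBlin : alternating_bilinear B)
  (hBeq : equivariant2 Un B)
  (hR0nf : curvature_nf R0 c0 c1 c2 c3 c4 B) :
  (exists (M : manifold R (n + n + 1)) (D : connection M)
          (P : Gstructure M Un1),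
      torsion_free D /\
      exists T0, characteristic_tensors D un0 P T0 R0 I0)
  <->
  (delta * (alpha - a) = 0 /\
   ((case_i a b alpha beta gamma delta c0 c1 c2 c3 c4 B /\
     ~ case_ii a b alpha beta gamma delta c0 c1 c2 c3 c4 B) \/
    (~ case_i a b alpha beta gamma delta c0 c1 c2 c3 c4 B /\
     case_ii a b alpha beta gamma delta c0 c1 c2 c3 c4 B))).
Proof.
have disjoint : case_i a b alpha beta gamma delta c0 c1 c2 c3 c4 B ->
    ~ case_ii a b alpha beta gamma delta c0 c1 c2 c3 c4 B.
  by move=> [alphaE _ _ _] [].
have disjoint' : case_ii a b alpha beta gamma delta c0 c1 c2 c3 c4 B ->
    ~ case_i a b alpha beta gamma delta c0 c1 c2 c3 c4 B.
  by move=> ii i; exact: disjoint i ii.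
split=> [[M [D [P [torD [T0 char]]]]]|[_ cases]].
  have [U [th [om [p [Up cs]]]]] := cartan_of_manifold un0_0 torD char.
  have [? [i|ii]] := cartan_necessary hn hI0nf hR0lin hBlin hBeq hR0nf cs Up hI0nz.
    by split=> //; left; split=> //; exact: disjoint.
  by split=> //; right; split=> //; exact: disjoint'.
have [U [th [om [U0 cs]]]] : exists (U : set 'cV[R]_(n + n + 1)) th om,
    U 0 /\ cartan_structure U R0 I0 th om.
  case: cases => [[i _]|[_ ii]]; [exact: case_i_cartan hI0nf hR0lin hR0nf i|].
  exact: case_ii_cartan hI0nf hR0lin hR0nf ii.
apply: (manifold_of_cartan Un1_1 Un1M Un1V Un1_unit un0_0 un0D un0B _ hI0lin.1
  hI0eq hR0eq hR0lin hI0lin U0 cs).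
exact: maurer_cartan_Un1.
Qed.
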